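(* Let $A$ be a finite dimensional weak $C^*$-Hopf algebra, $M$ an $A$-module algebra, and $\rho:M\to M\otimes\hat A$ the corresponding coaction. Let $\Lambda:M\rtimes A\to M\otimes\mathrm{End}\,A$ be given by $$\Lambda(m\rtimes a):=(\mathrm{id}_M\otimes\tau_L)(\rho(m))\,(1_M\otimes\ell(a)).$$ Then $\Lambda$ is a well defined (in general non-unital) injective $*$-algebra homomorphism satisfying for all $m\in M$, $a\in A$, $\varphi\in\hat A$ $$\Lambda(m\rtimes(\varphi\rightharpoonup a))=(1_M\otimes\tau_R(\varphi_{(1)}))\,\Lambda(m\rtimes a)\,(1_M\otimes\tau_R(\hat S(\varphi_{(2)}))).$$ Moreover, if $M$ is a von Neumann (or $C^*$-) algebra then $\Lambda(M\rtimes A)$ is a von Neumann (or $C^*$-) subalgebra of $M\otimes\mathrm{End}\,A$.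
   Context: A finite dimensional weak $C^*$-Hopf algebra is a finite dimensional $C^*$-algebra $A$ (unit $1$) with linear maps $\Delta:A\to A\otimes A$, $\varepsilon:A\to\mathbb C$, $S:A\to A$ such that, for all $x,y,z\in A$ in Sweedler notation: $\Delta(xy)=\Delta(x)\Delta(y)$; $\Delta(x^* )=\Delta(x)^*$; $(\Delta\otimes\mathrm{id})\Delta=(\mathrm{id}\otimes\Delta)\Delta$; $(\Delta(1)\otimes1)(1\otimes\Delta(1))=1_{(1)}\otimes1_{(2)}\otimes1_{(3)}$; $(\varepsilon\otimes\mathrm{id})\Delta=\mathrm{id}=(\mathrm{id}\otimes\varepsilon)\Delta$; $\varepsilon(xyz)=\varepsilon(xy_{(1)})\varepsilon(y_{(2)}z)$; $S(x_{(1)})x_{(2)}=1_{(1)}\varepsilon(x1_{(2)})$; $x_{(1)}S(x_{(2)})=\varepsilon(1_{(1)}x)1_{(2)}$; $S(x_{(1)})x_{(2)}S(x_{(3)})=S(x)$. ($\Delta(1)\neq 1\otimes 1$ in general; $S$ is automatically invertible.) Put $x_*:=S(x)^*$. The dual $\hat A$ is the dual vector space with $\langle\psi\varphi|x\rangle=\langle\psi\otimes\varphi|\Delta(x)\rangle$, $\langle\hat\Delta(\psi)|x\otimes y\rangle=\langle\psi|xy\rangle$, $\hat1=\varepsilon$, $\hat\varepsilon(\psi)=\langle\psi|1\rangle$, $\langle\hat S(\psi)|x\rangle=\langle\psi|S(x)\rangle$, $\langle\psi^*|x\rangle=\overline{\langle\psi|x_*\rangle}$; it is again a finite dimensional weak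 $C^*$-Hopf algebra. Write $\varphi\rightharpoonup a=a_{(1)}\langle\varphi|a_{(2)}\rangle$, $a\leftharpoonup\varphi=\langle\varphi|a_{(1)}\rangle a_{(2)}$. $A_L=\{(\varphi\otimes\mathrm{id})(\Delta(1)):\varphi\in\hat A\}$. $\hat h\in\hat A$ is the normalized Haar integral: the unique element with $\psi\hat h=\psi_{(1)}\hat S(\psi_{(2)})\hat h$, $\hat h\psi=\hat h\hat S(\psi_{(1)})\psi_{(2)}$ for all $\psi$ and $\hat S(\hat h_{(1)})\hat h_{(2)}=\hat h_{(1)}\hat S(\hat h_{(2)})=\hat1$. It is a faithful positive functional on $A$, and $(a,b):=\langle\hat h|a^*b\rangle$ is a scalar product on $A$, giving the Hilbert space $L^2(A,\hat h)$ with elements $|a\rangle$; the $*$-structure on $\mathrm{End}\,A$ is the adjoint with respect to it. On it define $\ell(a)|b\rangle=|ab\rangle$, $\tau_R(\varphi)|b\rangle=|\varphi\rightharpoonup b\rangle$, $\tau_L(\varphi)|b\rangle=|b\leftharpoonup\hat S^{-1}(\varphi)\rangle$. An $A$-module algebra is a unital $*$-algebra $M$ with a linear left action $\triangleright$ of $A$ with $(ab)\triangleright m=a\triangleright(b\triangleright m)$, $1\triangleright m=m$, $a\triangleright(mn)=(a_{(1)}\triangleright m)(a_{(2)}\triangleright n)$, $(a\triangleright m)^*=a_*\triangleright m^*$, $a\triangleright1_M=(a_{(1)}S(a_{(2)}))\triangleright1_M$; if $M$ is a $C^*$- (von Neumann) algebra, each $a\triangleright$ is required to be norm (weakly) continuous.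 The corresponding coaction $\rho$ is determined by $a\triangleright m=(\mathrm{id}\otimes a)(\rho(m))$. The crossed product $M\rtimes A=M\otimes_{A_L}A$ (elements $(m\rtimes a)$ modulo $(m\rtimes ba)=(m(b\triangleright1_M)\rtimes a)$, $b\in A_L$) has product $(m\rtimes a)(m'\rtimes a')=(m(a_{(1)}\triangleright m')\rtimes a_{(2)}a')$ and $(m\rtimes a)^*=(1_M\rtimes a^* )(m^*\rtimes1)$. In the von Neumann case $M\subset\mathcal B(\mathcal H)$, $M\otimes\mathrm{End}\,A$ acts on $\mathcal H\otimes L^2(A,\hat h)$. *)

(* Defs.v *)
(* MathComp and MathComp-Analysis, with the complex numbers R[i]. *)
From HB Require Import structures.
From mathcomp Require Import all_boot all_order all_algebra all_field.
From mathcomp Require Import all_classical all_reals.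
From mathcomp Require Import complex.

Set Implicit Arguments.
Unset Strict Implicit.
Unset Printing Implicit Defensive.

Import Order.TTheory GRing.Theory Num.Theory.
Local Open Scope ring_scope.
Local Open Scope quotient_scope.

Reserved Notation "u '\ox' v" (at level 40, left associativity).
Reserved Notation "\sw_ ( x , y <- t ) F"
  (at level 41, F at level 41, t at level 60,
   format "\sw_ ( x ,  y  <-  t )  F").

Section Tensor.
Variables (K : fieldType) (U : lmodType K) (V : vectType K).

(* The element \sum_i u_i \ox e_i of U (x) V, with (e_i) the basis
   vbasis {:V}, is stored as the family (u_i). *)
Definition tens : Type := {ffun 'I_(\dim {:V}) -> U}.
HB.instance Definition _ := GRing.Lmodule.on tens.

Definition tpure (u : U) (v : V) : tens :=
  [ffun i => coord (vbasis {:V}) i v *: u].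

Definition tlift (W : zmodType) (t : tens) (f : U -> V -> W) : W :=
  \sum_i f (t i) (vbasis {:V})`_i.
End Tensor.
HB.instance Definition _ (K : fieldType) (U V : vectType K) :=
  Vector.on (tens U V).

Notation "u '\ox' v" := (tpure u v) : ring_scope.
(* Sweedler's summation: t = \sum x \ox y. *)
Notation "\sw_ ( x , y <- t ) F" := (tlift t (fun x y => F)) : ring_scope.

(* The map induced on U (x) V by a biadditive balanced f. *)
Lemma tlift_pure (K : fieldType) (U : lmodType K) (V : vectType K)
    (W : zmodType) (f : U -> V -> W) (u : U) (v : V) :
  (forall u, {morph f u : x y / x + y}) ->
  (forall (k : K) u v, f (k *: u) v = f u (k *: v)) ->
  \sw_(x, y <- u \ox v) f x y = f u v.
Proof.
move=> fD fZ; have f0 x : f x 0 = 0.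
  by apply: (addrI (f x 0)); rewrite -(fD x 0 0) !addr0.
rewrite [in RHS](coord_vbasis (memvf v)).
rewrite (big_morph (f u) (fD u) (f0 u)).
by apply: eq_bigr => i _; rewrite ffunE fZ.
Qed.

Lemma tens_sum (K : fieldType) (U : lmodType K) (V : vectType K)
    (t : tens U V) : \sw_(x, y <- t) (x \ox y) = t.
Proof.
apply/ffunP => i; rewrite sum_ffunE (bigD1 i) //= big1 ?addr0 => [|j ji].
  by rewrite ffunE coord_free ?(basis_free (vbasisP _)) // eqxx scale1r.
by rewrite ffunE coord_free ?(basis_free (vbasisP _)) // (negPf ji) scale0r.
Qed.

Lemma linfun_linear (K : fieldType) (U V : vectType K) (f : U -> V) (x : U) :
  linear f -> linfun f x = f x.
Proof.
move=> fl; pose F : {linear U -> V} :=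
  HB.pack f (GRing.isLinear.Build _ _ _ _ f fl).
exact: (lfunE F).
Qed.

Definition tens_mul (K : fieldType) (U : lmodType K) (V : vectType K)
    (mulU : U -> U -> U) (mulV : V -> V -> V) (s t : tens U V) : tens U V :=
  \sw_(u, v <- s) \sw_(u', v' <- t) (mulU u u' \ox mulV v v').

Definition tens_star (K : fieldType) (U : lmodType K) (V : vectType K)
    (starU : U -> U) (starV : V -> V) (t : tens U V) : tens U V :=
  \sw_(u, v <- t) (starU u \ox starV v).

HB.mixin Record hasStar (R : realType) A of GRing.Algebra R[i] A := {
  star : A -> A;
  starD : {morph star : x y / x + y};
  starZ : forall (k : R[i]) (x : A), star (k *: x) = k^* *: star x;
  starM : forall x y : A, star (x * y) = star y * star x;
  starK : involutive star
}.
#[short(type="starAlgType")]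
HB.structure Definition StarAlgebra (R : realType) :=
  {A of hasStar R A & GRing.Algebra R[i] A}.

#[short(type="starFalgType")]
HB.structure Definition StarFalgebra (R : realType) :=
  {A of StarAlgebra R A & Falgebra R[i] A}.

Definition complete_wrt (R : realType) (V : zmodType) (nrm : V -> R) : Prop :=
  forall u : nat -> V,
    (forall e, 0 < e -> exists N, forall m n, (N <= m)%N -> (N <= n)%N ->
       nrm (u m - u n) < e) ->
  exists l, forall e, 0 < e -> exists N, forall n, (N <= n)%N ->
       nrm (u n - l) < e.

Record cstar_norm (R : realType) (V : lmodType R[i]) (mul : V -> V -> V)
    (st : V -> V) (nrm : V -> R) : Prop := {
  cstar_normD : forall x y, nrm (x + y) <= nrm x + nrm y;
  cstar_normZ : forall k x, nrm (k *: x) = Normc.normc k * nrm x;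
  cstar_norm_eq0 : forall x, nrm x = 0 -> x = 0;
  cstar_normM : forall x y, nrm (mul x y) <= nrm x * nrm y;
  cstar_identity : forall x, nrm (mul (st x) x) = nrm x ^+ 2;
  cstar_complete : complete_wrt nrm
}.

HB.mixin Record isWeakCstarHopf (R : realType) A of StarFalgebra R A := {
  comul : 'Hom(A, tens A A);
  counit : 'Hom(A, R[i]^o);
  antipode : 'End(A);
  weak_hopf_cstar : exists nrm : A -> R, cstar_norm *%R star nrm;
  comulM : forall x y : A,
    comul (x * y) = tens_mul *%R *%R (comul x) (comul y);
  comul_star : forall x : A, comul (star x) = tens_star star star (comul x);
  comulA : forall x : A,
    \sw_(x12, x3 <- comul x) \sw_(x1, x2 <- comul x12) (x1 \ox (x2 \ox x3))
    = \sw_(x1, x23 <- comul x) (x1 \ox comul x23);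
  (* (Delta(1) \ox 1) (1 \ox Delta(1)) = 1_(1) \ox 1_(2) \ox 1_(3) *)
  comul1 :
    \sw_(x1, x2 <- comul 1) \sw_(y1, y2 <- comul 1)
      (x1 \ox ((x2 * y1) \ox y2))
    = \sw_(x1, x23 <- comul 1) (x1 \ox comul x23);
  counit_comull : forall x : A, \sw_(x1, x2 <- comul x) (counit x1 *: x2) = x;
  counit_comulr : forall x : A, \sw_(x1, x2 <- comul x) (counit x2 *: x1) = x;
  counitM : forall x y z : A,
    counit (x * y * z)
    = \sw_(y1, y2 <- comul y) (counit (x * y1) * counit (y2 * z));
  antipodel : forall x : A,
    \sw_(x1, x2 <- comul x) (antipode x1 * x2)
    = \sw_(e1, e2 <- comul 1) (counit (x * e2) *: e1);
  antipoder : forall x : A,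
    \sw_(x1, x2 <- comul x) (x1 * antipode x2)
    = \sw_(e1, e2 <- comul 1) (counit (e1 * x) *: e2);
  antipode_lr : forall x : A,
    \sw_(x12, x3 <- comul x) \sw_(x1, x2 <- comul x12)
      (antipode x1 * x2 * antipode x3)
    = antipode x
}.
#[short(type="weakCstarHopfType")]
HB.structure Definition WeakCstarHopf (R : realType) :=
  {A of isWeakCstarHopf R A & StarFalgebra R A}.

Section Dual.
Variables (R : realType) (A : weakCstarHopfType R).

Local Notation dual := 'Hom(A, R[i]^o).

Definition dual_basis (i : 'I_(\dim {:A})) : dual :=
  linfun (coord (vbasis {:A}) i : A -> R[i]^o).

Definition hat_mul (psi phi : dual) : dual :=
  linfun (fun x => \sw_(x1, x2 <- comul x) (psi x1 * phi x2) : R[i]^o).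

Definition hat_one : dual := counit.

(* Characterized by hat_comulP. *)
Definition hat_comul (psi : dual) : tens dual dual :=
  \sum_(i < \dim {:A})
    (linfun (fun x : A => psi (x * (vbasis {:A})`_i)) \ox dual_basis i).

Lemma dual_basisE i (x : A) : dual_basis i x = coord (vbasis {:A}) i x.
Proof. by rewrite lfunE. Qed.

Lemma hat_comulP (psi : dual) (x y : A) :
  \sw_(psi1, psi2 <- hat_comul psi) (psi1 x * psi2 y) = psi (x * y).
Proof.
have sumD (F G : tens dual dual) :
    \sw_(p, q <- F + G) (p x * q y) =
    \sw_(p, q <- F) (p x * q y) + \sw_(p, q <- G) (p x * q y) :> R[i].
  by rewrite /tlift -big_split; apply: eq_bigr => i _;
     rewrite ffunE lfunE mulrDl.
have sum0 : \sw_(p, q <- 0 : tens dual dual) (p x * q y) = 0 :> R[i].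
  by rewrite /tlift big1 // => i _; rewrite ffunE lfunE mul0r.
rewrite /hat_comul (big_morph (fun F => tlift F (fun p q : dual => p x * q y)) sumD sum0).
have -> : psi (x * y) =
    \sum_(i < \dim {:A}) (psi (x * (vbasis {:A})`_i) * coord (vbasis {:A}) i y).
  rewrite [in LHS](coord_vbasis (memvf y)) mulr_sumr linear_sum.
  by apply: eq_bigr => i _; rewrite -scalerAr linearZ mulrC.
apply: eq_bigr => i _; rewrite tlift_pure; first last.
- by move=> k p q; rewrite !lfunE /= -mulrA mulrCA.
- by move=> p q r; rewrite lfunE mulrDr.
rewrite dual_basisE linfun_linear //= => k u v.
by rewrite mulrDl -scalerAl linearP.
Qed.

Definition hat_antipode : 'End(dual) :=
  linfun (fun psi : dual => (psi \o antipode)%VF : dual).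

(* phi acting on a from the left, and on a from the right *)
Definition harpoonl (phi : dual) (a : A) : A :=
  \sw_(a1, a2 <- comul a) (phi a2 *: a1).
Definition harpoonr (a : A) (phi : dual) : A :=
  \sw_(a1, a2 <- comul a) (phi a1 *: a2).

Record haar_integral (h : dual) : Prop := {
  haar_l : forall psi : dual, hat_mul psi h =
    \sw_(p1, p2 <- hat_comul psi) hat_mul (hat_mul p1 (hat_antipode p2)) h;
  haar_r : forall psi : dual, hat_mul h psi =
    \sw_(p1, p2 <- hat_comul psi) hat_mul (hat_mul h (hat_antipode p1)) p2;
  haar_norml :
    \sw_(h1, h2 <- hat_comul h) hat_mul (hat_antipode h1) h2 = hat_one;
  haar_normr :
    \sw_(h1, h2 <- hat_comul h) hat_mul h1 (hat_antipode h2) = hat_one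
}.

Definition faithful_positive (h : dual) : Prop :=
  (forall a : A, 0 <= h (star a * a)) /\
  (forall a : A, h (star a * a) = 0 -> a = 0).

Definition l2_dot (h : dual) (a b : A) : R[i] := h (star a * b).

(* The adjoint of T; it exists and is unique as l2_dot h is nondegenerate. *)
Definition l2_adj (h : dual) (T : 'End(A)) : 'End(A) :=
  xget 0 [set T' : 'End(A) |
    forall a b, l2_dot h a (T b) = l2_dot h (T' a) b]%classic.

Definition ell (a : A) : 'End(A) := linfun (fun b : A => a * b).
Definition tauR (phi : dual) : 'End(A) := linfun (harpoonl phi).
(* The antipode is bijective, so that ^-1 is a two-sided inverse. *)
Definition tauL (phi : dual) : 'End(A) :=
  linfun (fun b : A => harpoonr b ((hat_antipode^-1)%VF phi)).

Definition leftA : set A :=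
  [set b | exists phi : dual, b = \sw_(e1, e2 <- comul 1) (phi e1 *: e2)]%classic.
End Dual.

Section Quotient.
Variables (K : fieldType) (V : lmodType K) (G : set V).
Local Open Scope classical_set_scope.

Definition lspan : set V := [set v | forall W : set V,
  W 0 -> (forall (k : K) u w, W u -> W w -> W (k *: u + w)) -> G `<=` W -> W v].

Let span0 : lspan 0. Proof. by move=> W. Qed.
Let spanP (k : K) u w : lspan u -> lspan w -> lspan (k *: u + w).
Proof. by move=> hu hw W W0 WL GW; exact: WL (hu W W0 WL GW) (hw W W0 WL GW). Qed.

Let congr_rel : rel V := fun x y => `[< lspan (x - y) >].
Let congr_refl : reflexive congr_rel.
Proof. by move=> x; apply/asboolP; rewrite subrr. Qed.
Let congr_sym : symmetric congr_rel.
Proof.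
move=> x y; apply/asboolP/asboolP => h.
  by rewrite -[y - x]addr0 -[y - x]opprB -scaleN1r; exact: (spanP _ h span0).
by rewrite -[x - y]addr0 -[x - y]opprB -scaleN1r; exact: (spanP _ h span0).
Qed.
Let congr_trans : transitive congr_rel.
Proof.
move=> y x z /asboolP xy /asboolP yz; apply/asboolP.
have -> : x - z = 1 *: (x - y) + (y - z) by rewrite scale1r addrA subrK.
exact: spanP.
Qed.
Canonical lquot_equiv := EquivRel congr_rel congr_refl congr_sym congr_trans.

(* the quotient of V by the linear span of G *)
Definition lquot : Type := {eq_quot congr_rel}.
HB.instance Definition _ : EqQuotient V congr_rel lquot := EqQuotient.on lquot.
HB.instance Definition _ := Choice.on lquot.

Lemma lquot_eqP (x y : V) : \pi_lquot x = \pi_lquot y <-> lspan (x - y).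
Proof.
by split=> [/eqmodP/asboolP|h]; last by apply/eqmodP/asboolP.
Qed.

Definition lquot_zero : lquot := \pi_lquot 0.
Definition lquot_add (x y : lquot) : lquot := \pi_lquot (repr x + repr y).
Definition lquot_opp (x : lquot) : lquot := \pi_lquot (- repr x).
Definition lquot_scale (k : K) (x : lquot) : lquot := \pi_lquot (k *: repr x).

Let reprP x : lspan (repr (\pi_lquot x) - x).
Proof. by apply/lquot_eqP; rewrite reprK. Qed.

Let pi_add x y : lquot_add (\pi_lquot x) (\pi_lquot y) = \pi_lquot (x + y).
Proof.
apply/lquot_eqP; rewrite opprD addrACA.
by have := spanP 1 (reprP x) (reprP y); rewrite scale1r.
Qed.
Let pi_scale k x : lquot_scale k (\pi_lquot x) = \pi_lquot (k *: x).
Proof.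
by apply/lquot_eqP; rewrite -scalerBr -[_ *: _]addr0;
   apply: (spanP _ (reprP x) span0).
Qed.
Let pi_opp x : lquot_opp (\pi_lquot x) = \pi_lquot (- x).
Proof.
apply/lquot_eqP; rewrite opprK addrC -opprB -scaleN1r -[_ *: _]addr0.
exact: (spanP _ (reprP x) span0).
Qed.

Let addA : associative lquot_add.
Proof.
move=> x y z; rewrite -[x]reprK -[y]reprK -[z]reprK.
by rewrite (pi_add (repr y)) (pi_add (repr x) (repr y)) !pi_add addrA.
Qed.
Let addC : commutative lquot_add.
Proof. by move=> x y; rewrite -[x]reprK -[y]reprK !pi_add addrC. Qed.
Let add0 : left_id lquot_zero lquot_add.
Proof. by move=> x; rewrite -[x]reprK pi_add add0r. Qed.
Let addN : left_inverse lquot_zero lquot_opp lquot_add.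
Proof. by move=> x; rewrite -[x]reprK pi_opp pi_add addNr. Qed.
HB.instance Definition _ := GRing.isZmodule.Build lquot addA addC add0 addN.

Let scaleA k l x : lquot_scale k (lquot_scale l x) = lquot_scale (k * l) x.
Proof. by rewrite -[x]reprK (pi_scale l (repr x)) !pi_scale scalerA. Qed.
Let scale1 : left_id 1 lquot_scale.
Proof. by move=> x; rewrite -[x]reprK pi_scale scale1r. Qed.
Let scaleDr : right_distributive lquot_scale +%R.
Proof.
move=> k x y; rewrite -[x]reprK -[y]reprK.
by rewrite [X in lquot_scale k X]pi_add !pi_scale scalerDr -pi_add.
Qed.
Let scaleDl x : {morph lquot_scale^~ x : k l / k + l}.
Proof.
by move=> k l; rewrite -[x]reprK !pi_scale scalerDl -pi_add.
Qed.
HB.instance Definition _ :=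
  GRing.Zmodule_isLmodule.Build K lquot scaleA scale1 scaleDr scaleDl.

Lemma lquot_pi_linear : linear (\pi_lquot : V -> lquot).
Proof. by move=> k x y; rewrite -pi_add -pi_scale. Qed.
End Quotient.

Section CrossedProduct.
Variables (R : realType) (A : weakCstarHopfType R) (M : starAlgType R).
Variable act : A -> M -> M.
Local Notation dual := 'Hom(A, R[i]^o).

Record module_algebra : Prop := {
  act_linearl : forall m, linear (act^~ m);
  act_linearr : forall a, linear (act a);
  actA : forall a b m, act (a * b) m = act a (act b m);
  act1 : forall m, act 1 m = m;
  actM : forall a m n,
    act a (m * n) = \sw_(a1, a2 <- comul a) (act a1 m * act a2 n);
  act_star : forall a m, star (act a m) = act (star (antipode a)) (star m);
  act_one : forall a,
    act a 1 = act (\sw_(a1, a2 <- comul a) (a1 * antipode a2)) 1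
}.

(* Characterized by coactionP. *)
Definition coaction (m : M) : tens M dual :=
  \sum_(i < \dim {:A}) (act (vbasis {:A})`_i m \ox dual_basis i).

Lemma coactionP (a : A) (m : M) : linear (act^~ m) ->
  \sw_(n, phi <- coaction m) (phi a *: n) = act a m.
Proof.
move=> actl; have actE (I : finType) (k : I -> R[i]) (x : I -> A) :
    act (\sum_i k i *: x i) m = \sum_i k i *: act (x i) m.
  pose F : {linear A -> M} := HB.pack (act^~ m)
    (GRing.isLinear.Build _ _ _ _ (act^~ m) actl).
  by rewrite -[LHS]/(F _) linear_sum; apply: eq_bigr => i _; rewrite linearZ.
have sumD (F G : tens M dual) :
    \sw_(n, phi <- F + G) (phi a *: n) =
    \sw_(n, phi <- F) (phi a *: n) + \sw_(n, phi <- G) (phi a *: n).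
  by rewrite /tlift -big_split; apply: eq_bigr => i _; rewrite ffunE scalerDr.
have sum0 : \sw_(n, phi <- 0 : tens M dual) (phi a *: n) = 0.
  by rewrite /tlift big1 // => i _; rewrite ffunE scaler0.
rewrite /coaction.
rewrite (big_morph (fun F => tlift F (fun n (p : dual) => p a *: n)) sumD sum0).
rewrite [in RHS](coord_vbasis (memvf a)) actE; apply: eq_bigr => i _.
rewrite tlift_pure; first by rewrite dual_basisE.
- by move=> n p q; rewrite lfunE scalerDl.
- by move=> k n p; rewrite lfunE scalerA mulrC.
Qed.

(* M (x)_{A_L} A, with m . b = m (b |> 1) for b in A_L *)
Definition crossed_rel : set (tens M A) :=
  [set t | exists m a b, leftA b /\
     t = m \ox (b * a) - (m * act b 1) \ox a]%classic.

Definition crossed_product : Type := lquot crossed_rel.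
HB.instance Definition _ := GRing.Lmodule.on crossed_product.

Definition crossed_class (t : tens M A) : crossed_product := \pi_(lquot _) t.

Definition crossed (m : M) (a : A) : crossed_product := crossed_class (m \ox a).

(* Representatives of the product and of the involution of crossed_product:
   the product of the classes of s and t is the class of crossed_mul s t, and
   the adjoint of the class of t is the class of crossed_star t. *)
Definition crossed_mul (s t : tens M A) : tens M A :=
  \sw_(m, a <- s) \sw_(m', a' <- t) \sw_(a1, a2 <- comul a)
    ((m * act a1 m') \ox (a2 * a')).
Definition crossed_star (t : tens M A) : tens M A :=
  \sw_(m, a <- t) crossed_mul (1 \ox star a) (star m \ox 1).

Definition mend_mul : tens M 'End(A) -> tens M 'End(A) -> tens M 'End(A) :=
  tens_mul *%R (fun S T => (S \o T)%VF).
Definition mend_star (h : dual) : tens M 'End(A) -> tens M 'End(A) :=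
  tens_star star (l2_adj h).

(* (id (x) tau_L)(rho(m)) *)
Definition tauL_coaction (m : M) : tens M 'End(A) :=
  \sw_(n, phi <- coaction m) (n \ox tauL phi).
End CrossedProduct.

Section VonNeumann.
Variable R : realType.

Definition hilbert_norm (H : lmodType R[i]) (dot : H -> H -> R[i]) (x : H) : R :=
  Num.sqrt (complex.Re (dot x x)).

(* Scalar products are conjugate-linear in the first argument. *)
Record hilbert_space (H : lmodType R[i]) (dot : H -> H -> R[i]) : Prop := {
  hilbert_linear : forall x, linear (dot x : H -> R[i]^o);
  hilbert_herm : forall x y, dot y x = (dot x y)^*;
  hilbert_ge0 : forall x, 0 <= dot x x;
  hilbert_eq0 : forall x, dot x x = 0 -> x = 0;
  hilbert_complete : complete_wrt (hilbert_norm dot)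
}.

Inductive weak_topology := WeakOperator | Ultraweak.

Variables (w : weak_topology) (H : lmodType R[i]) (dot : H -> H -> R[i]).

Definition bounded_operator (T : H -> H) : Prop :=
  linear T /\
  exists c : R, forall x, hilbert_norm dot (T x) <= c * hilbert_norm dot x.

Definition weak_admissible (xi : nat -> H) : Prop :=
  match w with
  | WeakOperator => exists N, forall n, (N <= n)%N -> xi n = 0
  | Ultraweak =>
      exists c : R, forall N, \sum_(n < N) hilbert_norm dot (xi n) ^+ 2 <= c
  end.

(* The w-continuous functionals are T |-> \sum_n (xi_n, T eta_n) with xi, eta
   admissible; "|\sum_n (xi_n, T eta_n)| < e" is read off the partial sums. *)
Definition weak_lt (xi eta : nat -> H) (T : H -> H) (e : R) : Prop :=
  exists N, forall n, (N <= n)%N ->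
    Normc.normc (\sum_(k < n) dot (xi k) (T (eta k))) < e.

Definition weak_closed (S : set (H -> H)) : Prop :=
  forall T, bounded_operator T ->
    (forall (n : nat) (xi eta : 'I_n -> nat -> H) (e : R), 0 < e ->
       (forall j, weak_admissible (xi j) /\ weak_admissible (eta j)) ->
       exists2 T', S T' & forall j,
         weak_lt (xi j) (eta j) (fun x => T x - T' x) e) ->
  S T.

(* S is a (possibly degenerate) von Neumann algebra of operators on H. *)
Record von_neumann_algebra (S : set (H -> H)) : Prop := {
  vn_bounded : forall T, S T -> bounded_operator T;
  vn0 : S (fun=> 0);
  vnD : forall T T', S T -> S T' -> S (fun x => T x + T' x);
  vnZ : forall (k : R[i]) T, S T -> S (fun x => k *: T x);
  vnM : forall T T', S T -> S T' -> S (T \o T');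
  vn_adj : forall T, S T ->
    exists2 T', S T' & forall x y, dot x (T y) = dot (T' x) y;
  vn_closed : weak_closed S
}.

(* pi identifies the *-algebra M with a von Neumann algebra containing the
   identity operator of H. *)
Record von_neumann_on (M : starAlgType R) (pi : M -> H -> H) : Prop := {
  vn_hilbert : hilbert_space dot;
  vn_linear : forall x, linear (pi^~ x);
  vn_mul : forall m n x, pi (m * n) x = pi m (pi n x);
  vn_one : forall x, pi 1 x = x;
  vn_star : forall m x y, dot x (pi m y) = dot (pi (star m) x) y;
  vn_inj : forall m, (forall x, pi m x = 0) -> m = 0;
  vn_image : von_neumann_algebra (range pi)
}.

Definition weakly_continuous (M : starAlgType R) (pi : M -> H -> H)
    (f : M -> M) : Prop :=
  forall (m0 : M) (xi eta : nat -> H) (e : R),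
    weak_admissible xi -> weak_admissible eta -> 0 < e ->
  exists (n : nat) (xi' eta' : 'I_n -> nat -> H) (d : R), [/\ 0 < d,
    forall j, weak_admissible (xi' j) /\ weak_admissible (eta' j) &
    forall m, (forall j, weak_lt (xi' j) (eta' j) (pi (m - m0)) d) ->
      weak_lt xi eta (pi (f m - f m0)) e].
End VonNeumann.

Definition norm_continuous (R : realType) (V : zmodType) (nrm : V -> R)
    (f : V -> V) : Prop :=
  forall (m0 : V) (e : R), 0 < e -> exists2 d, 0 < d &
    forall m, nrm (m - m0) < d -> nrm (f m - f m0) < e.

Definition norm_closed (R : realType) (V : zmodType) (nrm : V -> R)
    (S : set V) : Prop :=
  forall x, (forall e, 0 < e -> exists2 y, S y & nrm (x - y) < e) -> S x.

Record cstar_subalgebra (R : realType) (V : lmodType R[i])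
    (mul : V -> V -> V) (st : V -> V) (nrm : V -> R) (S : set V) : Prop := {
  cstar_sub0 : S 0;
  cstar_subD : forall x y, S x -> S y -> S (x + y);
  cstar_subZ : forall (k : R[i]) x, S x -> S (k *: x);
  cstar_subM : forall x y, S x -> S y -> S (mul x y);
  cstar_sub_star : forall x, S x -> S (st x);
  cstar_sub_closed : norm_closed nrm S
}.

Section HilbertTensor.
Variables (R : realType) (A : weakCstarHopfType R) (M : starAlgType R).
Variables (H : lmodType R[i]) (dot : H -> H -> R[i]).

(* scalar product of H (x) L^2(A, h), and action of M (x) End A on it *)
Definition tens_dot (h : 'Hom(A, R[i]^o)) (x y : tens H A) : R[i] :=
  \sw_(xi, a <- x) \sw_(eta, b <- y) (dot xi eta * l2_dot h a b).

Definition tens_op (pi : M -> H -> H) (X : tens M 'End(A)) (x : tens H A) :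
    tens H A :=
  \sw_(m, T <- X) \sw_(xi, a <- x) (pi m xi \ox T a).
End HilbertTensor.

(* Main.v *)
Require Import Defs.
From HB Require Import structures.
From mathcomp Require Import all_boot all_order all_algebra all_field.
From mathcomp Require Import all_classical all_reals.
From mathcomp Require Import complex ring.

Set Implicit Arguments.
Unset Strict Implicit.
Unset Printing Implicit Defensive.

Import Order.TTheory GRing.Theory Num.Theory.
Local Open Scope ring_scope.

(* Write Delta(x) = x_1 (x) x_2, S' for the inverse of the antipode, and let
   X in M (x) End A act on M (x) A.  Then Lambda(m x| a) maps n (x) b to
   (S'(a_1 b_1) |> m) n (x) a_2 b_2.  The counital identities
   S(x_1) x_2 (x) x_3 = 1_1 (x) x 1_2 and their variants give multiplicativity,
   compatibility with the relation over A_L, and the formula for phi -> a, while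
   Lambda(m x| a)^* = Lambda((m x| a)^* ) comes from the invariance of the Haar
   functional, h(a b_2) b_1 = S(a_1) h(a_2 b).  If X(1 (x) 1) = n (x) c, put
   G(X) = c_1 |> n x| c_2; then G Lambda = id, as x_2 S'(x_1) (x) x_3 =
   1_1 (x) 1_2 x.  Hence Lambda is injective, and its range is the kernel of
   1 - Lambda G, whose matrix entries over M only involve the action of A; this
   kernel is closed in every topology for which the action and the matrix
   entries are continuous. *)

(** * Multilinear maps on tensors *)

(** The axioms are one-sided. They fix one order of the factors in (Delta(1) (x) 1)(1 (x) Delta(1))
    and one splitting of [counit (x * y * z)], and they do not state that the antipode reverses
    products and coproducts or is bijective. The mirrored forms come from the involution, which also
    supplies S' as [star (S (star x))]; the two reversals are convolution arguments with the
    counital maps x_1 S(x_2) and S(x_1) x_2. S' enters Lambda because tau_L uses the inverse of the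
    dual antipode. Tensors are stored as coordinate families, so [tlift] accepts any function, but
    its value on a pure tensor is the expected one only for multilinear functions. Identities are
    therefore stated for an arbitrary multilinear test map, and each use leaves linearity goals to
    [lin_auto]. In the von Neumann case an operator in the weak closure is not given as an element
    of M (x) End A. Its matrix entries must first be placed in the image of M, by closedness of that
    image; only then does the kernel argument apply. *)

Section Multilinear.
Variable K : fieldType.

(** An unbundled predicate can be asked of the anonymous functions under a Sweedler sum and proved
    by following their syntax. *)
Definition lin (U W : lmodType K) (f : U -> W) : Prop := linear f.
Definition bilin (U V W : lmodType K) (f : U -> V -> W) : Prop :=
  (forall u, lin (f u)) /\ (forall v, lin (f^~ v)).
Definition trilin (U V X W : lmodType K) (f : U -> V -> X -> W) : Prop :=
  [/\ forall v w, lin (fun u => f u v w), forall u w, lin (fun v => f u v w)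
    & forall u v, lin (fun w => f u v w)].

Lemma linD (U W : lmodType K) (f : U -> W) : lin f -> {morph f : x y / x + y}.
Proof. by move=> fl x y; rewrite -[x]scale1r fl !scale1r. Qed.
Lemma lin0 (U W : lmodType K) (f : U -> W) : lin f -> f 0 = 0.
Proof. by move=> fl; apply: (addrI (f 0)); rewrite -(linD fl) !addr0. Qed.
Lemma linZ (U W : lmodType K) (f : U -> W) :
  lin f -> forall k x, f (k *: x) = k *: f x.
Proof. by move=> fl k x; rewrite -[k *: x]addr0 fl (lin0 fl) addr0. Qed.
Lemma lin_sumE (U W : lmodType K) (f : U -> W) : lin f ->
  forall (I : Type) (r : seq I) (P : pred I) (F : I -> U),
  f (\sum_(i <- r | P i) F i) = \sum_(i <- r | P i) f (F i).
Proof. by move=> fl I r P F; apply: (big_morph f (linD fl) (lin0 fl)). Qed.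
Lemma linB (U W : lmodType K) (f : U -> W) : lin f -> {morph f : x y / x - y}.
Proof. by move=> fl x y; rewrite (linD fl) -scaleN1r (linZ fl) scaleN1r. Qed.

Lemma lin_id (U : lmodType K) : lin (fun x : U => x). Proof. by []. Qed.
Lemma lin_comp (U V W : lmodType K) (g : V -> W) (f : U -> V) :
  lin g -> lin f -> lin (fun x => g (f x)).
Proof. by move=> gl fl k x y; rewrite fl gl. Qed.
Lemma lin_sum (U W : lmodType K) (I : Type) (r : seq I) (P : pred I)
  (F : U -> I -> W) : (forall i, lin (F^~ i)) ->
  lin (fun x => \sum_(i <- r | P i) F x i).
Proof.
move=> Fl k x y; rewrite scaler_sumr -big_split.
by apply: eq_bigr => i _; rewrite (Fl i).
Qed.
Lemma lin_add (U W : lmodType K) (f g : U -> W) :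
  lin f -> lin g -> lin (fun x => f x + g x).
Proof. by move=> fl gl k x y; rewrite fl gl scalerDr addrACA. Qed.
Lemma lin_scalel (U W : lmodType K) (f : U -> K^o) (w : W) :
  lin f -> lin (fun x => (f x : K) *: w).
Proof. by move=> fl k x y; rewrite fl scalerDl scalerA. Qed.
Lemma lin_scaler (U W : lmodType K) (f : U -> W) (a : K) :
  lin f -> lin (fun x => a *: f x).
Proof. by move=> fl k x y; rewrite fl scalerDr !scalerA mulrC. Qed.
Lemma lin_mull (U : lmodType K) (B : algType K) (f : U -> B) (b : B) :
  lin f -> lin (fun x => f x * b).
Proof. by move=> fl k x y; rewrite fl mulrDl scalerAl. Qed.
Lemma lin_mulr (U : lmodType K) (B : algType K) (f : U -> B) (b : B) :
  lin f -> lin (fun x => b * f x).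
Proof. by move=> fl k x y; rewrite fl mulrDr scalerAr. Qed.
Lemma lin_hom (U W : vectType K) (f : 'Hom(U, W)) : lin f.
Proof. exact: linearP. Qed.
Lemma lin_app (U : lmodType K) (V W : vectType K) (f : U -> 'Hom(V, W)) (x : V) :
  lin f -> lin (fun u => f u x).
Proof. by move=> fl k u v; rewrite fl add_lfunE scale_lfunE. Qed.
Lemma lin_homc (U : lmodType K) (V W X : vectType K) (g : 'Hom(W, X))
  (f : U -> 'Hom(V, W)) : lin f -> lin (fun x => (g \o f x)%VF).
Proof.
by move=> fl k x y; apply/lfunP=> v;
   rewrite fl comp_lfunE !(add_lfunE, scale_lfunE, comp_lfunE) linearP.
Qed.
Lemma lin_homc2 (U : lmodType K) (V W X : vectType K) (g : 'Hom(V, W))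
  (f : U -> 'Hom(W, X)) : lin f -> lin (fun x => (f x \o g)%VF).
Proof.
by move=> fl k x y; apply/lfunP=> v;
   rewrite fl !(add_lfunE, scale_lfunE, comp_lfunE).
Qed.

Section Tens.
Variables (U : lmodType K) (V : vectType K).
Implicit Types (t : tens U V).

Lemma tens_ffunE (k : K) (s t : tens U V) i : (k *: s + t) i = k *: s i + t i.
Proof. by rewrite !ffunE. Qed.

Lemma eq_tlift (W : zmodType) t (f g : U -> V -> W) :
  (forall u v, f u v = g u v) -> tlift t f = tlift t g.
Proof. by move=> fg; apply: eq_bigr => i _; apply: fg. Qed.

(** The second slot of [f] is only ever evaluated at the fixed basis vectors, so linearity in [t]
    comes from the first slot. *)
Lemma lin_tlift (W X : lmodType K) (t : X -> tens U V) (f : U -> V -> W) :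
  (forall v, lin (f^~ v)) -> lin t -> lin (fun x => tlift (t x) f).
Proof.
move=> fl tl k x y; rewrite scaler_sumr -big_split; apply: eq_bigr => i _.
by rewrite tl tens_ffunE fl.
Qed.

Lemma lin_tliftf (W X : lmodType K) t (f : X -> U -> V -> W) :
  (forall u v, lin (fun x => f x u v)) -> lin (fun x => tlift t (f x)).
Proof. by move=> fl; apply: lin_sum => i. Qed.

Lemma tliftD (W : zmodType) (f : U -> V -> W) (s t : tens U V) :
  (forall v, {morph f^~ v : x y / x + y}) ->
  tlift (s + t) f = tlift s f + tlift t f.
Proof. by move=> fD; rewrite -big_split; apply: eq_bigr => i _; rewrite ffunE fD. Qed.

Lemma tlift_sum (W : zmodType) (f : U -> V -> W) (I : Type) (r : seq I)
    (P : pred I) (F : I -> tens U V) :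
  (forall v, {morph f^~ v : x y / x + y}) ->
  tlift (\sum_(i <- r | P i) F i) f = \sum_(i <- r | P i) tlift (F i) f.
Proof.
move=> fD; apply: (big_morph (fun s => tlift s f)) => [s t|]; first exact: tliftD.
rewrite /tlift big1 // => i _; rewrite ffunE.
by apply: (addrI (f 0 (vbasis {:V})`_i)); rewrite -(fD _ 0 0) !addr0.
Qed.

Lemma tlift_tlift (W : zmodType) (U' : lmodType K) (V' : vectType K)
    (t : tens U' V') (F : U' -> V' -> tens U V) (f : U -> V -> W) :
  (forall v, {morph f^~ v : x y / x + y}) ->
  tlift (tlift t F) f = tlift t (fun u v => tlift (F u v) f).
Proof. by move=> fD; rewrite tlift_sum. Qed.

Lemma tlift_pureE (W : lmodType K) (f : U -> V -> W) u v :
  bilin f -> tlift (u \ox v) f = f u v.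
Proof.
move=> [fr fl]; apply: tlift_pure => [w|k u' v']; first exact: linD.
by rewrite (linZ (fl v')) (linZ (fr u')).
Qed.

Lemma tlift_comp (W X : lmodType K) (g : W -> X) t (f : U -> V -> W) :
  lin g -> g (tlift t f) = tlift t (fun u v => g (f u v)).
Proof. by move=> gl; apply: lin_sumE. Qed.

Lemma lin_pure1 (X : lmodType K) (f : X -> U) (v : V) :
  lin f -> lin (fun x => f x \ox v).
Proof.
move=> fl k x y; apply/ffunP=> i; rewrite tens_ffunE !ffunE fl.
by rewrite scalerDr !scalerA mulrC.
Qed.

Lemma lin_pure2 (X : lmodType K) (f : X -> V) (u : U) :
  lin f -> lin (fun x => u \ox f x).
Proof.
move=> fl k x y; apply/ffunP=> i; rewrite tens_ffunE !ffunE fl linearP.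
by rewrite scalerDl scalerA.
Qed.
End Tens.

(** [tens_sum] writes [t] as a sum of pure tensors, over which [F] and [G] distribute. *)
Lemma tens_ext (U : lmodType K) (V : vectType K) (W : lmodType K)
    (F G : tens U V -> W) : lin F -> lin G ->
  (forall u v, F (u \ox v) = G (u \ox v)) -> forall t, F t = G t.
Proof.
move=> Fl Gl FG t; rewrite -(tens_sum t) (tlift_comp _ _ Fl) (tlift_comp _ _ Gl).
exact: eq_tlift.
Qed.
End Multilinear.

Lemma trilin1 (K : fieldType) (U V X W : lmodType K) (f : U -> V -> X -> W) :
  trilin f -> forall v w, lin (fun u => f u v w). Proof. by case. Qed.
Lemma trilin2 (K : fieldType) (U V X W : lmodType K) (f : U -> V -> X -> W) :
  trilin f -> forall u w, lin (fun v => f u v w). Proof. by case. Qed.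
Lemma trilin3 (K : fieldType) (U V X W : lmodType K) (f : U -> V -> X -> W) :
  trilin f -> forall u v, lin (fun w => f u v w). Proof. by case. Qed.

(* Hook for the linearity of maps defined later on. *)
Ltac lin_extra := fail.
(** Linearity is read off the syntax: [?c] cannot mention the bound variable, so a clause fires only
    when that variable sits in the slot matched by the second-order pattern. *)
Ltac lin_step :=
  match goal with
  | |- bilin _ => split=> ?; cbv beta
  | |- trilin _ => split=> ? ?; cbv beta
  | |- forall _, _ => move=> ?; cbv beta
  | H : lin ?f |- lin ?f => exact H
  | H : bilin ?f |- lin (?f ?c) => exact (proj1 H c)
  | H : trilin ?f |- lin (?f ?c ?d) => exact (trilin3 H c d)
  | |- lin (fun x => x) => exact: lin_id
  | |- @lin _ ?X ?W (fun x => ?c *: @?g x) => refine (@lin_scaler _ X W g c _)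
  | |- @lin _ ?X ?W (fun x => @?g x *: ?c) => refine (@lin_scalel _ X W g c _)
  | |- @lin _ ?X ?W (fun x => ?c * @?g x) => refine (@lin_mulr _ X _ g c _)
  | |- @lin _ ?X ?W (fun x => @?g x * ?c) => refine (@lin_mull _ X _ g c _)
  | |- @lin _ ?X ?W (fun x => @?f x + @?g x) => refine (@lin_add _ X W f g _ _)
  | |- @lin _ ?X ?W (fun x => tlift ?t (@?f x)) => refine (@lin_tliftf _ _ _ W X t f _)
  | |- @lin _ ?X ?W (fun x => tlift (@?t x) ?f) => refine (@lin_tlift _ _ _ W X t f _ _)
  | |- lin (fun x => tpure ?c (@?g x)) => apply: lin_pure2
  | |- lin (fun x => tpure (@?g x) ?c) => apply: lin_pure1
  | |- lin (fun x => bigop _ _ (@?f x)) => apply: lin_sum => ?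
  | H : bilin ?f |- lin (fun x => ?f ?c (@?g x)) => refine (lin_comp (f := g) (proj1 H c) _)
  | H : bilin ?f |- lin (fun x => ?f (@?g x) ?c) => refine (lin_comp (f := g) (proj2 H c) _)
  | H : trilin ?f |- lin (fun x => ?f (@?g x) ?c ?d) => refine (lin_comp (f := g) (trilin1 H c d) _)
  | H : trilin ?f |- lin (fun x => ?f ?c (@?g x) ?d) => refine (lin_comp (f := g) (trilin2 H c d) _)
  | H : trilin ?f |- lin (fun x => ?f ?c ?d (@?g x)) => refine (lin_comp (f := g) (trilin3 H c d) _)
  | H : lin ?f |- lin (fun x => ?f (@?g x)) => refine (lin_comp (f := g) H _)
  | |- _ => lin_extra
  | |- lin (fun x => fun_of_lfun ?h (@?g x)) => apply: (lin_comp (lin_hom h))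
  | |- lin (fun x => fun_of_lfun (@?h x) ?c) => apply: lin_app
  | |- lin ?f => lazymatch f with fun x => _ => fail | _ => change (lin (fun x => f x)) end
  end.
Ltac lin_auto := repeat lin_step.

(** * Coproduct axioms tested against multilinear maps *)

Section Comultiplication.
Variables (K : fieldType) (V : vectType K) (D : V -> tens V V).
Variables (mu : V -> V -> V) (e : V).

(** The axiom is an equation in A (x) (A (x) A); applying the linear map induced by [f] to both
    sides turns it into a rewriting rule under Sweedler sums. *)
Lemma tlift_coassoc (W : lmodType K) (f : V -> V -> V -> W) (x : V) :
  \sw_(p, c <- D x) \sw_(a, b <- D p) (a \ox (b \ox c))
  = \sw_(a, q <- D x) (a \ox D q) -> trilin f ->
  \sw_(p, c <- D x) \sw_(a, b <- D p) f a b c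
  = \sw_(a, q <- D x) \sw_(b, c <- D q) f a b c.
Proof.
move=> + fl; have E : bilin (fun a t => tlift t (f a)) by lin_auto.
have ED t : {morph (fun a => tlift t (f a)) : x y / x + y} by apply: linD; lin_auto.
move/(congr1 (fun t => tlift t (fun a t' => tlift t' (f a)))); rewrite !tlift_tlift //.
move=> H; transitivity (\sw_(a, q <- D x) tlift (a \ox D q) (fun a t => tlift t (f a)));
  last by apply: eq_tlift => a b; rewrite tlift_pureE.
rewrite -H; apply: eq_tlift => p c; rewrite tlift_tlift //.
by apply: eq_tlift => a b; rewrite !tlift_pureE //; lin_auto.
Qed.

Lemma tlift_unit (W : lmodType K) (f : V -> V -> V -> W) :
  \sw_(a, b <- D e) \sw_(c, d <- D e) (a \ox (mu b c \ox d))
  = \sw_(a, q <- D e) (a \ox D q) -> trilin f ->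
  \sw_(a, b <- D e) \sw_(c, d <- D e) f a (mu b c) d
  = \sw_(a, q <- D e) \sw_(b, c <- D q) f a b c.
Proof.
move=> + fl; have E : bilin (fun a t => tlift t (f a)) by lin_auto.
have ED t : {morph (fun a => tlift t (f a)) : x y / x + y} by apply: linD; lin_auto.
move/(congr1 (fun t => tlift t (fun a t' => tlift t' (f a)))); rewrite !tlift_tlift //.
move=> H; transitivity (\sw_(a, q <- D e) tlift (a \ox D q) (fun a t => tlift t (f a)));
  last by apply: eq_tlift => a b; rewrite tlift_pureE.
rewrite -H; apply: eq_tlift => a b; rewrite tlift_tlift //.
by apply: eq_tlift => c d; rewrite !tlift_pureE //; lin_auto.
Qed.

Lemma tlift_mul (W : lmodType K) (f : V -> V -> W) (s t : tens V V) :
  bilin f -> tlift (tens_mul mu mu s t) f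
  = \sw_(a, b <- s) \sw_(c, d <- t) f (mu a c) (mu b d).
Proof.
move=> fl; rewrite /tens_mul tlift_tlift; last by move=> v; apply: linD; lin_auto.
apply: eq_tlift => a b; rewrite tlift_tlift; last by move=> v; apply: linD; lin_auto.
by apply: eq_tlift => c d; rewrite tlift_pureE.
Qed.

Lemma tlift_star (W : lmodType K) (f : V -> V -> W) (st : V -> V) (t : tens V V) :
  bilin f -> tlift (tens_star st st t) f = \sw_(a, b <- t) f (st a) (st b).
Proof.
move=> fl; rewrite /tens_star tlift_tlift; last by move=> v; apply: linD; lin_auto.
by apply: eq_tlift => a b; rewrite tlift_pureE.
Qed.
End Comultiplication.

(* W with conjugate scalars, so that conjugate-linear maps into W are linear. *)
Definition conjmod (R : realType) (W : lmodType R[i]) : Type := W.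
HB.instance Definition _ (R : realType) (W : lmodType R[i]) :=
  GRing.Zmodule.on (conjmod W).
Section Conjmod.
Variables (R : realType) (W : lmodType R[i]).
Definition conj_scale (k : R[i]) (w : conjmod W) : conjmod W := k^* *: (w : W).
Lemma conj_scaleA k l w : conj_scale k (conj_scale l w) = conj_scale (k * l) w.
Proof. by rewrite /conj_scale scalerA rmorphM. Qed.
Lemma conj_scale1 : left_id 1 conj_scale.
Proof. by move=> w; rewrite /conj_scale rmorph1 scale1r. Qed.
Lemma conj_scaleDr : right_distributive conj_scale +%R.
Proof. by move=> k u v; apply: (@scalerDr _ W). Qed.
Lemma conj_scaleDl w : {morph conj_scale^~ w : k l / k + l}.
Proof. by move=> k l; rewrite /conj_scale rmorphD scalerDl. Qed.
HB.instance Definition _ := GRing.Zmodule_isLmodule.Build R[i] (conjmod W)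
  conj_scaleA conj_scale1 conj_scaleDr conj_scaleDl.
End Conjmod.

Lemma lin_star (R : realType) (B : starAlgType R) (W : lmodType R[i]) (f : B -> W) :
  lin f -> lin (fun x => f (star x) : conjmod W).
Proof. by move=> fl k x y; rewrite starD starZ fl. Qed.

Lemma star1 (R : realType) (B : starAlgType R) : star 1 = 1 :> B.
Proof. by rewrite -[LHS]mulr1 -[X in _ * X](starK 1) -starM mulr1 starK. Qed.

(** * Weak Hopf algebras in Sweedler calculus *)

Section Sweedler.
Variables (R : realType) (A : starAlgType R) (I : finType).
Variables (l : I -> A -> A) (r : I -> A).

(* The comultiplication is x |-> \sum_i l i x (x) r i, and [sw x f] is
   f(x_1, x_2) in Sweedler notation. *)
Definition sw (W : zmodType) (x : A) (f : A -> A -> W) : W :=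
  \sum_i f (l i x) (r i).
Local Notation "\D_ ( a , b <- x ) F" := (sw x (fun a b => F))
  (at level 41, F at level 41, x at level 60, a name, b name,
   format "\D_ ( a ,  b  <-  x )  F") : ring_scope.

Lemma eq_sw (W : zmodType) x (f g : A -> A -> W) :
  (forall a b, f a b = g a b) -> sw x f = sw x g.
Proof. by move=> fg; apply: eq_bigr => i _; apply: fg. Qed.

Lemma exchange_sw (W : zmodType) x y (f : A -> A -> A -> A -> W) :
  \D_(a, b <- x) \D_(c, d <- y) f a b c d = \D_(c, d <- y) \D_(a, b <- x) f a b c d.
Proof. exact: exchange_big. Qed.

Lemma sw_comp (W X : lmodType R[i]) (g : W -> X) x (f : A -> A -> W) :
  lin g -> g (sw x f) = sw x (fun a b => g (f a b)).
Proof. by move=> gl; apply: lin_sumE. Qed.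

Lemma lin_swf (W X : lmodType R[i]) x (f : X -> A -> A -> W) :
  (forall a b, lin (fun t => f t a b)) -> lin (fun t => sw x (f t)).
Proof. by move=> fl; apply: lin_sum. Qed.

(** The axioms in tested form. With Delta given by a finite family, interchanging two Sweedler sums
    is an exchange of finite sums, valid for every summand. *)
Record weak_hopf (counit : A -> R[i]^o) (S : A -> A) : Prop := {
  wh_comul : forall i, lin (l i);
  wh_counit : lin counit;
  wh_antipode : lin S;
  wh_coassoc : forall (W : lmodType R[i]) (f : A -> A -> A -> W) x, trilin f ->
    \D_(p, c <- x) \D_(a, b <- p) f a b c = \D_(a, q <- x) \D_(b, c <- q) f a b c;
  wh_mul : forall (W : lmodType R[i]) (f : A -> A -> W) x y, bilin f ->
    \D_(a, b <- x * y) f a b = \D_(a, b <- x) \D_(c, d <- y) f (a * c) (b * d);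
  wh_star : forall (W : lmodType R[i]) (f : A -> A -> W) x, bilin f ->
    \D_(a, b <- star x) f a b = \D_(a, b <- x) f (star a) (star b);
  wh_unit : forall (W : lmodType R[i]) (f : A -> A -> A -> W), trilin f ->
    \D_(a, b <- 1) \D_(c, d <- 1) f a (b * c) d
    = \D_(a, q <- 1) \D_(b, c <- q) f a b c;
  wh_counitl : forall x, \D_(a, b <- x) ((counit a : R[i]) *: b) = x;
  wh_counitr : forall x, \D_(a, b <- x) ((counit b : R[i]) *: a) = x;
  wh_counitM : forall x y z, counit (x * y * z)
    = \D_(a, b <- y) (counit (x * a) * counit (b * z));
  wh_Sl : forall x, \D_(a, b <- x) (S a * b)
    = \D_(a, b <- 1) ((counit (x * b) : R[i]) *: a);
  wh_Sr : forall x, \D_(a, b <- x) (a * S b)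
    = \D_(a, b <- 1) ((counit (a * x) : R[i]) *: b);
  wh_Slr : forall x, \D_(p, c <- x) \D_(a, b <- p) (S a * b * S c) = S x
}.
End Sweedler.
Arguments sw_comp {R A I l r W X g}.

Section WeakHopf.
Variables (R : realType) (A : starAlgType R) (I : finType).
Variables (l : I -> A -> A) (r : I -> A) (counit : A -> R[i]^o) (S : A -> A).
Hypothesis H : weak_hopf l r counit S.
Local Notation K := (R[i]).
Implicit Types (x y z : A) (W : lmodType K).
Local Notation "\D_ ( a , b <- x ) F" := (sw l r x (fun a b => F))
  (at level 41, F at level 41, x at level 60, a name, b name,
   format "\D_ ( a ,  b  <-  x )  F") : ring_scope.
Let ll := wh_comul H.
Let cl := wh_counit H.
Let Sl := wh_antipode H.

Lemma sw_coassoc W (f : A -> A -> A -> W) x : trilin f ->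
  \D_(p, c <- x) \D_(a, b <- p) f a b c = \D_(a, q <- x) \D_(b, c <- q) f a b c.
Proof. exact: (wh_coassoc H). Qed.
Lemma sw_mul W (f : A -> A -> W) x y : bilin f ->
  \D_(a, b <- x * y) f a b = \D_(a, b <- x) \D_(c, d <- y) f (a * c) (b * d).
Proof. exact: (wh_mul H). Qed.
Lemma sw_star W (f : A -> A -> W) x : bilin f ->
  \D_(a, b <- star x) f a b = \D_(a, b <- x) f (star a) (star b).
Proof. exact: (wh_star H). Qed.
Lemma sw_unit W (f : A -> A -> A -> W) : trilin f ->
  \D_(a, b <- 1) \D_(c, d <- 1) f a (b * c) d
  = \D_(a, q <- 1) \D_(b, c <- q) f a b c.
Proof. exact: (wh_unit H). Qed.

Lemma lin_swx W (X : lmodType K) (x : X -> A) (f : A -> A -> W) :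
  (forall b, lin (f^~ b)) -> lin x -> lin (fun t => sw l r (x t) f).
Proof.
move=> fl xl; apply: lin_sum => i.
exact: (lin_comp (fl _) (lin_comp (ll i) xl)).
Qed.
Ltac lin_extra ::=
  match goal with
  | |- @lin _ ?X ?W (fun t => sw _ _ ?x (@?f t)) => refine (@lin_swf _ _ _ _ _ W X x f _)
  | |- @lin _ ?X ?W (fun t => sw _ _ (@?x t) ?f) => refine (@lin_swx W X x f _ _)
  end.

Lemma sw_star1 W (f : A -> A -> W) : bilin f ->
  \D_(a, b <- 1) f a b = \D_(a, b <- 1) f (star a) (star b).
Proof. by move=> fl; have := sw_star 1 fl; rewrite star1. Qed.

(** The involution fixes 1, hence Delta(1), and reverses the product in the middle leg of the
    axiom. *)
Lemma sw_unit' W (f : A -> A -> A -> W) : trilin f ->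
  \D_(a, b <- 1) \D_(c, d <- 1) f a (c * b) d
  = \D_(a, q <- 1) \D_(b, c <- q) f a b c.
Proof.
move=> fl.
transitivity (\D_(a, b <- 1) \D_(c, d <- 1) f (star a) (star (b * c)) (star d)).
  rewrite sw_star1; last by lin_auto.
  apply: eq_sw => a b; rewrite sw_star1; last by lin_auto.
  by apply: eq_sw => c d; rewrite starM.
(* Composed with [star], the test map is conjugate-linear in each slot, hence linear into
   [conjmod W], and the axiom applies to it. *)
have gl : trilin (fun a b c => f (star a) (star b) (star c) : conjmod W).
  split=> u v; [exact: lin_star (trilin1 fl _ _) | exact: lin_star (trilin2 fl _ _)
    | exact: lin_star (trilin3 fl _ _)].
transitivity (\D_(a, q <- 1) \D_(b, c <- q) f (star a) (star b) (star c));
  first exact: (sw_unit gl).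
rewrite [RHS]sw_star1; last by lin_auto.
by apply: eq_sw => a b; rewrite sw_star //; lin_auto.
Qed.

Lemma sw_mulr1 W (f : A -> A -> W) x : bilin f ->
  \D_(a, b <- x) \D_(c, d <- 1) f (a * c) (b * d) = \D_(a, b <- x) f a b.
Proof. by move=> fl; rewrite -sw_mul // mulr1. Qed.

Lemma sw_mul1r W (f : A -> A -> W) x : bilin f ->
  \D_(a, b <- 1) \D_(c, d <- x) f (a * c) (b * d) = \D_(a, b <- x) f a b.
Proof. by move=> fl; rewrite -sw_mul // mul1r. Qed.

Lemma sw_counitl W (g : A -> W) x : lin g -> \D_(a, b <- x) (counit a *: g b) = g x.
Proof.
move=> gl; rewrite -[x in RHS](wh_counitl H) (sw_comp _ _ gl).
by apply: eq_sw => a b; rewrite (linZ gl).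
Qed.

Lemma sw_counitr W (g : A -> W) x : lin g -> \D_(a, b <- x) (counit b *: g a) = g x.
Proof.
move=> gl; rewrite -[x in RHS](wh_counitr H) (sw_comp _ _ gl).
by apply: eq_sw => a b; rewrite (linZ gl).
Qed.

(** The conjugate of [counit (star x)] is again a left counit, and a left counit agrees with a right
    one: apply each to x expanded by the other. *)
Lemma counit_star x : counit (star x) = (counit x : K)^* :> K.
Proof.
pose e x : K^o := ((counit (star x) : K)^*).
have el : lin e.
  move=> k u v; rewrite /e starD starZ.
  have -> : counit (k^* *: star u + star v)
    = k^* * (counit (star u) : K) + (counit (star v) : K) :> K.
    by rewrite (linD cl) (linZ cl).
  by rewrite rmorphD rmorphM /= conjCK.
have eE y : \D_(a, b <- y) (e a *: b) = y.
  apply: (can_inj (@starK R A)).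
  rewrite (sw_comp (W := A) (X := conjmod A) (g := @star R A)); last first.
    exact: lin_star (@lin_id _ A).
  transitivity (\D_(a, b <- star y) (counit a *: b)); last exact: (wh_counitl H).
  rewrite sw_star; last by lin_auto.
  by apply: eq_sw => a b; rewrite starZ conjCK.
suff -> : counit x = e x by rewrite conjCK.
rewrite -{1}[x]eE -[x in RHS](wh_counitr H) !sw_comp; [|lin_auto..].
by apply: eq_sw => a b; rewrite (linZ el) (linZ cl) [LHS]mulrC.
Qed.

Lemma scale_counitM W x y z (w : W) :
  counit (x * y * z) *: w
  = \D_(a, b <- y) (counit (x * a) *: (counit (b * z) *: w)).
Proof.
rewrite (wh_counitM H) (sw_comp (g := fun k : K^o => (k : K) *: w)); last by lin_auto.
by apply: eq_sw => a b; rewrite scalerA.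
Qed.

(** The splitting with the legs of y interchanged: the involution reverses x y z, and [counit_star]
    conjugates the values. *)
Lemma scale_counitM' W x y z (w : W) :
  counit (x * y * z) *: w
  = \D_(a, b <- y) (counit (x * b) *: (counit (a * z) *: w)).
Proof.
suff -> : counit (x * y * z) = \D_(a, b <- y) (counit (x * b) * counit (a * z)) :> K.
  rewrite (sw_comp (g := fun k : K^o => (k : K) *: w)); last by lin_auto.
  by apply: eq_sw => a b; rewrite scalerA.
rewrite -[X in counit X]starK counit_star !starM mulrA (wh_counitM H).
rewrite (sw_star (f := fun a b => (counit (star z * a) * counit (b * star x) : K^o)));
  last by lin_auto.
rewrite (sw_comp (W := K^o) (X := conjmod K^o) (g := fun k : K => k^*)); last first.
  by move=> k u v; rewrite rmorphD rmorphM.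
apply: eq_sw => a b.
by rewrite rmorphM mulrC; congr (_ * _); apply: (etrans (esym (counit_star _)));
  rewrite starM !starK.
Qed.

(** * The counital maps: [tcounit], with image A_L, and its mirror [scounit] *)

Definition tcounit x : A := \D_(a, b <- x) (a * S b).
Definition scounit x : A := \D_(a, b <- x) (S a * b).

Lemma lin_tcounit : lin tcounit. Proof. by rewrite /tcounit; lin_auto. Qed.
Lemma lin_scounit : lin scounit. Proof. by rewrite /scounit; lin_auto. Qed.
Ltac lin_extra ::=
  match goal with
  | |- @lin _ ?X ?W (fun t => sw _ _ ?x (@?f t)) => refine (@lin_swf _ _ _ _ _ W X x f _)
  | |- @lin _ ?X ?W (fun t => sw _ _ (@?x t) ?f) => refine (@lin_swx W X x f _ _)
  | |- lin (fun t => tcounit (@?x t)) => apply: (lin_comp lin_tcounit)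
  | |- lin (fun t => scounit (@?x t)) => apply: (lin_comp lin_scounit)
  end.

Lemma lin_tcounitE W (g : A -> W) x : lin g ->
  g (tcounit x) = \D_(c, d <- 1) (counit (c * x) *: g d).
Proof.
move=> gl; rewrite /tcounit (wh_Sr H) (sw_comp _ _ gl).
by apply: eq_sw => c d; rewrite (linZ gl).
Qed.
Lemma lin_scounitE W (g : A -> W) x : lin g ->
  g (scounit x) = \D_(c, d <- 1) (counit (x * d) *: g c).
Proof.
move=> gl; rewrite /scounit (wh_Sl H) (sw_comp _ _ gl).
by apply: eq_sw => c d; rewrite (linZ gl).
Qed.

(** Delta(x) = Delta(x) Delta(1) creates a second copy of Delta(1); the unit axiom fuses both into
    1_1 (x) 1_2 (x) 1_3, and the counit collapses Delta(x 1_2). *)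
Lemma sw_scounitl W (f : A -> A -> W) x : bilin f ->
  \D_(a, b <- x) f (scounit a) b = \D_(a, b <- 1) f a (x * b).
Proof.
move=> fl; transitivity (\D_(a, b <- x) \D_(c, d <- 1) (counit (a * d) *: f c b)).
  by apply: eq_sw => a b; apply: (lin_scounitE (g := f^~ b)); lin_auto.
rewrite -(sw_mulr1 (f := fun a b => \D_(c, d <- 1) (counit (a * d) *: f c b)));
  last by lin_auto.
transitivity (\D_(a, b <- x) \D_(c, d <- 1) \D_(p, q <- 1)
    (counit (a * (p * d)) *: f c (b * q))).
  apply: eq_sw => a b; rewrite exchange_sw.
  by do 2!apply: eq_sw => ? ?; rewrite mulrA.
rewrite exchange_sw.
transitivity (\D_(c, d <- 1) \D_(d1, d2 <- d) \D_(a, b <- x)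
    (counit (a * d1) *: f c (b * d2))).
  rewrite -(sw_unit' (f := fun c d1 d2 => \D_(a, b <- x)
    (counit (a * d1) *: f c (b * d2)))); last by lin_auto.
  by apply: eq_sw => c d; rewrite exchange_sw.
apply: eq_sw => c d; rewrite -(sw_counitl (g := f c)) ?sw_mul //; lin_auto.
exact: exchange_sw.
Qed.

Lemma sw_tcounitr W (f : A -> A -> W) x : bilin f ->
  \D_(a, b <- x) f a (tcounit b) = \D_(a, b <- 1) f (a * x) b.
Proof.
move=> fl; transitivity (\D_(a, b <- x) \D_(c, d <- 1) (counit (c * b) *: f a d)).
  by apply: eq_sw => a b; apply: (lin_tcounitE (g := f a)); lin_auto.
rewrite -(sw_mul1r (f := fun a b => \D_(c, d <- 1) (counit (c * b) *: f a d)));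
  last by lin_auto.
transitivity (\D_(p, q <- 1) \D_(c, d <- 1) \D_(a, b <- x)
    (counit (c * q * b) *: f (p * a) d)).
  apply: eq_sw => p q; rewrite exchange_sw.
  by do 2!apply: eq_sw => ? ?; rewrite mulrA.
rewrite (sw_unit' (f := fun p q d => \D_(a, b <- x)
  (counit (q * b) *: f (p * a) d))); last by lin_auto.
rewrite -(sw_coassoc (f := fun p q d => \D_(a, b <- x)
  (counit (q * b) *: f (p * a) d))); last by lin_auto.
apply: eq_sw => c d; rewrite -(sw_counitr (g := f^~ d)) ?sw_mul //; lin_auto.
Qed.

(** Splitting the counit at 1 gives one Delta(1), writing Delta(x) as Delta(x) Delta(1) gives
    another, and the unit axiom fuses them. This feeds the counital identity [sw_scounitr], where S
    appears. *)
Lemma sw_counit_mulr W (g : A -> W) x z : lin g ->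
  \D_(a, b <- x) (counit (b * z) *: g a)
  = \D_(a, b <- 1) (counit (b * z) *: g (x * a)).
Proof.
move=> gl.
transitivity (\D_(a, b <- x) \D_(c, d <- 1)
    (counit (b * c) *: (counit (d * z) *: g a))).
  by apply: eq_sw => a b; rewrite -scale_counitM mulr1.
rewrite -(sw_mulr1 (f := fun a b => \D_(c, d <- 1)
    (counit (b * c) *: (counit (d * z) *: g a)))); last by lin_auto.
transitivity (\D_(p, q <- 1) \D_(c, d <- 1) \D_(a, b <- x)
    (counit (b * (q * c)) *: (counit (d * z) *: g (a * p)))).
  rewrite exchange_sw; apply: eq_sw => p q; rewrite exchange_sw.
  by do 2!apply: eq_sw => ? ?; rewrite mulrA.
rewrite (sw_unit (f := fun p q d => \D_(a, b <- x)
    (counit (b * q) *: (counit (d * z) *: g (a * p))))); last by lin_auto.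
rewrite -(sw_coassoc (f := fun p q d => \D_(a, b <- x)
    (counit (b * q) *: (counit (d * z) *: g (a * p))))); last by lin_auto.
apply: eq_sw => c d.
rewrite -(sw_counitr (g := fun a => counit (d * z) *: g a)) ?sw_mul //; lin_auto.
exact: exchange_sw.
Qed.

Lemma sw_counit_mull W (g : A -> W) x z : lin g ->
  \D_(a, b <- x) (counit (z * a) *: g b)
  = \D_(a, b <- 1) (counit (z * a) *: g (b * x)).
Proof.
move=> gl.
transitivity (\D_(a, b <- x) \D_(c, d <- 1)
    (counit (d * a) *: (counit (z * c) *: g b))).
  apply: eq_sw => a b; rewrite -[z in LHS]mulr1 scale_counitM.
  by apply: eq_sw => ? ?; rewrite !scalerA mulrC.
rewrite -(sw_mul1r (f := fun a b => \D_(c, d <- 1)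
    (counit (d * a) *: (counit (z * c) *: g b)))); last by lin_auto.
transitivity (\D_(c, d <- 1) \D_(p, q <- 1) \D_(a, b <- x)
    (counit (d * p * a) *: (counit (z * c) *: g (q * b)))).
  rewrite [RHS]exchange_sw; apply: eq_sw => p q; rewrite exchange_sw.
  by do 2!apply: eq_sw => ? ?; rewrite mulrA.
rewrite (sw_unit (f := fun c p q => \D_(a, b <- x)
    (counit (p * a) *: (counit (z * c) *: g (q * b))))); last by lin_auto.
apply: eq_sw => c d.
rewrite -(sw_counitl (g := fun a => counit (z * c) *: g a)) ?sw_mul //; lin_auto.
Qed.
Local Notation et := tcounit.
Local Notation es := scounit.

Lemma scounit1 : es 1 = 1.
Proof.
rewrite (lin_scounitE 1 (@lin_id _ A)); under eq_sw do rewrite mul1r.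
exact: (wh_counitr H).
Qed.

Lemma tcounit1 : et 1 = 1.
Proof.
rewrite (lin_tcounitE 1 (@lin_id _ A)); under eq_sw do rewrite mulr1.
exact: (wh_counitl H).
Qed.

Lemma sw1_tcounitr W (f : A -> A -> W) : bilin f ->
  \D_(a, b <- 1) f a (et b) = \D_(a, b <- 1) f a b.
Proof. by move=> fl; rewrite sw_tcounitr //; under eq_sw do rewrite mulr1. Qed.
Lemma sw1_scounitl W (f : A -> A -> W) : bilin f ->
  \D_(a, b <- 1) f (es a) b = \D_(a, b <- 1) f a b.
Proof. by move=> fl; rewrite sw_scounitl //; under eq_sw do rewrite mul1r. Qed.

(** [scounit x] is made of left legs and [tcounit y] of right legs of Delta(1); the two products are
    the middle legs in [sw_unit'] and [sw_unit], which have the same value. *)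
Lemma scounit_tcounitC x y : es x * et y = et y * es x.
Proof.
have tE z : et y * z = \D_(a, b <- 1) (counit (a * y) *: (b * z)).
  by apply: (lin_tcounitE (g := fun t => t * z)); lin_auto.
have tE' z : z * et y = \D_(a, b <- 1) (counit (a * y) *: (z * b)).
  by apply: (lin_tcounitE (g := fun t => z * t)); lin_auto.
rewrite (lin_scounitE (g := fun s => s * et y)); last by lin_auto.
rewrite (lin_scounitE (g := fun s => et y * s)); last by lin_auto.
transitivity (\D_(a, b <- 1) \D_(c, d <- 1)
   (counit (a * y) *: (counit (x * d) *: (c * b)))).
  rewrite [RHS]exchange_sw; apply: eq_sw => c d.
  rewrite tE' (sw_comp (g := fun w => counit (x * d) *: w)); last by lin_auto.
  by apply: eq_sw => a b; rewrite !scalerA mulrC.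
rewrite (sw_unit' (f := fun a b d => counit (a * y) *: (counit (x * d) *: b)));
  last by lin_auto.
rewrite -(sw_unit (f := fun a b d => counit (a * y) *: (counit (x * d) *: b)));
  last by lin_auto.
rewrite exchange_sw; apply: eq_sw => c d.
rewrite tE (sw_comp (g := fun w => counit (x * d) *: w)); last by lin_auto.
by apply: eq_sw => a b; rewrite !scalerA mulrC.
Qed.

(** The mirrored splitting at 1: counit (p x 1_2) counit (1_1 y) = counit (p x y). *)
Lemma tcounit_mulr x y : et (x * et y) = et (x * y).
Proof.
rewrite (lin_tcounitE (g := fun z => et (x * z))); last by lin_auto.
rewrite [RHS](lin_tcounitE (g := id)); last by lin_auto.
transitivity (\D_(p, q <- 1) \D_(c, d <- 1)
   (counit (p * x * d) *: (counit (c * y) *: q))).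
  rewrite exchange_sw; apply: eq_sw => c d.
  rewrite (lin_tcounitE (g := fun z => counit (c * y) *: z)); last by lin_auto.
  by apply: eq_sw => a b; rewrite mulrA.
by apply: eq_sw => c d; rewrite -scale_counitM' mulr1 mulrA.
Qed.

Lemma scounit_mull x y : es (es x * y) = es (x * y).
Proof.
rewrite (lin_scounitE (g := fun z => es (z * y))); last by lin_auto.
rewrite [RHS](lin_scounitE (g := id)); last by lin_auto.
transitivity (\D_(p, q <- 1) \D_(c, d <- 1)
   (counit (x * d) *: (counit (c * (y * q)) *: p))).
  rewrite exchange_sw; apply: eq_sw => c d.
  rewrite (lin_scounitE (g := fun z => counit (x * d) *: z)); last by lin_auto.
  by apply: eq_sw => a b; rewrite -mulrA !scalerA [in LHS]mulrC.
by apply: eq_sw => c d; rewrite -scale_counitM' mulr1 mulrA.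
Qed.

(** [tcounit y] is a combination of right legs of Delta(1), and the unit axiom expands the coproduct
    of such a leg. *)
Lemma sw_tcounit W (f : A -> A -> W) y : bilin f ->
  \D_(a, b <- et y) f a b = \D_(a, b <- 1) f (et y * a) b.
Proof.
move=> fl; rewrite (lin_tcounitE (g := fun z => sw l r z f)); last by lin_auto.
transitivity (\D_(c, d <- 1) \D_(a, b <- 1) (counit (c * y) *: f (d * a) b)).
  rewrite (sw_unit (f := fun c a b => counit (c * y) *: f a b)); last by lin_auto.
  by apply: eq_sw => c d; rewrite (sw_comp (g := fun w => counit (c * y) *: w)); lin_auto.
rewrite exchange_sw; apply: eq_sw => a b.
by rewrite (lin_tcounitE (g := fun z => f (z * a) b)) //; lin_auto.
Qed.

Lemma sw_tcounit' W (f : A -> A -> W) y : bilin f ->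
  \D_(a, b <- et y) f a b = \D_(a, b <- 1) f (a * et y) b.
Proof.
move=> fl; rewrite (lin_tcounitE (g := fun z => sw l r z f)); last by lin_auto.
transitivity (\D_(c, d <- 1) \D_(a, b <- 1) (counit (c * y) *: f (a * d) b)).
  rewrite (sw_unit' (f := fun c a b => counit (c * y) *: f a b)); last by lin_auto.
  by apply: eq_sw => c d; rewrite (sw_comp (g := fun w => counit (c * y) *: w)); lin_auto.
rewrite exchange_sw; apply: eq_sw => a b.
by rewrite (lin_tcounitE (g := fun z => f (a * z) b)) //; lin_auto.
Qed.

Lemma sw_scounit W (f : A -> A -> W) y : bilin f ->
  \D_(a, b <- es y) f a b = \D_(a, b <- 1) f a (es y * b).
Proof.
move=> fl; rewrite (lin_scounitE (g := fun z => sw l r z f)); last by lin_auto.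
transitivity (\D_(a, b <- 1) \D_(c, d <- 1) (counit (y * d) *: f a (c * b))).
  rewrite (sw_unit' (f := fun a b d => counit (y * d) *: f a b)); last by lin_auto.
  rewrite -(sw_coassoc (f := fun a b d => counit (y * d) *: f a b)); last by lin_auto.
  by apply: eq_sw => c d; rewrite (sw_comp (g := fun w => counit (y * d) *: w)); lin_auto.
apply: eq_sw => a b.
by rewrite (lin_scounitE (g := fun z => f a (z * b))) //; lin_auto.
Qed.

Lemma sw_mul_tcounit W (f : A -> A -> W) x y : bilin f ->
  \D_(a, b <- x * et y) f a b = \D_(a, b <- x) f (a * et y) b.
Proof.
move=> fl; rewrite sw_mul // -[RHS]sw_mulr1; last by lin_auto.
apply: eq_sw => a b; rewrite sw_tcounit'; last by lin_auto.
by apply: eq_sw => c d; rewrite mulrA.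
Qed.

Lemma sw_tcounit_mul W (f : A -> A -> W) x y : bilin f ->
  \D_(a, b <- et y * x) f a b = \D_(a, b <- x) f (et y * a) b.
Proof.
move=> fl; rewrite sw_mul // -[RHS]sw_mul1r; last by lin_auto.
rewrite sw_tcounit; last by lin_auto.
by do 2!apply: eq_sw => ? ?; rewrite mulrA.
Qed.

Lemma sw_scounit_mul W (f : A -> A -> W) x y : bilin f ->
  \D_(a, b <- es y * x) f a b = \D_(a, b <- x) f a (es y * b).
Proof.
move=> fl; rewrite sw_mul // -[RHS]sw_mul1r; last by lin_auto.
rewrite sw_scounit; last by lin_auto.
by do 2!apply: eq_sw => ? ?; rewrite mulrA.
Qed.

(** * The antipode reverses products and coproducts *)

Lemma antipodeEl x : \D_(a, b <- x) (es a * S b) = S x.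
Proof.
rewrite -[RHS](wh_Slr H); apply: eq_sw => a b.
by rewrite (sw_comp (g := fun z => z * S b)); lin_auto.
Qed.

Lemma antipodeEr x : \D_(a, b <- x) (S a * et b) = S x.
Proof.
rewrite -[RHS](wh_Slr H) (sw_coassoc (f := fun a b c => S a * b * S c)); last by lin_auto.
apply: eq_sw => a b; rewrite (sw_comp (g := fun z => S a * z)); last by lin_auto.
by apply: eq_sw => ? ?; rewrite mulrA.
Qed.

(** S(xy) = S(x_1 y_1) x_2 y_2 S(y_3) S(x_3) = S(y_1) scounit(x_1) tcounit(y_2) S(x_2); the two
    counital factors commute, and each is then absorbed by the antipode next to it. *)
Lemma antipodeM x y : S (x * y) = S y * S x.
Proof.
rewrite -[LHS]antipodeEr sw_mul; last by lin_auto.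
transitivity (\D_(x', q <- x) \D_(y', s <- y) \D_(a, p <- x') \D_(c, r <- y')
    (S (a * c) * (p * r) * S s * S q)).
  transitivity (\D_(a, b <- x) \D_(c, d <- y) \D_(p, q <- b) \D_(r, s <- d)
      (S (a * c) * (p * r) * S s * S q)).
    do 2!(apply: eq_sw => ? ?); rewrite -tcounit_mulr /tcounit.
    rewrite sw_mul_tcounit; last by lin_auto.
    rewrite (sw_comp (g := fun z => S _ * z)); last by lin_auto.
    apply: eq_sw => p q; rewrite (sw_comp (g := fun z => S _ * (p * z * S q)));
      last by lin_auto.
    by apply: eq_sw => ? ?; rewrite !mulrA.
  under eq_sw => a b do rewrite exchange_sw.
  rewrite -(sw_coassoc (f := fun a p q => \D_(c, d <- y) \D_(r, s <- d)
      (S (a * c) * (p * r) * S s * S q))); last by lin_auto.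
  apply: eq_sw => x' q; rewrite [RHS]exchange_sw; apply: eq_sw => a p.
  by rewrite -(sw_coassoc (f := fun c r s => S (a * c) * (p * r) * S s * S q)); lin_auto.
transitivity (\D_(x', q <- x) \D_(y', s <- y) (es (x' * y') * S s * S q)).
  apply: eq_sw => x' q; apply: eq_sw => y' s; rewrite /scounit sw_mul; last by lin_auto.
  rewrite (sw_comp (g := fun z => z * S s * S q)); last by lin_auto.
  by apply: eq_sw => ? ?; rewrite (sw_comp (g := fun z => z * S s * S q)) //; lin_auto.
transitivity (\D_(x', q <- x) \D_(c, d <- y) (S c * et d * (es x' * S q))); last first.
  rewrite -(antipodeEl x) (sw_comp (g := fun z => S y * z)); last by lin_auto.
  apply: eq_sw => x' q; rewrite -(antipodeEr y) (sw_comp (g := fun z => z * (es x' * S q))) //.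
  by lin_auto.
apply: eq_sw => x' q.
transitivity (\D_(y', s <- y) \D_(c, r <- y') (S c * (es x' * r) * S s * S q)).
  apply: eq_sw => y' s; rewrite -scounit_mull {1}/scounit sw_scounit_mul; last by lin_auto.
  by rewrite (sw_comp (g := fun z => z * S s * S q)); lin_auto.
rewrite (sw_coassoc (f := fun c r s => S c * (es x' * r) * S s * S q)); last by lin_auto.
apply: eq_sw => c d; rewrite -[RHS]mulrA [X in _ * X]mulrA -scounit_tcounitC /tcounit.
rewrite (sw_comp (g := fun z => S c * (es x' * z * S q))); last by lin_auto.
by apply: eq_sw => ? ?; rewrite !mulrA.
Qed.

Lemma antipode1 : S 1 = 1.
Proof.
rewrite -antipodeEl -[RHS]tcounit1 (sw1_scounitl (f := fun a b => a * S b)) //; lin_auto.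
Qed.

Lemma antipode_scounit y : S (es y) = et (es y).
Proof.
rewrite /tcounit sw_scounit; last by lin_auto.
under eq_sw => a b do rewrite antipodeM mulrA.
rewrite -(sw_comp (g := fun z => z * S (es y))); last by lin_auto.
by rewrite -/(et 1) tcounit1 mul1r.
Qed.

Lemma antipode_tcounit y : S (et y) = es (et y).
Proof.
rewrite /scounit sw_tcounit'; last by lin_auto.
under eq_sw => a b do rewrite antipodeM -mulrA.
rewrite -(sw_comp (g := fun z => S (et y) * z)); last by lin_auto.
by rewrite -/(es 1) scounit1 mulr1.
Qed.

(** Right legs of Delta(1) may be replaced by their [tcounit], on which S and [scounit] coincide. *)
Lemma sw1_scounitr W (f : A -> A -> W) : bilin f ->
  \D_(a, b <- 1) f a (es b) = \D_(a, b <- 1) f a (S b).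
Proof.
move=> fl; rewrite -(sw1_tcounitr (f := fun a b => f a (es b))); last by lin_auto.
rewrite -[RHS]sw1_tcounitr; last by lin_auto.
by under eq_sw => a b do rewrite -antipode_tcounit.
Qed.

Lemma sw1_tcounitl W (f : A -> A -> W) : bilin f ->
  \D_(a, b <- 1) f (et a) b = \D_(a, b <- 1) f (S a) b.
Proof.
move=> fl; rewrite -(sw1_scounitl (f := fun a b => f (et a) b)); last by lin_auto.
rewrite -[RHS](sw1_scounitl (f := fun a b => f (S a) b)); last by lin_auto.
by under eq_sw => a b do rewrite -antipode_scounit.
Qed.

Lemma sw_scounitr W (f : A -> A -> W) x : bilin f ->
  \D_(a, b <- x) f a (es b) = \D_(a, b <- 1) f (x * a) (S b).
Proof.
move=> fl; transitivity (\D_(a, b <- x) \D_(c, d <- 1) (counit (b * d) *: f a c)).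
  by apply: eq_sw => a b; apply: (lin_scounitE (g := f a)); lin_auto.
rewrite -(sw1_scounitr (f := fun a b => f (x * a) b)); last by lin_auto.
transitivity (\D_(a, b <- 1) \D_(c, d <- 1) (counit (b * d) *: f (x * a) c)).
  rewrite exchange_sw [RHS]exchange_sw; apply: eq_sw => c d.
  by apply: (sw_counit_mulr (g := f^~ c)); lin_auto.
by apply: eq_sw => a b; rewrite (lin_scounitE (g := f (x * a))); lin_auto.
Qed.

Lemma sw_tcounitl W (f : A -> A -> W) x : bilin f ->
  \D_(a, b <- x) f (et a) b = \D_(a, b <- 1) f (S a) (b * x).
Proof.
move=> fl; transitivity (\D_(a, b <- x) \D_(c, d <- 1) (counit (c * a) *: f d b)).
  by apply: eq_sw => a b; apply: (lin_tcounitE (g := f^~ b)); lin_auto.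
rewrite -(sw1_tcounitl (f := fun a b => f a (b * x))); last by lin_auto.
transitivity (\D_(a, b <- 1) \D_(c, d <- 1) (counit (c * a) *: f d (b * x))).
  rewrite exchange_sw [RHS]exchange_sw; apply: eq_sw => c d.
  by apply: (sw_counit_mull (g := f d)); lin_auto.
by apply: eq_sw => a b; rewrite (lin_tcounitE (g := f^~ (b * x))); lin_auto.
Qed.
(** The left side becomes scounit(1_2) (x) tcounit(1_1). Expanding both maps yields two counits that
    recombine at the unit, which leaves 1_1 (x) tcounit(1_2). *)
Lemma sw1_antipode W (f : A -> A -> W) : bilin f ->
  \D_(a, b <- 1) f (S b) (S a) = \D_(a, b <- 1) f a b.
Proof.
move=> fl; transitivity (\D_(a, b <- 1) f (es b) (et a)).
  rewrite -(sw1_scounitr (f := fun a b => f b (S a))); last by lin_auto.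
  rewrite -(sw1_scounitl (f := fun a b => f (es b) (S a))); last by lin_auto.
  under eq_sw => a b do rewrite antipode_scounit.
  by rewrite (sw1_scounitl (f := fun a b => f (es b) (et a))); lin_auto.
transitivity (\D_(c, d <- 1) \D_(p, q <- 1) (counit (p * d) *: f c q)).
  transitivity (\D_(a, b <- 1) \D_(c, d <- 1) \D_(p, q <- 1)
      (counit (p * a) *: (counit (b * d) *: f c q))).
    apply: eq_sw => a b; rewrite (lin_scounitE (g := f^~ (et a))); last by lin_auto.
    apply: eq_sw => c d.
    rewrite (lin_tcounitE (g := fun z => counit (b * d) *: f c z)) //; lin_auto.
  rewrite exchange_sw; apply: eq_sw => c d; rewrite exchange_sw; apply: eq_sw => p q.
  by rewrite -scale_counitM mulr1.
rewrite -(sw1_tcounitr fl); apply: eq_sw => c d.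
by rewrite (lin_tcounitE (g := f c)) //; lin_auto.
Qed.

Lemma sw_antipode_unit W (f : A -> A -> W) x : bilin f ->
  \D_(a, b <- x) \D_(c, d <- 1) f (S b * c) (S a * d)
  = \D_(a, b <- x) f (S b) (S a).
Proof.
move=> fl.
rewrite -[RHS](sw_mul1r (f := fun a b => f (S b) (S a))); last by lin_auto.
rewrite exchange_sw.
rewrite -(sw1_antipode (f := fun c d => \D_(a, b <- x) f (S b * c) (S a * d)));
  last by lin_auto.
by do 2!(apply: eq_sw => ? ?); rewrite !antipodeM.
Qed.

(** Uniqueness of the convolution inverse of Delta, in the weak form where Delta(scounit x) and
    Delta(tcounit x) replace the unit: [conv] inserts S(x_2) (x) S(x_1) on the left, and Delta(x_3)
    Delta(S(x_4)) then collapses to Delta(tcounit(x_3)). *)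
Lemma sw_antipode W (f : A -> A -> W) x : bilin f ->
  \D_(a, b <- S x) f a b = \D_(a, b <- x) f (S b) (S a).
Proof.
move=> fl.
have conv p (g : A -> A -> W) : bilin g ->
    \D_(u, v <- p) \D_(a, b <- u) \D_(c, d <- v) g (S b * c) (S a * d)
    = \D_(a, b <- es p) g a b.
  move=> gl.
  rewrite (sw_coassoc (f := fun a b v => \D_(c, d <- v) g (S b * c) (S a * d)));
    last by lin_auto.
  transitivity (\D_(a, t <- p) \D_(m, d <- 1) g m (S a * (t * d))).
    apply: eq_sw => a t.
    rewrite -(sw_coassoc (f := fun b c d => g (S b * c) (S a * d))); last by lin_auto.
    rewrite -(sw_scounitl (f := fun m d => g m (S a * d))); last by lin_auto.
    apply: eq_sw => m d; rewrite (sw_comp (g := fun z => g z (S a * d))) //; lin_auto.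
  rewrite exchange_sw (sw_scounit _ gl); apply: eq_sw => c d.
  rewrite (sw_comp (g := fun z => g c (z * d))); last by lin_auto.
  by apply: eq_sw => ? ?; rewrite mulrA.
transitivity (\D_(p, q <- x) \D_(u, v <- p) \D_(a, b <- u) \D_(c, d <- v)
    \D_(s, t <- S q) f (S b * c * s) (S a * d * t)).
  rewrite -{1}(antipodeEl x) (sw_comp (g := fun z => sw l r z f)); last by lin_auto.
  apply: eq_sw => p q; rewrite sw_mul //.
  rewrite -(conv p (fun a b => \D_(s, t <- S q) f (a * s) (b * t))) //.
  by lin_auto.
rewrite (sw_coassoc (f := fun u v q => \D_(a, b <- u) \D_(c, d <- v)
    \D_(s, t <- S q) f (S b * c * s) (S a * d * t))); last by lin_auto.
transitivity (\D_(u, z <- x) \D_(a, b <- u) \D_(c, d <- 1)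
    f (S b * (et z * c)) (S a * d)).
  apply: eq_sw => u z; rewrite [LHS]exchange_sw; apply: eq_sw => a b.
  rewrite -(sw_tcounit (f := fun c d => f (S b * c) (S a * d))); last by lin_auto.
  rewrite (sw_comp (g := fun w => sw l r w _)); last by lin_auto.
  apply: eq_sw => v q; rewrite (sw_mul (f := fun c d => f (S b * c) (S a * d))); last by lin_auto.
  by do 2!(apply: eq_sw => ? ?); rewrite !mulrA.
rewrite (sw_coassoc (f := fun a b z => \D_(c, d <- 1) f (S b * (et z * c)) (S a * d)));
  last by lin_auto.
rewrite -sw_antipode_unit //; apply: eq_sw => a b; rewrite exchange_sw.
apply: eq_sw => c d; rewrite -(antipodeEr b).
rewrite (sw_comp (g := fun z => f (z * c) (S a * d))); last by lin_auto.
by apply: eq_sw => ? ?; rewrite mulrA.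
Qed.

(* The inverse of the antipode, by [antipode_sinv] and [sinv_antipode]. *)
Definition sinv x : A := star (S (star x)).

Lemma lin_sinv : lin sinv.
Proof. by move=> k x y; rewrite /sinv starD starZ Sl starD starZ conjCK. Qed.
Ltac lin_extra ::=
  match goal with
  | |- @lin _ ?X ?W (fun t => sw _ _ ?x (@?f t)) => refine (@lin_swf _ _ _ _ _ W X x f _)
  | |- @lin _ ?X ?W (fun t => sw _ _ (@?x t) ?f) => refine (@lin_swx W X x f _ _)
  | |- lin (fun t => tcounit (@?x t)) => apply: (lin_comp lin_tcounit)
  | |- lin (fun t => scounit (@?x t)) => apply: (lin_comp lin_scounit)
  | |- lin (fun t => sinv (@?x t)) => apply: (lin_comp lin_sinv)
  end.

Lemma sinvM x y : sinv (x * y) = sinv y * sinv x.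
Proof. by rewrite /sinv starM antipodeM starM. Qed.

(** The involution applied to the axiom for S(x_1) x_2 at [star x]. *)
Lemma sw_sinvl x :
  \D_(a, b <- x) (b * sinv a) = \D_(a, b <- 1) (counit (b * x) *: a).
Proof.
have starl : lin (@star R A : A -> conjmod A) by move=> k u v; rewrite starD starZ.
transitivity (star (es (star x))).
  rewrite /scounit (wh_star H); last by lin_auto.
  rewrite (sw_comp (W := A) (X := conjmod A) (g := @star R A)) //.
  by apply: eq_sw => a b; rewrite starM starK.
rewrite /scounit (wh_Sl H) (sw_comp (W := A) (X := conjmod A) (g := @star R A)) //.
rewrite [RHS]sw_star1; last by lin_auto.
apply: eq_sw => a b.
by rewrite starZ -counit_star starM starK.
Qed.

(** S(S'(x_1)) S(x_2) x_3 is computed in two ways: grouping the last two factors gives S(S'(x)),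
    grouping the first two gives S(x_2 S'(x_1)) x_3, which reduces to x. *)
Lemma antipode_sinv x : S (sinv x) = x.
Proof.
pose F x := \D_(a, b <- x) (b * sinv a).
have F1 : F 1 = 1.
  by rewrite /F sw_sinvl; under eq_sw do rewrite mulr1; exact: (wh_counitr H).
transitivity (\D_(a, b <- x) (S (sinv a) * es b)).
  rewrite (sw_scounitr (f := fun a b => S (sinv a) * b)); last by lin_auto.
  under eq_sw => a b do rewrite -antipodeM sinvM mulrA.
  rewrite -(sw_comp (g := fun z => S (z * sinv x))); last by lin_auto.
  by rewrite -/(F 1) F1 mul1r.
transitivity (\D_(p, q <- x) (S (F p) * q)).
  transitivity (\D_(a, b <- x) \D_(p, q <- b) (S (sinv a) * (S p * q))).
    by apply: eq_sw => a b; rewrite (sw_comp (g := fun z => S (sinv a) * z)) //; lin_auto.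
  rewrite -(sw_coassoc (f := fun a p q => S (sinv a) * (S p * q))); last by lin_auto.
  apply: eq_sw => p q; rewrite (sw_comp (g := fun z => S z * q)); last by lin_auto.
  by apply: eq_sw => a b; rewrite antipodeM mulrA.
transitivity (\D_(c, d <- 1) (S c * (d * x))); last first.
  under eq_sw do rewrite mulrA.
  by rewrite -(sw_comp (g := fun z => z * x)) -/(es 1) ?scounit1 ?mul1r //; lin_auto.
transitivity (\D_(a, b <- x) \D_(c, d <- 1) (counit (d * a) *: (S c * b))).
  apply: eq_sw => a b; rewrite /F sw_sinvl.
  rewrite (sw_comp (g := fun z => S z * b)); last by lin_auto.
  by apply: eq_sw => c d; rewrite (linZ Sl) -scalerAl.
rewrite exchange_sw.
under eq_sw => c d.
  rewrite (sw_counit_mull (g := fun b => S c * b)); last by lin_auto.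
  over.
rewrite (sw_unit (f := fun c d b => counit d *: (S c * (b * x)))); last by lin_auto.
apply: eq_sw => c d.
by rewrite (sw_counitl (g := fun b => S c * (b * x))) //; lin_auto.
Qed.

Lemma sinv_antipode x : sinv (S x) = x.
Proof. by have := antipode_sinv (star x); rewrite /sinv starK => ->; rewrite starK. Qed.

Lemma sw_sinv W (f : A -> A -> W) x : bilin f ->
  \D_(a, b <- sinv x) f a b = \D_(a, b <- x) f (sinv b) (sinv a).
Proof.
move=> fl; rewrite -{2}(antipode_sinv x).
rewrite (sw_antipode (f := fun a b => f (sinv b) (sinv a))); last by lin_auto.
by under [RHS]eq_sw => a b do rewrite !sinv_antipode.
Qed.

Lemma sinv1 : sinv 1 = 1.
Proof. by rewrite /sinv star1 antipode1 star1. Qed.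

Lemma sw1_sinv W (f : A -> A -> W) : bilin f ->
  \D_(a, b <- 1) f (sinv b) (sinv a) = \D_(a, b <- 1) f a b.
Proof. by move=> fl; rewrite -sw_sinv // sinv1. Qed.

Lemma sinv_scounit x : \D_(a, b <- x) (sinv b * a) = sinv (es x).
Proof.
rewrite /scounit (sw_comp _ _ lin_sinv).
by apply: eq_sw => a b; rewrite sinvM sinv_antipode.
Qed.

Lemma sinv_tcounit x : \D_(a, b <- x) (b * sinv a) = sinv (et x).
Proof.
rewrite /tcounit (sw_comp _ _ lin_sinv).
by apply: eq_sw => a b; rewrite sinvM sinv_antipode.
Qed.

Lemma sw_sinv_mull W (f : A -> A -> W) x : bilin f ->
  \D_(p, c <- x) \D_(a, b <- p) f (sinv b * a) c
  = \D_(a, b <- 1) f (sinv a) (x * b).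
Proof.
move=> fl; rewrite -(sw_scounitl (f := fun a b => f (sinv a) b)); last by lin_auto.
by apply: eq_sw => p c; rewrite -sinv_scounit (sw_comp (g := f^~ c)) //; lin_auto.
Qed.

Lemma sw_sinv_mulr W (f : A -> A -> W) x : bilin f ->
  \D_(p, c <- x) \D_(a, b <- p) f (b * sinv a) c
  = \D_(a, b <- 1) f a (b * x).
Proof.
move=> fl; transitivity (\D_(a, b <- x) f (sinv (et a)) b).
  by apply: eq_sw => p c; rewrite -sinv_tcounit (sw_comp (g := f^~ c)) //; lin_auto.
rewrite (sw_tcounitl (f := fun a b => f (sinv a) b)); last by lin_auto.
by under eq_sw => a b do rewrite sinv_antipode.
Qed.

(* [h_l] is the left integral property [haar_l], evaluated on A. *)
Lemma haar_invariance (h : A -> K^o) a b : lin h ->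
  (forall x, \D_(u, v <- x) (h v *: u) = \D_(u, v <- x) (h v *: et u)) ->
  \D_(u, v <- b) (h (a * v) *: u) = \D_(u, v <- a) (h (v * b) *: S u).
Proof.
move=> hl h_l.
(* Both sides equal h(a_3 b_2) S(a_1) a_2 b_1: on the left S(a_1) a_2 is absorbed by Delta(1); on
   the right [h_l] replaces the first leg of Delta(a_2 b) by its [tcounit]. *)
transitivity (\D_(u, v <- a) \D_(p, q <- v) \D_(c, d <- b)
    (h (q * d) *: (S u * (p * c)))).
  transitivity (\D_(p, q <- a) \D_(c, d <- b) (h (q * d) *: (es p * c))); last first.
    rewrite -(sw_coassoc (f := fun u p q => \D_(c, d <- b)
      (h (q * d) *: (S u * (p * c))))); last by lin_auto.
    apply: eq_sw => p q; rewrite exchange_sw; apply: eq_sw => c d.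
    rewrite (sw_comp (g := fun z => h (q * d) *: (z * c))); last by lin_auto.
    by apply: eq_sw => u v; rewrite mulrA.
  rewrite (sw_scounitl (f := fun p q => \D_(c, d <- b) (h (q * d) *: (p * c))));
    last by lin_auto.
  rewrite -(sw_mul1r (f := fun u v => h (a * v) *: u)); last by lin_auto.
  by apply: eq_sw => p q; apply: eq_sw => c d; rewrite mulrA.
transitivity (\D_(u, v <- a) \D_(p, q <- v * b) (h q *: (S u * et p))).
  apply: eq_sw => u v.
  transitivity (\D_(p, q <- v * b) (h q *: (S u * p))).
    by rewrite (sw_mul (f := fun p q => h q *: (S u * p))); lin_auto.
  have /(congr1 (fun z => S u * z)) := h_l (v * b).
  rewrite !(sw_comp (g := fun z => S u * z)); [|lin_auto..].
  under eq_sw do rewrite -scalerAr; move=> ->.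
  by under eq_sw do rewrite -scalerAr.
transitivity (\D_(u, v <- a) \D_(c, d <- 1) (h (d * v * b) *: S (c * u))).
  apply: eq_sw => u v.
  rewrite (sw_tcounitl (f := fun p q => h q *: (S u * p))); last by lin_auto.
  by apply: eq_sw => c d; rewrite antipodeM mulrA.
rewrite exchange_sw (sw_mul1r (f := fun u v => h (v * b) *: S u)) //.
by lin_auto.
Qed.

(** * Sweedler identities for an action, underlying the properties of Lambda *)

Section Action.
Variables (M : algType K) (act : A -> M -> M).
Hypotheses (actl : bilin act) (actA : forall a b m, act (a * b) m = act a (act b m)).
Hypotheses (act1 : forall m, act 1 m = m).
Hypothesis actM : forall a m n, act a (m * n) = \D_(u, v <- a) (act u m * act v n).
Hypothesis act_one : forall a, act a 1 = act (et a) 1.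
Implicit Types (m n : M) (a b : A).

(** S' reverses the coproduct, so n receives the first leg of b, exactly as when the operator of n
    is applied before that of m. *)
Lemma sw_act_mul W (g : M -> A -> W) m n b : bilin g ->
  \D_(u, v <- b) g (act (sinv u) (m * n)) v
  = \D_(p, q <- b) \D_(u, v <- q) g (act (sinv u) m * act (sinv p) n) v.
Proof.
move=> gl; rewrite -(sw_coassoc (f := fun p u v => g (act (sinv u) m * act (sinv p) n) v));
  last by lin_auto.
apply: eq_sw => u v; rewrite actM (sw_sinv (f := fun c d => act c m * act d n));
  last by lin_auto.
by rewrite (sw_comp (g := g^~ v)) //; lin_auto.
Qed.

(** Moves left multiplication by a past the coaction of m: the factor S'(a_2) a_1 collapses to
    S'(1_1), and Delta(1) is absorbed by Delta(b). *)
Lemma sw_act_mull W (g : M -> A -> W) m a b : bilin g ->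
  \D_(s, t <- a) \D_(u, v <- t * b) g (act (sinv u) (act s m)) v
  = \D_(u, v <- b) g (act (sinv u) m) (a * v).
Proof.
move=> gl.
transitivity (\D_(s, t <- a) \D_(p, q <- t) \D_(c, d <- b)
    g (act (sinv c * (sinv p * s)) m) (q * d)).
  apply: eq_sw => s t; rewrite (sw_mul (f := fun u v => g (act (sinv u) (act s m)) v));
    last by lin_auto.
  by do 2!(apply: eq_sw => ? ?); rewrite sinvM -!actA mulrA.
rewrite -(sw_coassoc (f := fun s p q => \D_(c, d <- b)
    g (act (sinv c * (sinv p * s)) m) (q * d))); last by lin_auto.
rewrite (sw_sinv_mull (f := fun y q => \D_(c, d <- b) g (act (sinv c * y) m) (q * d)));
  last by lin_auto.
rewrite -(sw_mul1r (f := fun u v => g (act (sinv u) m) (a * v))); last by lin_auto.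
by do 2!(apply: eq_sw => ? ?); rewrite sinvM mulrA.
Qed.

(** Let w = S'(tcounit y). Then Delta(w) = 1_1 (x) 1_2 w, so on the product m 1 only the factor 1
    sees w; and w acts on 1 as [tcounit y] does, since their [tcounit] agree. *)
Lemma act_sinv_tcounit y m : act (sinv (et y)) m = m * act (et y) 1.
Proof.
have etw : et (sinv (et y)) = et y.
  rewrite {1}/tcounit (sw_sinv (f := fun a b => a * S b)); last by lin_auto.
  under eq_sw => a b do rewrite antipode_sinv.
  by rewrite sinv_scounit -antipode_tcounit sinv_antipode.
rewrite -[X in act X 1]etw -act_one -[m in LHS]mulr1 actM.
rewrite (sw_sinv (f := fun a b => act a m * act b 1)); last by lin_auto.
rewrite (sw_tcounit (f := fun a b => act (sinv b) m * act (sinv a) 1)); last by lin_auto.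
under eq_sw => a b do rewrite sinvM actA.
rewrite (sw1_sinv (f := fun a b => act a m * act b (act (sinv (et y)) 1))); last by lin_auto.
by rewrite -actM act1.
Qed.

Lemma sw_act_tcounit W (g : M -> A -> W) m b x : bilin g -> b = et b ->
  \D_(u, v <- b * x) g (act (sinv u) m) v
  = \D_(u, v <- x) g (act (sinv u) (m * act b 1)) v.
Proof.
move=> gl ->; rewrite (sw_tcounit_mul (f := fun u v => g (act (sinv u) m) v)); last by lin_auto.
by apply: eq_sw => u v; rewrite sinvM actA act_sinv_tcounit.
Qed.

(** The balance hypothesis is what the class map to the crossed product satisfies. It moves the leg
    1_2, displayed as [tcounit 1_2], from a onto m, where (1_1 |> m)(1_2 |> 1) = m. *)
Lemma sw_act_retract W (g : M -> A -> W) m a : bilin g ->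
  (forall n y x, g n (et y * x) = g (n * act (et y) 1) x) ->
  \D_(u, v <- a) \D_(c, d <- v) g (act c (act (sinv u) m)) d = g m a.
Proof.
move=> gl gbal.
transitivity (\D_(u, v <- a) \D_(c, d <- v) g (act (c * sinv u) m) d).
  by do 2!(apply: eq_sw => ? ?); rewrite actA.
rewrite -(sw_coassoc (f := fun u c d => g (act (c * sinv u) m) d)); last by lin_auto.
rewrite (sw_sinv_mulr (f := fun y d => g (act y m) d)); last by lin_auto.
rewrite -(sw1_tcounitr (f := fun s t => g (act s m) (t * a))); last by lin_auto.
under eq_sw => s t do rewrite gbal.
rewrite (sw1_tcounitr (f := fun s t => g (act s m * act t 1) a)); last by lin_auto.
by rewrite -(sw_comp (g := g^~ a)) -?actM ?act1 ?mulr1 //; lin_auto.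
Qed.

(** Insert Delta(1) and use 1_1 b (x) 1_2 = b_1 (x) b_2 S(b_3). The factor S(b_3) is the
    contribution of the right-hand operator tau_R in the formula for phi -> a. *)
Lemma sw_harpoon W (F : A -> W) (phi : A -> K^o) a b : lin F -> lin phi ->
  \D_(u, v <- a) (phi v *: F (u * b))
  = \D_(c, d <- b) \D_(u, v <- a * c) (phi (v * S d) *: F u).
Proof.
move=> Fl pl.
rewrite -(sw_mulr1 (f := fun u v => phi v *: F (u * b))); last by lin_auto.
transitivity (\D_(u, v <- a) \D_(c, d <- b) \D_(s, t <- c)
    (phi (v * (t * S d)) *: F (u * s))).
  apply: eq_sw => u v; rewrite (sw_coassoc (f := fun s t d =>
    phi (v * (t * S d)) *: F (u * s))); last by lin_auto.
  transitivity (\D_(s, z <- b) (phi (v * et z) *: F (u * s))).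
    rewrite (sw_tcounitr (f := fun s z => phi (v * z) *: F (u * s))); last by lin_auto.
    by apply: eq_sw => s t; rewrite mulrA.
  apply: eq_sw => s z.
  by rewrite (sw_comp (g := fun z => phi (v * z) *: F (u * s))); lin_auto.
rewrite exchange_sw; apply: eq_sw => c d.
rewrite (sw_mul (f := fun u v => phi (v * S d) *: F u)); last by lin_auto.
by do 2!(apply: eq_sw => ? ?); rewrite mulrA.
Qed.
End Action.
End WeakHopf.

(** * Tensors with endomorphisms *)

Section TensorOperators.
Variables (R : realType) (M : starAlgType R) (V : vectType R[i]).
Local Notation K := (R[i]).
Implicit Types (X Y : tens M 'End(V)).

Definition tmul : tens M 'End(V) -> tens M 'End(V) -> tens M 'End(V) :=
  tens_mul *%R (fun S T => (S \o T)%VF).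

Lemma lin_compl (T : 'End(V)) : lin (fun S : 'End(V) => (S \o T)%VF).
Proof. by apply: lin_homc2; exact: lin_id. Qed.
Lemma lin_compr (S : 'End(V)) : lin (fun T : 'End(V) => (S \o T)%VF).
Proof. by apply: lin_homc; exact: lin_id. Qed.

Ltac lin_extra ::=
  match goal with
  | |- lin (fun t => comp_lfun ?c (@?x t)) => apply: (lin_comp (lin_compr c))
  | |- lin (fun t => comp_lfun (@?x t) ?c) => apply: (lin_comp (lin_compl c))
  end.

Lemma bilin_tmul : bilin tmul.
Proof. by rewrite /tmul /tens_mul; lin_auto. Qed.

Lemma tmul_pure m S n T : tmul (m \ox S) (n \ox T) = (m * n) \ox (S \o T)%VF.
Proof. by rewrite /tmul /tens_mul !tlift_pureE //; lin_auto. Qed.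

Section Operators.
Variables (H : lmodType K) (pi : M -> H -> H).
Hypothesis pil : bilin pi.

Definition tact X (x : tens H V) : tens H V :=
  \sw_(m, T <- X) \sw_(xi, a <- x) (pi m xi \ox T a).

Lemma bilin_tact : bilin tact.
Proof. by rewrite /tact; lin_auto. Qed.

Lemma tact_pure m T xi a : tact (m \ox T) (xi \ox a) = pi m xi \ox T a.
Proof. by rewrite /tact !tlift_pureE //; lin_auto. Qed.

Lemma tact_mul X Y x : (forall m n xi, pi (m * n) xi = pi m (pi n xi)) ->
  tact (tmul X Y) x = tact X (tact Y x).
Proof.
move=> piM; have [tl1 tl2] := bilin_tact; have [ml1 ml2] := bilin_tmul.
move: X; apply: tens_ext => [||m S].
- by apply: (lin_comp (tl2 x)).
- by apply: tl2.
move: Y; apply: tens_ext => [||n T].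
- exact: (lin_comp (tl2 x) (ml1 _)).
- exact: (lin_comp (tl1 _) (tl2 x)).
move: x; apply: tens_ext => [||xi a].
- exact: tl1.
- exact: (lin_comp (tl1 _) (tl1 _)).
by rewrite tmul_pure !tact_pure comp_lfunE piM.
Qed.
End Operators.

(** * Matrix entries over M, coordinates, and the involution on M (x) End V *)

Section Basis.
Variables (J : finType) (o : J -> V) (c : J -> V -> K^o).
Hypotheses (cl : forall i, lin (c i)) (oc : forall a, a = \sum_i (c i a : K) *: o i).
Hypothesis co : forall i j, c i (o j) = (i == j)%:R.

Definition entry i j X : M := \sw_(m, T <- X) ((c i (T (o j)) : K) *: m).
Definition munit i j : 'End(V) := linfun (fun b : V => (c j b : K) *: o i).

Lemma munitE i j b : munit i j b = (c j b : K) *: o i.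
Proof. by rewrite linfun_linear // => k u v; rewrite cl scalerDl scalerA. Qed.

Lemma lin_entry i j : lin (entry i j).
Proof.
by rewrite /entry; lin_auto.
Qed.

Lemma entry_pure i j m T : entry i j (m \ox T) = (c i (T (o j)) : K) *: m.
Proof.
rewrite /entry tlift_pureE //; split=> ?; cbv beta; lin_auto.
by apply: (lin_comp (cl i)); lin_auto.
Qed.

Lemma munit_sum (T : 'End(V)) :
  T = \sum_i \sum_j (c i (T (o j)) : K) *: munit i j.
Proof.
apply/lfunP => a; rewrite sum_lfunE [LHS]oc; apply: eq_bigr => i _.
rewrite sum_lfunE [in LHS](oc a) linear_sum (lin_sumE (cl i)).
rewrite scaler_suml; apply: eq_bigr => j _.
by rewrite scale_lfunE munitE linearZ (linZ (cl i)) scalerA mulrC.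
Qed.

Lemma entry_sum X : X = \sum_i \sum_j (entry i j X \ox munit i j).
Proof.
move: X; apply: tens_ext => [||m T].
- exact: lin_id.
- apply: lin_sum => i; apply: lin_sum => j.
  by apply: lin_pure1; apply: lin_entry.
have ml : lin (fun T : 'End(V) => m \ox T) by lin_auto.
rewrite [in LHS](munit_sum T) (lin_sumE ml); apply: eq_bigr => i _.
rewrite (lin_sumE ml); apply: eq_bigr => j _.
have ml' : lin (fun m : M => m \ox munit i j) by lin_auto.
by rewrite entry_pure (linZ ml) (linZ ml').
Qed.

Lemma entry_munit_sum (m : J -> J -> M) i j :
  entry i j (\sum_k \sum_l (m k l \ox munit k l)) = m i j.
Proof.
have ml : lin (entry i j) by apply: lin_entry.
have E k l : entry i j (m k l \ox munit k l) = ((i == k) && (j == l))%:R *: m k l.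
  rewrite entry_pure munitE (linZ (cl i)) !co [l == j]eq_sym.
  by case: (i == k); case: (j == l); rewrite /= ?scaler0 ?scale0r //
    /GRing.scale /= ?mulr1 ?mulr0 ?mul0r.
transitivity (\sum_k \sum_l (((i == k) && (j == l))%:R *: m k l)).
  rewrite (lin_sumE ml); apply: eq_bigr => k _; rewrite (lin_sumE ml).
  by apply: eq_bigr => l _; apply: E.
rewrite (bigD1 i) //= (bigD1 j) //= !eqxx scale1r !big1 ?addr0 // => [k ki|l lj].
  by apply: big1 => l _; rewrite eq_sym (negPf ki) scale0r.
by rewrite eq_sym (negPf lj) scale0r.
Qed.

Section Coordinates.
Variable H : lmodType K.

Definition crd i (x : tens H V) : H := \sw_(xi, a <- x) ((c i a : K) *: xi).

Lemma lin_crd i : lin (crd i).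
Proof. by rewrite /crd; lin_auto. Qed.

Lemma crd_pure i xi a : crd i (xi \ox a) = (c i a : K) *: xi.
Proof. by rewrite /crd tlift_pureE //; split=> ?; cbv beta; lin_auto; apply: cl. Qed.

Lemma crd_sum x : x = \sum_i (crd i x \ox o i).
Proof.
move: x; apply: tens_ext => [||xi a].
- exact: lin_id.
- by apply: lin_sum => i; apply: lin_pure1; apply: lin_crd.
have ml : lin (fun a : V => xi \ox a) by lin_auto.
rewrite [in LHS](oc a) (lin_sumE ml); apply: eq_bigr => i _.
have ml' : lin (fun xi : H => xi \ox o i) by lin_auto.
by rewrite crd_pure (linZ ml) (linZ ml').
Qed.

Lemma crd_tact (pi : M -> H -> H) i j X xi : bilin pi ->
  crd i (tact pi X (xi \ox o j)) = pi (entry i j X) xi.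
Proof.
move=> pil; have [tl1 tl2] := bilin_tact pil.
move: X; apply: tens_ext => [||m T].
- by apply: (lin_comp (lin_crd i)).
- exact: (lin_comp (proj2 pil xi) (lin_entry i j)).
by rewrite tact_pure // crd_pure entry_pure (linZ (proj2 pil xi)).
Qed.
End Coordinates.

Lemma bilin_mulr : bilin (fun m n : M => m * n).
Proof. by lin_auto. Qed.

(** As M is unital, acting on 1 (x) [o j] and taking the i-th coordinate recovers the (i, j)
    entry. *)
Lemma tact_inj X Y :
  (forall n b, tact (fun m n => m * n) X (n \ox b) = tact (fun m n => m * n) Y (n \ox b)) ->
  X = Y.
Proof.
move=> XY; rewrite (entry_sum X) (entry_sum Y).
apply: eq_bigr => i _; apply: eq_bigr => j _; congr (_ \ox _).
have := congr1 (crd i) (XY 1 (o j)).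
by rewrite !(crd_tact _ _ _ _ bilin_mulr) !mulr1.
Qed.

Variable adj : 'End(V) -> 'End(V).
Hypothesis adjl : lin (adj : 'End(V) -> conjmod 'End(V)).
Hypothesis adjM : forall S T, adj (S \o T)%VF = (adj T \o adj S)%VF.

Definition tstar : tens M 'End(V) -> tens M 'End(V) := tens_star star adj.

Lemma tstarD : {morph tstar : X Y / X + Y}.
Proof.
move=> X Y; rewrite /tstar /tens_star tliftD // => T m n; rewrite starD.
by apply: (linD (lin_pure1 _ (@lin_id _ _))).
Qed.

Lemma tstarZ k X : tstar (k *: X) = k^* *: tstar X.
Proof.
rewrite /tstar /tens_star /tlift scaler_sumr; apply: eq_bigr => i _.
have pl : lin (fun m : M => m \ox adj (vbasis {:'End(V)})`_i) by lin_auto.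
by rewrite ffunE starZ (linZ pl).
Qed.

Lemma lin_tstar : lin (tstar : _ -> conjmod (tens M 'End(V))).
Proof. by move=> k X Y; rewrite tstarD tstarZ. Qed.

Lemma tstar_pure m T : tstar (m \ox T) = star m \ox adj T.
Proof.
have adjZ : forall k T, adj (k *: T) = k^* *: adj T by move=> k S; exact: (linZ adjl).
rewrite /tstar /tens_star tlift_pure // => [n S U|k n S].
  have -> : adj (S + U) = adj S + adj U by exact: (linD adjl).
  by apply: (linD (lin_pure2 _ (@lin_id _ _))).
have pl : lin (fun m : M => m \ox adj S) by lin_auto.
have pl' : lin (fun T : 'End(V) => star n \ox T) by lin_auto.
by rewrite starZ adjZ (linZ pl) (linZ pl').
Qed.

Lemma tstar_mul X Y : tstar (tmul X Y) = tmul (tstar Y) (tstar X).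
Proof.
have [ml1 ml2] := bilin_tmul.
move: X; apply: (@tens_ext _ _ _ (conjmod (tens M 'End(V)))) => [||m S].
- exact: (lin_comp lin_tstar (ml2 _)).
- by move=> k X X'; rewrite tstarD tstarZ (ml1 (tstar Y)).
move: Y; apply: (@tens_ext _ _ _ (conjmod (tens M 'End(V)))) => [||n T].
- exact: (lin_comp lin_tstar (ml1 _)).
- by move=> k X X'; rewrite tstarD tstarZ (ml2 (tstar _)).
by rewrite tmul_pure !tstar_pure tmul_pure starM adjM.
Qed.
End Basis.
End TensorOperators.

(** * Scalar products: orthonormal bases and adjoints *)

Section SesquilinearForm.
Variables (R : realType) (V : lmodType R[i]) (dot : V -> V -> R[i]).
Local Notation K := (R[i]).
Hypotheses (dotl : forall x, lin (dot x : V -> K^o)).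
Hypotheses (dotC : forall x y, dot y x = (dot x y)^*).

Lemma dotDl x y z : dot (x + y) z = dot x z + dot y z.
Proof. by rewrite dotC (linD (dotl z)) rmorphD /= -!dotC. Qed.
Lemma dotZl k x z : dot (k *: x) z = k^* * dot x z.
Proof. by rewrite dotC (linZ (dotl z)) rmorphM /= -dotC. Qed.
Lemma dotZr k x z : dot x (k *: z) = k * dot x z.
Proof. exact: (linZ (dotl x)). Qed.
Lemma dot_suml (I : finType) (F : I -> V) z : dot (\sum_i F i) z = \sum_i dot (F i) z.
Proof.
apply: (big_morph (dot^~ z)) => [x y|]; first exact: dotDl.
by rewrite -(scale0r 0) dotZl rmorph0 mul0r.
Qed.
Lemma dot_sumr (I : finType) (F : I -> V) z : dot z (\sum_i F i) = \sum_i dot z (F i).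
Proof. exact: (lin_sumE (dotl z)). Qed.

End SesquilinearForm.

Section ScalarProduct.
Variables (R : realType) (V : vectType R[i]) (dot : V -> V -> R[i]).
Local Notation K := (R[i]).
Hypotheses (dotl : forall x, lin (dot x : V -> K^o)).
Hypotheses (dotC : forall x y, dot y x = (dot x y)^*).
Hypotheses (dot_ge0 : forall x, 0 <= dot x x) (dot_eq0 : forall x, dot x x = 0 -> x = 0).

Local Notation dotDl := (dotDl dotl dotC).
Local Notation dotZl := (dotZl dotl dotC).
Local Notation dotZr := (dotZr dotl).
Local Notation dot_suml := (dot_suml dotl dotC).
Local Notation dot_sumr := (dot_sumr dotl).

Definition orthonormal_family (I : finType) (o : I -> V) : Prop :=
  forall i j, dot (o i) (o j) = (i == j)%:R.

Lemma orthonormal_sum (I : finType) (o : I -> V) (k : I -> K) i :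
  orthonormal_family o -> dot (o i) (\sum_j k j *: o j) = k i.
Proof.
move=> oo; rewrite dot_sumr (bigD1 i) //= big1 ?addr0 => [|j ji].
  by rewrite dotZr oo eqxx mulr1.
by rewrite dotZr oo eq_sym (negPf ji) mulr0.
Qed.

(** Gram-Schmidt, one vector at a time: a family shorter than the dimension does not span, and a
    vector outside its span minus the projection onto it is nonzero. *)
Lemma orthonormal_exists n : (n <= \dim {:V})%N ->
  exists o : 'I_n -> V, orthonormal_family o.
Proof.
elim: n => [|n IH] len; first by exists (fun=> 0); case.
have [o oo] := IH (ltnW len).
pose U := <<[tuple o i | i < n]>>%VS.
have oU i : o i \in U by apply: memv_span; apply: map_f; rewrite mem_enum.
have [v vU] : exists v, v \notin U.
  apply: contrapT => nv; move: len; apply/negP; rewrite -leqNgt.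
  have sub : ({:V} <= U)%VS.
    by apply/subvP => v _; apply: contrapT => /negP h; apply: nv; exists v.
  by apply: leq_trans (dimvS sub) _; apply: leq_trans (dim_span _) _; rewrite size_tuple.
pose w := v - \sum_j dot (o j) v *: o j.
have w0 : w != 0.
  apply: contraNneq vU => /eqP; rewrite subr_eq0 => /eqP ->.
  by apply: memv_suml => i _; apply: memvZ.
have ow i : dot (o i) w = 0 by rewrite (linB (dotl _)) orthonormal_sum // subrr.
have dw : 0 < dot w w.
  by rewrite lt_neqAle dot_ge0 andbT eq_sym; apply: contra_neq w0; apply: dot_eq0.
pose k := (sqrtC (dot w w))^-1.
have kc : k^* = k by rewrite /k; apply: conj_Creal; rewrite realV ger0_real ?sqrtC_ge0 ?ltW.
have ku : k * (k * dot w w) = 1.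
  rewrite mulrA -expr2 exprVn sqrtCK mulVf //.
  by rewrite gt_eqF.
(* The new unit vector takes the last index; [unlift ord_max] recognises the old ones. *)
exists (fun i => if unlift ord_max i is Some j then o j else k *: w) => i j.
case: (unliftP ord_max i) => [i'|] ->; case: (unliftP ord_max j) => [j'|] ->.
- by rewrite oo (inj_eq lift_inj).
- by rewrite dotZr ow mulr0 eq_sym (negPf (neq_lift _ _)).
- by rewrite dotZl (dotC (o j')) ow rmorph0 mulr0 (negPf (neq_lift _ _)).
- by rewrite dotZl dotZr kc ku eqxx.
Qed.

Lemma orthonormal_basis : exists o : 'I_(\dim {:V}) -> V,
  orthonormal_family o /\ forall a, a = \sum_i dot (o i) a *: o i.
Proof.
have [o oo] := orthonormal_exists (leqnn _).
exists o; split=> // a.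
pose X := [tuple o i | i < \dim {:V}].
have XE (i : 'I_(\dim {:V})) : X`_i = o i by rewrite -tnth_nth tnth_mktuple.
have Xb : basis_of {:V} X.
  rewrite basisEfree subvf size_tuple leqnn !andbT.
  apply/freeP => k; under eq_bigr do rewrite XE; move=> k0 i.
  by rewrite -(orthonormal_sum k i oo) k0 -(scale0r 0) dotZr mul0r.
rewrite {1}(coord_basis Xb (memvf a)); apply: eq_bigr => i _; rewrite XE; congr (_ *: _).
rewrite {2}(coord_basis Xb (memvf a)).
by under eq_bigr do rewrite XE; rewrite orthonormal_sum.
Qed.

Definition dot_adj (T : 'End(V)) : 'End(V) := xget 0 [set T' : 'End(V) |
  forall a b, dot a (T b) = dot (T' a) b]%classic.

Lemma dot_inj x y : (forall b, dot x b = dot y b) -> x = y.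
Proof.
move=> xy; apply/subr0_eq/dot_eq0.
rewrite [dot (x - y) _]dotDl -[- y]scaleN1r dotZl.
by rewrite rmorphN rmorph1 mulN1r xy subrr.
Qed.

(** An adjoint has to be exhibited, since otherwise [xget] returns its default 0; in an orthonormal
    basis it is a -> sum_i (T o_i, a) o_i. *)
Lemma dot_adjP (T : 'End(V)) a b : dot a (T b) = dot (dot_adj T a) b.
Proof.
have [o [oo oV]] := orthonormal_basis.
suff [T' T'P] : exists T' : 'End(V), forall a b, dot a (T b) = dot (T' a) b.
  have : [set T' : 'End(V) | forall a b, dot a (T b) = dot (T' a) b]%classic (dot_adj T).
    by apply: xgetPex; exists T'.
  exact.
have Tl : linear (fun a => \sum_i dot (T (o i)) a *: o i : V).
  by apply: (@lin_sum K V V) => i; apply: (lin_scalel (f := dot (T (o i)))).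
exists (linfun (fun a => \sum_i dot (T (o i)) a *: o i)) => x y.
rewrite linfun_linear // dot_suml [in LHS](oV y) linear_sum dot_sumr.
apply: eq_bigr => i _; rewrite linearZ dotZr dotZl mulrC; congr (_ * _).
exact: dotC.
Qed.

Lemma dot_adjE (T T' : 'End(V)) :
  (forall a b, dot a (T b) = dot (T' a) b) -> dot_adj T = T'.
Proof.
by move=> TT'; apply/lfunP => a; apply: dot_inj => b; rewrite -dot_adjP.
Qed.

Lemma lin_dot_adj : lin (dot_adj : 'End(V) -> conjmod 'End(V)).
Proof.
move=> k S T; apply: dot_adjE => a b.
rewrite !(add_lfunE, scale_lfunE) dotDl dotZl conjCK -!dot_adjP.
by rewrite (linD (dotl a)) dotZr.
Qed.

Lemma dot_adj_comp S T : dot_adj (S \o T)%VF = (dot_adj T \o dot_adj S)%VF.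
Proof. by apply: dot_adjE => a b; rewrite !comp_lfunE !dot_adjP. Qed.
End ScalarProduct.

(** * Boundedness of operators through squared norms *)

Section SquaredNorm.
Variables (R : realType) (U : lmodType R[i]) (dot : U -> U -> R[i]).
Local Notation K := (R[i]).
Hypotheses (dotl : forall x, lin (dot x : U -> K^o)).
Hypotheses (dotC : forall x y, dot y x = (dot x y)^*).
Hypothesis dot_ge0 : forall x, 0 <= dot x x.

Definition nsq (x : U) : R := complex.Re (dot x x).

Lemma nsq_ge0 x : 0 <= nsq x.
Proof. by have := dot_ge0 x; rewrite lecE => /andP[]. Qed.

Lemma hilbert_norm_nsq x : hilbert_norm dot x ^+ 2 = nsq x.
Proof. by rewrite sqr_sqrtr // nsq_ge0. Qed.

Lemma bounded_nsq (T : U -> U) C : lin T ->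
  (forall x, nsq (T x) <= C * nsq x) -> bounded_operator dot T.
Proof.
move=> Tl TC; split=> //; exists (Num.sqrt `|C|) => x.
rewrite -sqrtrM //; apply: ler_wsqrtr; apply: le_trans (TC x) _.
by apply: ler_wpM2r; [exact: nsq_ge0 | exact: ler_norm].
Qed.

Lemma nsq_bounded (T : U -> U) : bounded_operator dot T ->
  exists2 C, 0 <= C & forall x, nsq (T x) <= C * nsq x.
Proof.
move=> [_ [c Tc]]; exists (c ^+ 2) => [|x]; first exact: sqr_ge0.
rewrite -!hilbert_norm_nsq -exprMn; apply: lerXn2r (Tc x).
  by rewrite nnegrE sqrtr_ge0.
by rewrite nnegrE; apply: le_trans (Tc x); exact: sqrtr_ge0.
Qed.

(* By the parallelogram identity; this replaces the Cauchy-Schwarz inequality. *)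
Lemma nsqD x y : nsq (x + y) <= 2 * nsq x + 2 * nsq y.
Proof.
have e : nsq (x + y) + nsq (x - y) = 2 * nsq x + 2 * nsq y.
  have E : dot (x + y) (x + y) + dot (x - y) (x - y)
      = dot x x + dot x x + (dot y y + dot y y).
    have NE : - y = (-1) *: y by rewrite scaleN1r.
    rewrite NE !(linD (dotl _)) !(dotDl dotl dotC).
    rewrite !(dotZr dotl) !(dotZl dotl dotC) rmorphN rmorph1; ring.
  have := congr1 (@complex.Re R) E; rewrite !raddfD /= => E'.
  rewrite /nsq E'; ring.
by rewrite -e lerDl nsq_ge0.
Qed.

(** Iterated [nsqD]: each further term turns C into 2 + 2 C, independently of [f]. *)
Lemma nsq_sum (I : Type) (s : seq I) : exists2 C, 0 <= C &
  forall f : I -> U, nsq (\sum_(i <- s) f i) <= C * \sum_(i <- s) nsq (f i).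
Proof.
elim: s => [|i s [C C0 IH]].
  by exists 0 => // f; rewrite !big_nil mul0r /nsq (lin0 (dotl 0)).
exists (2 + 2 * C) => [|f]; first by rewrite addr_ge0 ?mulr_ge0.
rewrite !big_cons; apply: le_trans (nsqD _ _) _.
have s0 : 0 <= \sum_(i <- s) nsq (f i) by apply: sumr_ge0 => k _; exact: nsq_ge0.
apply: le_trans (_ : 2 * nsq (f i) + 2 * (C * \sum_(i <- s) nsq (f i)) <= _).
  by rewrite lerD2l ler_pM2l.
have -> : (2 + 2 * C) * (nsq (f i) + \sum_(i <- s) nsq (f i))
  = 2 * nsq (f i) + 2 * (C * \sum_(i <- s) nsq (f i))
    + (2 * (C * nsq (f i)) + 2 * \sum_(i <- s) nsq (f i)) by ring.
by rewrite lerDl addr_ge0 // !mulr_ge0 // nsq_ge0.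
Qed.
End SquaredNorm.

Section WeakTopology.
Variables (R : realType) (w : weak_topology) (U : lmodType R[i]) (dot : U -> U -> R[i]).
Local Notation K := (R[i]).
Hypotheses (dotl : forall x, lin (dot x : U -> K^o)).

Lemma weak_ltD xi eta (S T : U -> U) d e :
  weak_lt dot xi eta S d -> weak_lt dot xi eta T e ->
  weak_lt dot xi eta (fun x => S x + T x) (d + e).
Proof.
move=> [N Nd] [N' Ne]; exists (maxn N N') => n; rewrite geq_max => /andP[/Nd nd /Ne ne].
under eq_bigr => k _ do rewrite (linD (dotl _)).
by rewrite big_split /=; apply: le_lt_trans (le_normcD _ _) _; exact: ltrD.
Qed.

Lemma weak_lt0 xi eta e : 0 < e -> weak_lt dot xi eta (fun=> 0) e.
Proof.
move=> e0; exists 0%N => n _; rewrite big1 ?Normc.normc0 // => k _.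
exact: (lin0 (dotl _)).
Qed.

Lemma weak_lt_le xi eta (T : U -> U) d e : d <= e ->
  weak_lt dot xi eta T d -> weak_lt dot xi eta T e.
Proof. by move=> de [N NP]; exists N => n /NP h; apply: lt_le_trans de. Qed.

Lemma eq_weak_lt xi eta (S T : U -> U) e : (forall x, S x = T x) ->
  weak_lt dot xi eta S e -> weak_lt dot xi eta T e.
Proof.
move=> ST [N NP]; exists N => n /NP.
by under eq_bigr => k _ do rewrite ST.
Qed.

Definition weak_approx (F : set (U -> U)) (T : U -> U) (I : finType) : Prop :=
  forall (xi eta : I -> nat -> U) (e : R), 0 < e ->
    (forall j, weak_admissible w dot (xi j) /\ weak_admissible w dot (eta j)) ->
  exists2 T', F T' & forall j, weak_lt dot (xi j) (eta j) (fun x => T x - T' x) e.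

(** [weak_closed] speaks of families over ordinals; enumeration gives them over products such as
    ['I_n * (J * J)], so that all matrix entries can be approximated at once. *)
Lemma weak_approx_finType F T (I : finType) :
  (forall n, weak_approx F T 'I_n) -> weak_approx F T I.
Proof.
move=> TF xi eta e e0 adm.
have := TF #|I| (fun j => xi (enum_val j)) (fun j => eta (enum_val j)) e e0
  (fun j => adm (enum_val j)).
move=> [T' FT' TT'].
exists T'; first exact: FT'.
move=> j; move: (TT' (enum_rank j)); rewrite /comp.
rewrite !enum_rankK.
exact.
Qed.
End WeakTopology.

Section CstarNorm.
Variables (R : realType) (V : lmodType R[i]) (mul : V -> V -> V) (st : V -> V).
Variable nrm : V -> R.
Hypothesis nP : cstar_norm mul st nrm.

Lemma cstar_norm0 : nrm 0 = 0.
Proof. by rewrite -(scale0r (0 : V)) (cstar_normZ nP) Normc.normc0 mul0r. Qed.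
Lemma cstar_normN x : nrm (- x) = nrm x.
Proof. by rewrite -scaleN1r (cstar_normZ nP) normcN Normc.normc1 mul1r. Qed.
Lemma cstar_norm_ge0 x : 0 <= nrm x.
Proof.
have := cstar_normD nP x (- x); rewrite subrr cstar_norm0 cstar_normN.
by rewrite -mulr2n pmulrn_lge0.
Qed.
Lemma cstar_norm_sum (I : finType) (F : I -> V) : nrm (\sum_i F i) <= \sum_i nrm (F i).
Proof.
elim/big_rec2: _ => [|i y x _ le]; first by rewrite cstar_norm0.
by apply: le_trans (cstar_normD nP _ _) _; rewrite lerD2l.
Qed.
End CstarNorm.

(** * The crossed product *)

Section Instance.
Variables (R : realType) (A : weakCstarHopfType R).
Local Notation K := (R[i]).
Local Notation S := (@antipode R A).

Definition comul_l (i : 'I_(\dim {:A})) (x : A) : A := comul x i.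
Definition comul_r (i : 'I_(\dim {:A})) : A := (vbasis {:A})`_i.

Lemma swE (W : zmodType) x (f : A -> A -> W) :
  sw comul_l comul_r x f = tlift (comul x) f.
Proof. by []. Qed.

Lemma weak_hopf_comul :
  weak_hopf comul_l comul_r (counit : A -> K^o) (antipode : A -> A).
Proof.
split.
- by move=> i k x y; rewrite /comul_l linearP /= tens_ffunE.
- exact: lin_hom.
- exact: lin_hom.
- move=> W f x fl; exact: (tlift_coassoc (comulA x) fl).
- move=> W f x y fl; rewrite !swE comulM; exact: (tlift_mul *%R _ _ fl).
- move=> W f x fl; rewrite !swE comul_star; exact: (tlift_star star _ fl).
- move=> W f fl; exact: (tlift_unit (comul1 (s := A)) fl).
- exact: counit_comull.
- exact: counit_comulr.
- exact: counitM.
- exact: antipodel.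
- exact: antipoder.
- exact: antipode_lr.
Qed.
End Instance.

Section CrossedMap.
Variables (R : realType) (A : weakCstarHopfType R) (M : starAlgType R).
Variables (act : A -> M -> M).
Hypothesis act_alg : module_algebra act.
Local Notation K := (R[i]).
Local Notation S := (@antipode R A).
Local Notation dual := 'Hom(A, R[i]^o).
Local Notation sinv := (sinv (@antipode R A)).
Local Notation "\D_ ( a , b <- x ) F" := (sw (@comul_l R A) (@comul_r R A) x (fun a b => F))
  (at level 41, F at level 41, x at level 60, a name, b name,
   format "\D_ ( a ,  b  <-  x )  F") : ring_scope.
Let H := weak_hopf_comul A.
Let Sl : lin sinv := lin_sinv H.

Ltac lin_extra ::=
  match goal with
  | |- @lin _ ?X ?W (fun t => sw _ _ ?x (@?f t)) => refine (@lin_swf _ _ _ _ _ W X x f _)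
  | |- @lin _ ?X ?W (fun t => sw _ _ (@?x t) ?f) => refine (@lin_swx _ _ _ _ _ _ _ H W X x f _ _)
  end.

Lemma bilin_act : bilin act.
Proof. by split=> [a|m]; [exact: (act_linearr act_alg) | exact: (act_linearl act_alg)]. Qed.

(** * Explicit operators on M (x) A *)

Lemma hat_antipodeE (phi : dual) x : hat_antipode A phi x = phi (S x).
Proof.
rewrite linfun_linear ?comp_lfunE //.
exact: (@lin_homc2 K _ _ _ _ antipode id (@lin_id _ _)).
Qed.

(** Evaluating at S'(y) shows that the dual antipode is injective, which makes [^-1] a left inverse;
    phi composed with S' is the preimage of phi. *)
Lemma hat_antipode_inv (phi : dual) x : ((hat_antipode A)^-1)%VF phi x = phi (sinv x).
Proof.
pose s := linfun sinv : 'End(A).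
have sE y : s y = sinv y by apply: linfun_linear; exact: Sl.
have ker0 : lker (hat_antipode A) == 0%VS.
  apply/lker0P => psi psi' /lfunP E; apply/lfunP => y.
  by have := E (sinv y); rewrite !hat_antipodeE (antipode_sinv H).
have E : phi = hat_antipode A (phi \o s)%VF.
  by apply/lfunP => y; rewrite hat_antipodeE comp_lfunE sE (sinv_antipode H).
by rewrite {1}E lker0_lfunK // comp_lfunE sE.
Qed.

Lemma tauLE (phi : dual) b : tauL phi b = \D_(u, v <- b) (phi (sinv u) *: v).
Proof.
rewrite /tauL linfun_linear.
  by apply: eq_tlift => u v; rewrite hat_antipode_inv.
set psi := (_ phi).
suff : lin (fun b => \D_(u, v <- b) (psi u *: v)) by exact.
by lin_auto.
Qed.

Lemma lin_tauL : lin (@tauL R A).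
Proof.
move=> k phi psi; apply/lfunP => b; rewrite add_lfunE scale_lfunE !tauLE.
have l : lin (fun f : dual => \D_(u, v <- b) (f (sinv u) *: v)) by lin_auto.
exact: l.
Qed.

Lemma tauL_coactionE m :
  tauL_coaction act m = \sum_(i < \dim {:A}) (act (vbasis {:A})`_i m \ox tauL (dual_basis i)).
Proof.
have B : bilin (fun (n : M) (phi : dual) => n \ox tauL phi).
  split=> [n|phi]; last by lin_auto.
  exact: (lin_comp (lin_pure2 n (@lin_id _ _)) lin_tauL).
rewrite /tauL_coaction /coaction tlift_sum; last by move=> v; apply: linD (proj2 B v).
by apply: eq_bigr => i _; rewrite (tlift_pureE _ _ B).
Qed.

Lemma lin_tauL_coaction : lin (tauL_coaction act).
Proof.
have [_ al] := bilin_act; have [ar _] := bilin_act.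
move=> k m n; rewrite !tauL_coactionE.
have l : lin (fun m => \sum_(i < \dim {:A}) (act (vbasis {:A})`_i m \ox tauL (dual_basis i))).
  by apply: lin_sum => i; apply: lin_pure1; apply: ar.
exact: l.
Qed.

(** The basis sum in [coaction] reassembles S'(b_1) from its coordinates. *)
Lemma tact_tauL_coaction (U : lmodType K) (pi : M -> U -> U) m xi b : bilin pi ->
  tact pi (tauL_coaction act m) (xi \ox b)
  = \D_(u, v <- b) (pi (act (sinv u) m) xi \ox v).
Proof.
move=> pil; have [tl1 tl2] := bilin_tact A pil.
have [_ al] := bilin_act.
rewrite tauL_coactionE (lin_sumE (tl2 _)).
transitivity (\sum_(i < \dim {:A}) \D_(u, v <- b)
    (pi (act (coord (vbasis {:A}) i (sinv u) *: (vbasis {:A})`_i) m) xi \ox v)).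
  apply: eq_bigr => i _; rewrite tact_pure // tauLE.
  have l (w : U) : lin (fun v : A => w \ox v) by lin_auto.
  rewrite (sw_comp _ _ (l _)); apply: eq_sw => u v.
  have l' : lin (fun w : U => w \ox v) by lin_auto.
  by rewrite dual_basisE (linZ (l _)) (linZ (al m)) (linZ (proj2 pil xi)) (linZ l').
rewrite /sw exchange_big; apply: eq_bigr => j _.
set w := comul_l _ _; set v := comul_r _.
have l' : lin (fun a : A => pi (act a m) xi \ox v).
  by apply: lin_pure1; apply: (lin_comp (proj2 pil xi)); apply: al.
by rewrite -(lin_sumE l') -coord_vbasis ?memvf.
Qed.
Local Notation tau := (tauL_coaction act).
Local Notation tact0 := (tact (V := A) (fun m n : M => m * n)).
Local Notation act_mul := (actM act_alg).
Local Notation et := (tcounit (@comul_l R A) (@comul_r R A) antipode).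

Definition mend_ell (a : A) : tens M 'End(A) := 1 \ox ell a.

Lemma act_oneE a : act a 1 = act (et a) 1.
Proof. exact: (act_one act_alg). Qed.

(** M (x) End A acts faithfully on M (x) A, which reduces its identities to Sweedler computations on
    n (x) b. *)
Lemma mend_ext (X Y : tens M 'End(A)) :
  (forall n b, tact0 X (n \ox b) = tact0 Y (n \ox b)) -> X = Y.
Proof.
pose o (i : 'I_(\dim {:A})) : A := (vbasis {:A})`_i.
pose c (i : 'I_(\dim {:A})) (a : A) : K^o := coord (vbasis {:A}) i a.
apply: (@tact_inj R M A _ o c) => [i k x y|a].
- by rewrite /c linearP.
- by rewrite [LHS](coord_vbasis (memvf a)).
Qed.

Lemma lin_ell : lin (@ell R A).
Proof.
have El c : lin (fun b : A => c * b) by lin_auto.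
move=> k a b; apply/lfunP => c; rewrite add_lfunE scale_lfunE !linfun_linear; try exact: El.
by rewrite mulrDl scalerAl.
Qed.

Lemma ellE (a b : A) : ell a b = a * b.
Proof. by apply: linfun_linear; exact: (@lin_mulr _ _ A _ a (@lin_id _ _)). Qed.

Lemma lin_mend_ell : lin mend_ell.
Proof. exact: (lin_comp (lin_pure2 _ (@lin_id _ _)) lin_ell). Qed.

Section TactRep.
Variables (U : lmodType K) (pi : M -> U -> U).
Hypotheses (pil : bilin pi) (pi1 : forall xi, pi 1 xi = xi).
Hypothesis piM : forall m n xi, pi (m * n) xi = pi m (pi n xi).

Lemma tact_mend_ell a xi b : tact pi (mend_ell a) (xi \ox b) = xi \ox (a * b).
Proof. by rewrite tact_pure // ellE pi1. Qed.

Lemma tact_tau_mend_ell m a xi b :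
  tact pi (tmul (tau m) (mend_ell a)) (xi \ox b)
  = \D_(u, v <- a * b) (pi (act (sinv u) m) xi \ox v).
Proof. by rewrite tact_mul // tact_mend_ell tact_tauL_coaction. Qed.
End TactRep.

Let pil := bilin_mulr M.
Let piM (m n p : M) : m * n * p = m * (n * p). Proof. by rewrite mulrA. Qed.
Let pi1 (p : M) : 1 * p = p. Proof. by rewrite mul1r. Qed.
Let tl1 X : lin (tact0 X) := proj1 (bilin_tact A pil) X.
Let tl2 x : lin (tact0^~ x) := proj2 (bilin_tact A pil) x.
Let act_pure n : bilin (fun (m : M) (v : A) => (m * n) \ox v).
Proof. by lin_auto. Qed.

(** * Lambda is multiplicative and respects the relation over A_L *)

Lemma tau_mul m n : tau (m * n) = tmul (tau m) (tau n).
Proof.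
apply: mend_ext => p b.
rewrite (tact_mul pil) // !tact_tauL_coaction //.
rewrite (sw_act_mul H bilin_act act_mul _ _ _ (act_pure p)).
rewrite (sw_comp _ _ (tl1 _)); apply: eq_sw => u v.
rewrite tact_tauL_coaction //.
by apply: eq_sw => ? ?; rewrite mulrA.
Qed.

(** The crossed product relation (1 x| a)(m x| 1) = a_1 |> m x| a_2, realised in M (x) End A. *)
Lemma mend_ell_tau a m :
  tmul (mend_ell a) (tau m) = \D_(s, t <- a) (tmul (tau (act s m)) (mend_ell t)).
Proof.
apply: mend_ext => p b; rewrite (sw_comp _ _ (tl2 _)).
under [RHS]eq_sw => s t do rewrite tact_tau_mend_ell //.
rewrite (sw_act_mull H bilin_act (actA act_alg) _ _ _ (act_pure p)).
rewrite (tact_mul pil) // tact_tauL_coaction // (sw_comp _ _ (tl1 _)).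
by apply: eq_sw => u v; rewrite tact_mend_ell.
Qed.

Lemma mend_ell_mul a b : mend_ell (a * b) = tmul (mend_ell a) (mend_ell b).
Proof.
rewrite /mend_ell tmul_pure mul1r; congr (_ \ox _).
by apply/lfunP => c; rewrite comp_lfunE !ellE mulrA.
Qed.

Lemma tau_mend_ell_tcounit m b : b = et b -> tmul (tau m) (mend_ell b) = tau (m * act b 1).
Proof.
move=> eb; apply: mend_ext => p c; rewrite tact_tau_mend_ell // tact_tauL_coaction //.
exact: (sw_act_tcounit H bilin_act (actA act_alg) (act1 act_alg) act_mul act_oneE _ _
  (act_pure p) eb).
Qed.

Lemma tau_mend_ell1 m : tmul (tau m) (mend_ell 1) = tau m.
Proof.
apply: mend_ext => p c; rewrite (tact_mul pil) // tact_mend_ell //.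
by rewrite mul1r.
Qed.

Lemma leftA_tcounit b : leftA b -> b = et b.
Proof.
move=> [phi ->]; pose f (x y : A) := (phi x : K) *: y.
have fl : bilin f by rewrite /f; lin_auto.
have fel : lin (fun x => et x) by exact: lin_tcounit H.
transitivity (\D_(x, y <- 1) (f x (et y))); first by rewrite (sw1_tcounitr H fl).
rewrite -[X in et X]/(\D_(x, y <- 1) (f x y)) (sw_comp _ _ fel).
by apply: eq_sw => x y; rewrite (linZ fel).
Qed.

Lemma tcounit_leftA x : leftA (et x).
Proof.
have pl : linear (fun a : A => counit (a * x) : K^o).
  by move=> k u v; rewrite mulrDl -scalerAl linearP.
exists (linfun (fun a : A => counit (a * x) : K^o)).
rewrite (lin_tcounitE H x (@lin_id _ A)).
by apply: eq_tlift => a b; rewrite linfun_linear.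
Qed.
Let ml1 (X : tens M 'End(A)) : lin (tmul X) := proj1 (bilin_tmul M A) X.
Let ml2 (X : tens M 'End(A)) : lin (fun Y => tmul Y X) := proj2 (bilin_tmul M A) X.
Let taul : lin tau := lin_tauL_coaction.
Let mend_elll : lin mend_ell := lin_mend_ell.
Let actl := bilin_act.

Lemma tmulA (X Y Z : tens M 'End(A)) : tmul X (tmul Y Z) = tmul (tmul X Y) Z.
Proof. by apply: mend_ext => n b; rewrite !(tact_mul pil). Qed.

(** Lambda on M (x) A, before the quotient, where it can be checked on pure tensors. *)
Definition Lambda0 (t : tens M A) : tens M 'End(A) :=
  \sw_(m, a <- t) tmul (tau m) (mend_ell a).

Let Lambda0_bilin : bilin (fun m a => tmul (tau m) (mend_ell a)).
Proof.
split=> [m|a]; first exact: (lin_comp (ml1 _) mend_elll).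
exact: (lin_comp (ml2 _) taul).
Qed.

Lemma lin_Lambda0 : lin Lambda0.
Proof. by apply: lin_tlift => [a|]; [exact: (proj2 Lambda0_bilin a) | exact: lin_id]. Qed.

Lemma Lambda0_pure m a : Lambda0 (m \ox a) = tmul (tau m) (mend_ell a).
Proof. by rewrite /Lambda0 tlift_pureE. Qed.

Lemma Lambda0_rel t : crossed_rel act t -> Lambda0 t = 0.
Proof.
move=> [m [a [b [bl ->]]]]; rewrite (linB lin_Lambda0) !Lambda0_pure mend_ell_mul tmulA.
by rewrite tau_mend_ell_tcounit // ?subrr //; exact: leftA_tcounit.
Qed.

Lemma Lambda0_lspan t : lspan (crossed_rel act) t -> Lambda0 t = 0.
Proof.
move/(_ [set v | Lambda0 v = 0]%classic); apply => /= [|k u w u0 w0|u]; last exact: Lambda0_rel.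
  exact: (lin0 lin_Lambda0).
by rewrite (lin_Lambda0 k u w) u0 w0 scaler0 addr0.
Qed.

Let lin_crossed1 (a : A) m' a' :
  lin (fun m : M => \D_(u, v <- a) ((m * act u m') \ox (v * a'))).
Proof. by lin_auto. Qed.
Let lin_crossed2 m m' a' :
  lin (fun a : A => \D_(u, v <- a) ((m * act u m') \ox (v * a'))).
Proof. by lin_auto. Qed.
Let lin_crossed3 m (a : A) a' :
  lin (fun m' : M => \D_(u, v <- a) ((m * act u m') \ox (v * a'))).
Proof. by lin_auto. Qed.
Let lin_crossed4 (m : M) (a : A) m' :
  lin (fun a' : A => \D_(u, v <- a) ((m * act u m') \ox (v * a'))).
Proof. by lin_auto. Qed.

Lemma lin_crossed_mull s : lin (crossed_mul act s).
Proof.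
apply: lin_tliftf => m a; apply: lin_tlift => [a'|]; last exact: lin_id.
exact: lin_crossed3.
Qed.

Lemma lin_crossed_mulr t : lin ((crossed_mul act)^~ t).
Proof.
apply: lin_tlift => [a|]; last exact: lin_id.
by apply: lin_tliftf => m' a'; exact: lin_crossed1.
Qed.

Lemma crossed_mul_pure (m : M) (a : A) (m' : M) (a' : A) :
  crossed_mul act (m \ox a) (m' \ox a')
  = \D_(u, v <- a) ((m * act u m') \ox (v * a')).
Proof.
rewrite /crossed_mul tlift_pureE; last first.
  split=> [u|v]; cbv beta; apply: lin_tliftf => n c.
    exact: lin_crossed2.
  exact: lin_crossed1.
rewrite tlift_pureE //; split=> [u|v]; cbv beta; first exact: lin_crossed4.
exact: lin_crossed3.
Qed.

Lemma Lambda0_mul s t : Lambda0 (crossed_mul act s t) = tmul (Lambda0 s) (Lambda0 t).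
Proof.
move: s; apply: tens_ext => [||m a].
- exact: (lin_comp lin_Lambda0 (lin_crossed_mulr t)).
- exact: (lin_comp (ml2 _) lin_Lambda0).
move: t; apply: tens_ext => [||m' a'].
- exact: (lin_comp lin_Lambda0 (lin_crossed_mull _)).
- exact: (lin_comp (ml1 _) lin_Lambda0).
rewrite crossed_mul_pure !Lambda0_pure (sw_comp _ _ lin_Lambda0).
transitivity (tmul (tmul (tau m) (tmul (mend_ell a) (tau m'))) (mend_ell a'));
  last by rewrite !tmulA.
have l : lin (fun X => tmul (tmul (tau m) X) (mend_ell a')) by exact: (lin_comp (ml2 _) (ml1 _)).
rewrite mend_ell_tau // (sw_comp _ _ l); apply: eq_sw => u v.
by rewrite Lambda0_pure tau_mul // mend_ell_mul !tmulA.
Qed.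

(** * The Haar functional and compatibility with the involution *)

Section Star.
Variable h : dual.
Hypotheses (h_haar : haar_integral h) (h_pos : faithful_positive h).
Local Notation dot := (l2_dot h).

(** Evaluated at x, [haar_l] reads psi(x_1) h(x_2) = psi(x_1 S(x_2)) h(x_3) for every functional
    psi, and functionals separate the points of A. *)
Lemma haar_left_integral x :
  \D_(u, v <- x) ((h v : K) *: u) = \D_(u, v <- x) ((h v : K) *: et u).
Proof.
have hl : lin (h : A -> K^o) by exact: lin_hom.
have eq_dual (y z : A) : (forall psi : dual, psi y = psi z) -> y = z.
  move=> yz; rewrite [y](coord_vbasis (memvf y)) [z](coord_vbasis (memvf z)).
  by apply: eq_bigr => i _; have := yz (dual_basis i); rewrite !dual_basisE => ->.
have hatE (psi phi : dual) y :
    hat_mul psi phi y = \D_(u, v <- y) ((psi u : K) * (phi v : K) : K^o).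
  rewrite /hat_mul linfun_linear //.
  suff : lin (fun y => \D_(u, v <- y) ((psi u : K) * (phi v : K) : K^o)) by exact.
  by apply: (lin_swx H (x := id)) => [b|]; [lin_auto | exact: lin_id].
apply: eq_dual => psi; have pl : lin (psi : A -> K^o) by exact: lin_hom.
have /lfunP/(_ x) := haar_l h_haar psi; rewrite hatE => E.
rewrite (sw_comp (g := psi)) //.
transitivity (\D_(u, v <- x) ((psi u : K) * (h v : K) : K^o)).
  by apply: eq_sw => u v; rewrite (linZ pl) mulrC.
rewrite E /tlift sum_lfunE.
transitivity (\D_(p, q <- x) \D_(u, v <- p) ((psi (u * S v) : K) * (h q : K) : K^o)).
  transitivity (\sum_i \D_(p, q <- x) \D_(u, v <- p)
    (((hat_comul psi) i u : K) * ((vbasis {:dual})`_i (S v) : K) * (h q : K) : K^o)).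
    apply: eq_bigr => i _; rewrite hatE; apply: eq_sw => p q; rewrite hatE mulr_suml.
    by apply: eq_bigr => j _; rewrite hat_antipodeE.
  rewrite {1}/sw exchange_big; apply: eq_bigr => i _.
  rewrite {1}/sw exchange_big; apply: eq_bigr => j _.
  by rewrite -mulr_suml -hat_comulP.
rewrite (sw_comp (g := psi)) //; apply: eq_sw => p q.
rewrite (linZ pl) /tcounit (sw_comp (g := psi)) //.
by rewrite [RHS]mulrC mulr_suml.
Qed.
End Star.
Section Star.
Variable h : dual.
Hypotheses (h_haar : haar_integral h) (h_pos : faithful_positive h).
Local Notation dot := (l2_dot h).
Let hl : lin (h : A -> K^o). Proof. exact: lin_hom. Qed.

Lemma lin_l2_dot x : lin (dot x : A -> K^o).
Proof. by apply: (lin_comp hl); exact: (lin_mulr _ (@lin_id _ A)). Qed.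

Lemma l2_dot_ge0 x : 0 <= dot x x. Proof. exact: (proj1 h_pos). Qed.
Lemma l2_dot_eq0 x : dot x x = 0 -> x = 0. Proof. exact: (proj2 h_pos). Qed.

(* By polarization, as [dot z z] is real. *)
Lemma l2_dotC x y : dot y x = (dot x y)^*.
Proof.
have Dl u v w : dot (u + v) w = dot u w + dot v w.
  by rewrite /l2_dot starD mulrDl (linD hl).
have Zl k u w : dot (k *: u) w = k^* * dot u w.
  by rewrite /l2_dot starZ -scalerAl (linZ hl).
have Dr u v w : dot w (u + v) = dot w u + dot w v by exact: (linD (lin_l2_dot w)).
have Zr k u w : dot w (k *: u) = k * dot w u by exact: (linZ (lin_l2_dot w)).
have real z : (dot z z)^* = dot z z by apply/CrealP/ger0_real/l2_dot_ge0.
have E k : (k * dot x y + k^* * dot y x)^* = k * dot x y + k^* * dot y x.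
  have := real (x + k *: y); rewrite !(Dl, Dr, Zl, Zr).
  have := real (k *: y); rewrite !(Zl, Zr).
  rewrite !rmorphD /= real => -> /eqP.
  rewrite -!addrA (can_eq (addKr _)) !addrA (can_eq (addrK _)) => /eqP.
  by [].
have := E 1; have := E 'i; rewrite rmorph1 conjCi !mul1r !rmorphD !rmorphM /=
  conjCi rmorphN /= conjCi.
set a := dot x y; set b := dot y x.
rewrite opprK !mulNr => E1 E2.
have {}E1 : - a^* + b^* = a - b.
  apply: (mulfI (neq0Ci K)).
  by rewrite mulrDr mulrN mulrBr.
apply: (mulfI (_ : 2%:R != 0 :> K)); first by rewrite pnatr_eq0.
rewrite !mulr_natl !mulr2n.
have -> : a^* + a^* = (a^* + b^*) - (- a^* + b^*) by ring.
by rewrite E1 E2; ring.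
Qed.

Local Notation adj := (dot_adj dot).

Lemma l2_adjE (T T' : 'End(A)) :
  (forall a b, dot a (T b) = dot (T' a) b) -> adj T = T'.
Proof. exact: (dot_adjE lin_l2_dot l2_dotC l2_dot_ge0 l2_dot_eq0). Qed.

Lemma adj_ell a : adj (ell a) = ell (star a).
Proof.
apply: l2_adjE => x y.
by rewrite !ellE /l2_dot starM starK mulrA.
Qed.

(** With a = [star x], [haar_invariance] followed by S' gives h(a y_2) S'(y_1) = h(a_2 y) a_1: the
    coproduct moves from y to x. *)
Lemma adj_tauL (phi : dual) b :
  adj (tauL phi) b = \D_(u, v <- b) ((phi (star u) : K)^* *: v).
Proof.
have pl : lin (phi : A -> K^o) by exact: lin_hom.
have psl : lin (fun u => (phi (star u) : K)^* : K^o).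
  move=> k u v; rewrite starD starZ (linD pl) (linZ pl) rmorphD.
  by rewrite [X in X^* + _]/(_ * _) rmorphM /= conjCK.
pose T' b := \D_(u, v <- b) ((phi (star u) : K)^* *: v).
have T'l : lin T' by rewrite /T'; lin_auto.
have TE x : linfun T' x = T' x by apply: linfun_linear.
rewrite -/(T' b) -TE; suff -> : adj (tauL phi) = linfun T' by [].
apply: l2_adjE => x y; rewrite tauLE TE (sw_comp _ _ (lin_l2_dot x)) /l2_dot.
transitivity (\D_(u, v <- y) ((h (star x * v) : K) *: (phi (sinv u) : K^o))).
  apply: eq_sw => u v; rewrite -scalerAr (linZ hl); exact: mulrC.
have psinv : lin (fun u => phi (sinv u) : K^o) by exact: (lin_comp pl).
transitivity (phi (sinv (\D_(u, v <- y) ((h (star x * v) : K) *: u)))).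
  by rewrite (sw_comp _ _ psinv); apply: eq_sw => u v; rewrite (linZ psinv).
rewrite (haar_invariance H (star x) y hl (haar_left_integral h_haar)).
rewrite (sw_comp _ _ psinv).
rewrite (sw_star H (f := fun u v => phi (sinv ((h (v * y) : K) *: S u)) : K^o)); last first.
  split=> u; apply: (lin_comp psinv).
    by apply: lin_scalel; apply: (lin_comp hl); exact: (lin_mull _ (@lin_id _ A)).
  by apply: lin_scaler; exact: lin_hom.
have hyl : lin (fun z => h (z * y) : K^o).
  by apply: (lin_comp hl); exact: (lin_mull _ (@lin_id _ A)).
have sl := lin_star (B := A) hyl.
rewrite /T' (sw_comp _ _ sl); apply: eq_sw => u v.
rewrite (linZ psinv) (sinv_antipode H) starZ conjCK -scalerAl (linZ hl); exact: mulrC.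
Qed.

Lemma lin_adj : lin (adj : 'End(A) -> conjmod 'End(A)).
Proof. exact: (lin_dot_adj lin_l2_dot l2_dotC l2_dot_ge0 l2_dot_eq0). Qed.

Lemma adj_comp (T U : 'End(A)) : adj (T \o U)%VF = (adj U \o adj T)%VF.
Proof. exact: (dot_adj_comp lin_l2_dot l2_dotC l2_dot_ge0 l2_dot_eq0). Qed.

Local Notation mstar := (tstar (M := M) adj).

Lemma mstar_mend_ell a : mstar (mend_ell a) = mend_ell (star a).
Proof. by rewrite /mend_ell (tstar_pure lin_adj) star1 adj_ell. Qed.

(** By [adj_tauL] the adjoint multiplies by [star (act (star u) m)]; [act_star] makes this the
    action of [star (S (star u))], which is S'(u), on [star m]. *)
Lemma mstar_tau m : mstar (tau m) = tau (star m).
Proof.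
have al n : lin (act^~ n) by exact: (proj2 actl).
apply: mend_ext => n b.
rewrite tact_tauL_coaction // tauL_coactionE (lin_sumE (lin_tstar adj)) (lin_sumE (tl2 _)).
transitivity (\sum_(i < \dim {:A}) \D_(u, v <- b)
   ((star (act (coord (vbasis {:A}) i (star u) *: (vbasis {:A})`_i) m) * n) \ox v)).
  apply: eq_bigr => i _; rewrite (tstar_pure lin_adj) tact_pure // adj_tauL.
  have l (w : M) : lin (fun v : A => w \ox v) by lin_auto.
  have l' (v : A) : lin (fun w : M => (w * n) \ox v) by lin_auto.
  rewrite (sw_comp _ _ (l _)); apply: eq_sw => u v.
  by rewrite dual_basisE (linZ (l _)) (linZ (al m)) starZ (linZ (l' v)).
rewrite /sw exchange_big; apply: eq_bigr => j _.
set u := comul_l _ _; set v := comul_r _.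
have l : lin (fun a : A => star (act a m) * n \ox v : conjmod (tens M A)).
  have l' : lin (fun w : M => (w * n) \ox v) by lin_auto.
  by move=> k a a'; rewrite (al m) starD starZ (linD l') (linZ l').
transitivity (star (act (star u) m) * n \ox v).
  by rewrite [in RHS](coord_vbasis (memvf (star u))) (lin_sumE l).
by rewrite (act_star act_alg).
Qed.

Lemma Lambda0_star t : Lambda0 (crossed_star act t) = mstar (Lambda0 t).
Proof.
rewrite /crossed_star (tlift_comp _ _ lin_Lambda0).
rewrite (tlift_comp (X := conjmod (tens M 'End(A))) _ _ (lin_tstar adj)).
apply: eq_tlift => m a.
rewrite (tstar_mul lin_adj adj_comp) mstar_mend_ell mstar_tau.
rewrite Lambda0_mul // !Lambda0_pure // tau_mend_ell1 // -tmulA // mend_ell_tau //.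
rewrite (sw_comp _ _ (ml1 _)); apply: eq_sw => u v.
by rewrite tmulA // -tau_mul // mul1r.
Qed.
End Star.

(** * The formula for phi -> a, and a left inverse of Lambda *)

Lemma Lambda0_tact m a n b :
  tact0 (Lambda0 (m \ox a)) (n \ox b)
  = \D_(u, v <- a * b) ((act (sinv u) m * n) \ox v).
Proof. by rewrite Lambda0_pure // tact_tau_mend_ell. Qed.

Lemma tauRE (phi : dual) b : tauR phi b = \D_(u, v <- b) ((phi v : K) *: u).
Proof.
rewrite /tauR linfun_linear //.
suff : lin (fun b => \D_(u, v <- b) ((phi v : K) *: u)) by exact.
by lin_auto.
Qed.

(** On n (x) b the left side is rewritten by [sw_harpoon], and [hat_comulP] splits phi(v S(d)) into
    phi_1(v) phi_2(S(d)), one factor for each tau_R. *)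
Lemma Lambda0_harpoonl m a (phi : dual) :
  Lambda0 (m \ox harpoonl phi a)
  = \sw_(phi1, phi2 <- hat_comul phi)
      tmul (tmul (1 \ox tauR phi1) (Lambda0 (m \ox a))) (1 \ox tauR (hat_antipode A phi2)).
Proof.
apply: mend_ext => n b; have pl : lin (phi : A -> K^o) by exact: lin_hom.
pose F y := \D_(u, v <- y) ((act (sinv u) m * n) \ox v).
have Fl : lin F by rewrite /F; lin_auto.
transitivity (\D_(u, v <- a) ((phi v : K) *: F (u * b))).
  rewrite Lambda0_tact -/(F (harpoonl phi a * b)) /harpoonl.
  have l : lin (fun y => F (y * b)) by apply: (lin_comp Fl); exact: (lin_mull _ (@lin_id _ A)).
  rewrite (tlift_comp _ _ l).
  by apply: eq_tlift => u v; rewrite (linZ l).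
rewrite (sw_harpoon H _ _ Fl pl) (tlift_comp _ _ (tl2 _)) /tlift.
transitivity (\sum_i \D_(c, d <- b) \D_(u, v <- a * c)
   ((((hat_comul phi) i v : K) * ((vbasis {:dual})`_i (S d) : K)) *: F u)).
  rewrite exchange_big; apply: eq_bigr => j _.
  rewrite exchange_big; apply: eq_bigr => k _.
  by rewrite -scaler_suml -hat_comulP.
apply: eq_bigr => i _; set p1 := hat_comul phi i; set p2 := (vbasis _)`_i.
rewrite !(tact_mul pil) // tact_pure // tauRE pi1.
have l : lin (fun c => tact0 (1 \ox tauR p1) (tact0 (Lambda0 (m \ox a)) (n \ox c))).
  by apply: (lin_comp (tl1 _)); apply: (lin_comp (tl1 _)); apply: lin_pure2; exact: lin_id.
rewrite (sw_comp _ _ l); apply: eq_sw => c d.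
rewrite (linZ l) hat_antipodeE Lambda0_tact (sw_comp _ _ (tl1 _)).
transitivity ((p2 (S d) : K) *: \D_(u, v <- a * c) ((p1 v : K) *: F u)).
  rewrite [RHS]scaler_sumr; apply: eq_bigr => j _; rewrite scalerA; congr (_ *: _); exact: mulrC.
congr (_ *: _).
have B2 : trilin (fun u x q : A => (p1 q : K) *: ((act (sinv u) m * n) \ox x)).
  split=> x y.
  - by lin_auto.
  - by lin_auto.
  - by apply: lin_scalel; exact: lin_hom.
transitivity (\D_(s, q <- a * c) \D_(u, x <- s) ((p1 q : K) *: ((act (sinv u) m * n) \ox x))).
  by apply: eq_sw => s q; rewrite [LHS]scaler_sumr.
rewrite (sw_coassoc H _ B2); apply: eq_sw => u v.
have l2 : lin (fun v : A => (act (sinv u) m * n) \ox v) by lin_auto.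
rewrite tact_pure // pi1 tauRE (sw_comp _ _ l2).
by apply: eq_sw => x q; rewrite (linZ l2).
Qed.

(* If X(1 (x) 1) = n (x) c, then [retract X] is c_1 |> n (x) c_2. *)
Definition retract0 (y : tens M A) : tens M A :=
  \sw_(n, d <- y) \D_(u, v <- d) (act u n \ox v).

Let retract_bilin : bilin (fun (n : M) d => \D_(u, v <- d) (act u n \ox v)).
Proof. by lin_auto. Qed.

Lemma lin_retract0 : lin retract0.
Proof. by apply: lin_tlift => [a|]; [exact: (proj2 retract_bilin a) | exact: lin_id]. Qed.

Definition retract (X : tens M 'End(A)) : tens M A := retract0 (tact0 X (1 \ox 1)).

Lemma lin_retract : lin retract.
Proof. exact: (lin_comp lin_retract0 (tl2 _)). Qed.

Lemma lin_crossed_class : lin (crossed_class act).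
Proof. exact: lquot_pi_linear. Qed.

Lemma crossed_tcounit n y x : crossed act n (et y * x) = crossed act (n * act (et y) 1) x.
Proof.
apply/lquot_eqP => W _ _; apply; exists n, x, (et y); split=> //.
exact: tcounit_leftA.
Qed.

Lemma Lambda0_retract t : crossed_class act (retract (Lambda0 t)) = crossed_class act t.
Proof.
move: t; apply: tens_ext => [||m a].
- exact: (lin_comp lin_crossed_class (lin_comp lin_retract lin_Lambda0)).
- exact: lin_crossed_class.
rewrite /retract Lambda0_tact mulr1 (sw_comp _ _ lin_retract0) (sw_comp _ _ lin_crossed_class).
have gl : bilin (crossed act).
  split=> [n|y]; apply: (lin_comp lin_crossed_class).
    exact: (lin_pure2 _ (@lin_id _ _)).
  exact: (lin_pure1 _ (@lin_id _ _)).
have act_mul := (actM act_alg).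
rewrite -[RHS](sw_act_retract H bilin_act (actA act_alg) (act1 act_alg) act_mul m a gl
  crossed_tcounit).
apply: eq_sw => u v; rewrite mulr1 /retract0 (tlift_pureE _ _ retract_bilin).
by rewrite (sw_comp _ _ lin_crossed_class).
Qed.

(** The choice of representative is harmless because [Lambda0] vanishes on the span of the
    relations. *)
Definition LambdaQ (q : crossed_product act) : tens M 'End(A) := Lambda0 (repr q).

Lemma LambdaQE t : LambdaQ (crossed_class act t) = Lambda0 t.
Proof.
apply/subr0_eq; rewrite -(linB lin_Lambda0); apply: Lambda0_lspan.
by apply/lquot_eqP; rewrite reprK.
Qed.

Lemma crossed_classP q : exists t, q = crossed_class act t.
Proof. by exists (repr q); rewrite /crossed_class reprK. Qed.

Lemma lin_LambdaQ : lin LambdaQ.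
Proof.
move=> k q q'; have [[t ->] [t' ->]] := (crossed_classP q, crossed_classP q').
by rewrite -(lin_crossed_class k t t') !LambdaQE (lin_Lambda0 k t t').
Qed.

Lemma LambdaQ_retract q : crossed_class act (retract (LambdaQ q)) = q.
Proof. by have [t ->] := crossed_classP q; rewrite LambdaQE Lambda0_retract. Qed.

Lemma range_LambdaQP X : range LambdaQ X <-> X = Lambda0 (retract X).
Proof.
split=> [[q _ <-]|->]; first by rewrite -[RHS]LambdaQE LambdaQ_retract.
by exists (crossed_class act (retract X)) => //; exact: LambdaQE.
Qed.

(** * Closedness of the range, for an abstract topology and for C*-norms *)

Section Closedness.
Variables (J : finType) (o : J -> A) (c : J -> A -> K^o).
Hypotheses (cl : forall i, lin (c i)) (oc : forall a, a = \sum_i (c i a : K) *: o i).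
Local Notation entry := (entry (M := M) o c).
Local Notation munit := (munit o c).

(** The coefficients do not depend on X: [e i j v] is the element of A whose action on n gives the
    entry of Lambda(n x| v), and q is [e i j v * u] summed over the coproduct u (x) v of
    [munit k l 1]. *)
Lemma entry_retract : exists q : J -> J -> J -> J -> A, forall X i j,
  entry i j (Lambda0 (retract X)) = \sum_k \sum_l act (q i j k l) (entry k l X).
Proof.
pose e i j v := \D_(p, q <- v * o j) ((c i q : K) *: sinv p).
have al n : lin (act^~ n) by exact: (proj2 actl).
have eE i j n v : entry i j (Lambda0 (n \ox v)) = act (e i j v) n.
  rewrite -[LHS]mulr1 -(crd_tact o cl i j (Lambda0 (n \ox v)) 1 pil) Lambda0_tact //.
  rewrite (sw_comp _ _ (lin_crd c i)) (sw_comp _ _ (al n)).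
  by apply: eq_sw => p q; rewrite crd_pure // mulr1 (linZ (al n)).
have el i j : lin (e i j) by rewrite /e; lin_auto.
have ell' := @lin_entry R M A J o c.
exists (fun i j k l => \D_(u, v <- munit k l 1) (e i j v * u)) => X i j.
have Ll : lin (fun X => entry i j (Lambda0 (retract X))).
  exact: (lin_comp (ell' i j) (lin_comp lin_Lambda0 lin_retract)).
rewrite [in LHS](entry_sum cl oc X) (lin_sumE Ll); apply: eq_bigr => k _.
rewrite (lin_sumE Ll); apply: eq_bigr => l _; set m := entry k l X.
rewrite /retract tact_pure // mulr1.
have Ll' : lin (fun y => entry i j (Lambda0 y)) by exact: (lin_comp (ell' i j) lin_Lambda0).
rewrite /retract0 tlift_pureE; last by lin_auto.
rewrite (sw_comp _ _ Ll') (sw_comp _ _ (al m)); apply: eq_sw => u v.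
by rewrite eE (actA act_alg).
Qed.

(* The neighbourhoods of 0 for a topology on M; the norm topology and the weak
   topologies are the two instances. *)
Record null_filter (F : set (set M)) : Prop := {
  null_setT : F setT;
  null_setI : forall U V, F U -> F V -> F (U `&` V)%classic;
  null_half : forall U, F U ->
    exists2 V, F V & forall x y, V x -> V y -> U (x + y);
  null_act : forall a U, F U -> F [set m | U (act a m)]%classic;
  null_0 : forall U, F U -> U 0;
  null_separated : forall x, (forall U, F U -> U x) -> x = 0
}.

Lemma null_filter_sum F : null_filter F ->
  forall (s : seq (A * (J * J))) U, F U -> exists2 V, F V &
    forall z : J * J -> M, (forall kl, V (z kl)) ->
    U (\sum_(x <- s) act x.1 (z x.2)).
Proof.
move=> nF; elim=> [|x s IH] U FU.
  exists setT => [|z _]; first exact: null_setT nF.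
  by rewrite big_nil; exact: null_0 nF _ FU.
have [V FV VU] := null_half nF FU; have [V' FV' sV] := IH V FV.
exists (V' `&` [set m | V (act x.1 m)])%classic.
  exact: null_setI nF _ _ FV' (null_act nF x.1 FV).
move=> z zV; rewrite big_cons; apply: VU; first by have [] := zV x.2.
by apply: sV => kl; have [] := zV kl.
Qed.

Lemma range_LambdaQ_closed F X : null_filter F ->
  (forall U, F U -> exists2 Y, range LambdaQ Y &
    forall i j, U (entry i j (X - Y))) ->
  range LambdaQ X.
Proof.
move=> nF XF; apply/range_LambdaQP/subr0_eq.
have [q qE] := entry_retract.
(* The pair (1, (i, j)) yields the entry of Z itself, since 1 acts trivially; the remaining pairs
   yield the entries of Lambda G with opposite sign. *)
have pE Z i j : entry i j (Z - Lambda0 (retract Z)) =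
   \sum_(x <- (1, (i, j)) :: [seq (- q i j kl.1 kl.2, kl) | kl <- enum {: J * J}])
     act x.1 (entry x.2.1 x.2.2 Z).
  rewrite (linB (lin_entry o c i j)) qE big_cons big_map (act1 act_alg); congr (_ + _).
  rewrite big_enum /= pair_big /= -sumrN; apply: eq_bigr => kl _.
  have al n : lin (act^~ n) by exact: (proj2 actl).
  by rewrite -scaleN1r -[- q _ _ _ _]scaleN1r (linZ (al _)).
rewrite (entry_sum cl oc (X - _)) big1 // => i _; rewrite big1 // => j _.
suff -> : entry i j (X - Lambda0 (retract X)) = 0.
  by rewrite -(scale0r (0 : M)); have l : lin (fun m : M => m \ox munit i j);
     [exact: (lin_pure1 _ (@lin_id _ _)) | rewrite (linZ l) scale0r].
apply: (null_separated nF) => U FU.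
have [V FV sV] := null_filter_sum nF
  ((1, (i, j)) :: [seq (- q i j kl.1 kl.2, kl) | kl <- enum {: J * J}]) FU.
have [Y Yr YV] := XF V FV.
(* Y is fixed by Lambda G, so X may be replaced by X - Y, whose entries all lie in V. *)
have -> : X - Lambda0 (retract X) = (X - Y) - Lambda0 (retract (X - Y)).
  have YE := (proj1 (range_LambdaQP Y) Yr).
  rewrite (linB lin_retract) (linB lin_Lambda0) -YE.
  by rewrite opprB addrA subrK.
by rewrite pE; apply: (sV (fun kl => entry kl.1 kl.2 (X - Y))) => kl; exact: YV.
Qed.

(* Compressing with matrix units bounds the entries of X by its norm, for every
   C*-norm on M (x) End A. *)
Lemma entry_compress i j X :
  entry i j X \ox \1%VF
  = \sum_k tmul (tmul (1 \ox munit k i) X) (1 \ox munit j k).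
Proof.
move: X; apply: tens_ext => [||m T].
- exact: (lin_comp (lin_pure1 _ (@lin_id _ _)) (lin_entry o c i j)).
- by apply: lin_sum => k; apply: (lin_comp (ml2 _)); exact: ml1.
have l : lin (fun T : 'End(A) => m \ox T) by exact: (lin_pure2 _ (@lin_id _ _)).
have l' : lin (fun m : M => m \ox (\1%VF : 'End(A))) by exact: (lin_pure1 _ (@lin_id _ _)).
rewrite entry_pure // (linZ l').
under eq_bigr => k _ do rewrite !tmul_pure mul1r mulr1.
rewrite -(lin_sumE l) -(linZ l); congr (_ \ox _).
apply/lfunP => b; rewrite scale_lfunE id_lfunE sum_lfunE [in LHS](oc b) scaler_sumr.
apply: eq_bigr => k _; rewrite !comp_lfunE !(munitE o cl) (linZ (lin_hom T)) (linZ (cl i)) !scalerA.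
by rewrite [in LHS]mulrC.
Qed.

Variables (h : dual) (nrm : M -> R) (N : tens M 'End(A) -> R).
Hypotheses (nP : cstar_norm *%R star nrm)
  (act_cont : forall a : A, norm_continuous nrm (act a))
  (NP : cstar_norm (@mend_mul R A M) (mend_star h) N)
  (N1 : forall m : M, N (m \ox \1%VF) = nrm m).

Lemma entry_bound i j X : nrm (entry i j X)
  <= (\sum_k N (1 \ox munit k i) * N (1 \ox munit j k)) * N X.
Proof.
have N_ge0 := cstar_norm_ge0 NP; have NM := cstar_normM NP.
rewrite -N1 entry_compress; apply: le_trans (cstar_norm_sum NP _) _.
rewrite mulr_suml; apply: ler_sum => k _; apply: le_trans (NM _ _) _.
by rewrite [leRHS]mulrAC; apply: ler_wpM2r => //; exact: NM.
Qed.

Definition norm_null : set (set M) :=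
  [set U | exists2 d, 0 < d & forall m, nrm m < d -> U m]%classic.

Lemma norm_null_filter : null_filter norm_null.
Proof.
have n0 := cstar_norm0 nP; have ge0 := cstar_norm_ge0 nP.
split=> [|U V [d d0 dU] [e e0 eV]|U [d d0 dU]|a U [d d0 dU]|U [d d0 dU]|x xU].
- by exists 1.
- exists (Num.min d e); first by rewrite lt_min d0.
  by move=> m; rewrite lt_min => /andP[/dU Um /eV Vm].
- exists [set m | nrm m < d / 2]%classic.
    by exists (d / 2) => //; rewrite divr_gt0.
  move=> x y /= xd yd; apply: dU; apply: le_lt_trans (cstar_normD nP _ _) _.
  by rewrite [d]splitr ltrD.
- have [e e0 eU] := act_cont a 0 d0; exists e => // m me; apply: dU.
  have := eU m; rewrite subr0 (lin0 (proj1 actl a)) subr0; exact.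
- by apply: dU; rewrite n0.
(* Otherwise the open ball of radius [nrm x] would be a neighbourhood that misses x. *)
- apply: (cstar_norm_eq0 nP); apply/eqP; rewrite eq_le ge0 andbT leNgt; apply/negP => x0.
  have : [set m | nrm m < nrm x]%classic x by apply: xU; exists (nrm x).
  by rewrite /= ltxx.
Qed.

Lemma range_LambdaQ_norm_closed : norm_closed N (range LambdaQ).
Proof.
move=> X XN; apply: (range_LambdaQ_closed norm_null_filter) => U [d d0 dU].
have N_ge0 := cstar_norm_ge0 NP.
pose C i j := \sum_k N (1 \ox munit k i) * N (1 \ox munit j k).
have C0 i j : 0 <= C i j by apply: sumr_ge0 => k _; rewrite mulr_ge0.
(* One bound for all entries; the summand 1 makes it positive, so that d / D is a legitimate
   radius. *)
pose D := 1 + \sum_i \sum_j C i j.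
have D0 : 0 < D.
  by rewrite /D ltr_pwDl //; apply: sumr_ge0 => i _; apply: sumr_ge0.
have [Y Yr XY] := XN (d / D) (divr_gt0 d0 D0).
exists Y => // i j; apply: dU; apply: le_lt_trans (entry_bound i j _) _.
apply: le_lt_trans (_ : D * N (X - Y) < d); last by rewrite mulrC -ltr_pdivlMr.
apply: ler_wpM2r => //; apply: le_trans (_ : \sum_i \sum_j C i j <= D); last by rewrite lerDr.
have -> : \sum_i \sum_j C i j = C i j + (\sum_(l | l != j) C i l
    + \sum_(k | k != i) \sum_l C k l).
  by rewrite (bigD1 i) //= (bigD1 j) //= addrA.
rewrite lerDl addr_ge0 //; first by apply: sumr_ge0.
by apply: sumr_ge0 => k _; apply: sumr_ge0.
Qed.
End Closedness.

(** * The von Neumann case, on H (x) L^2(A, h) *)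

Section VonNeumannCase.
Variable h : dual.
Hypotheses (h_haar : haar_integral h) (h_pos : faithful_positive h).
Variables (J : finType) (o : J -> A).
Hypotheses (oo : orthonormal_family (l2_dot h) o).
Hypothesis oV : forall a, a = \sum_i (l2_dot h (o i) a : K) *: o i.
Let c (i : J) (a : A) : K^o := l2_dot h (o i) a.
Let cl i : lin (c i) := lin_l2_dot h (o i).
Let co i j : c i (o j) = (i == j)%:R := oo i j.
Local Notation entry := (entry (M := M) o c).
Local Notation munit := (munit o c).
Local Notation adj := (dot_adj (l2_dot h)).
Local Notation mstar := (tstar (M := M) adj).

(** The coordinates are scalar products with an orthonormal basis, so adjoints have the conjugate
    transposed matrix. *)
Lemma entry_mstar i j Z : entry j i (mstar Z) = star (entry i j Z).
Proof.
move: Z; apply: (@tens_ext _ _ _ (conjmod M)) => [||m T].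
- by move=> k X Y; rewrite tstarD tstarZ (lin_entry o c j i k^*).
- by move=> k X Y; rewrite (lin_entry o c i j k X Y) starD starZ.
have E : c j (adj T (o i)) = (c i (T (o j)) : K)^*.
  rewrite /c (l2_dotC h_pos).
  by rewrite -(dot_adjP (lin_l2_dot h) (l2_dotC h_pos) (l2_dot_ge0 h_pos) (l2_dot_eq0 h_pos)).
by rewrite (tstar_pure (lin_adj h_pos)) !entry_pure // E starZ.
Qed.

Variables (w : weak_topology) (U : lmodType K) (dot : U -> U -> K) (pi : M -> U -> U).
Hypothesis vN : von_neumann_on w dot pi.
Hypothesis act_cont : forall a : A, weakly_continuous w dot pi (act a).

Let hs := vn_hilbert vN.
Let dotl x : lin (dot x : U -> K^o) := hilbert_linear hs x.
Let dotC x y : dot y x = (dot x y)^* := hilbert_herm hs x y.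
Let dot_ge0 x : 0 <= dot x x := hilbert_ge0 hs x.
Let vnI := vn_image vN.
Let pi_bounded m : bounded_operator dot (pi m).
Proof. by apply: (vn_bounded vnI); exists m. Qed.
Let pib : bilin pi.
Proof. by split=> [m|x]; [exact: (proj1 (pi_bounded m)) | exact: (vn_linear vN)]. Qed.

Local Notation TD := (tens_dot dot h).
Local Notation crd := (crd c).
Let oc : forall a, a = \sum_i (c i a : K) *: o i := oV.

Lemma lin_tens_dot x : lin (TD x : tens U A -> K^o).
Proof.
apply: lin_tliftf => xi a; apply: lin_tlift => [b|]; last exact: lin_id.
exact: (lin_mull (B := K^o) _ (dotl xi)).
Qed.

Lemma tens_dot_basis xi i eta j :
  TD (xi \ox o i) (eta \ox o j) = (i == j)%:R * dot xi eta.
Proof.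
have l2l := lin_l2_dot h; have l2C := l2_dotC h_pos.
rewrite /tens_dot tlift_pure => [|u a b|k u a]; last first.
- apply: eq_tlift => v b; rewrite (dotZl dotl dotC) (dotZl l2l l2C).
  by rewrite mulrCA mulrA.
- rewrite -big_split; apply: eq_bigr => n _.
  by rewrite (dotDl l2l l2C) mulrDr.
rewrite tlift_pure => [|u a b|k u a]; last first.
- by rewrite (dotZr dotl) (dotZr l2l) mulrCA mulrA.
- by rewrite (linD (l2l _)) mulrDr.
by rewrite oo mulrC.
Qed.

Lemma tens_dotDl x y z : TD (x + y) z = TD x z + TD y z.
Proof.
apply: tliftD => a u v; rewrite -big_split; apply: eq_bigr => n _.
by rewrite (dotDl dotl dotC) mulrDl.
Qed.

Lemma tens_dot_suml (I : finType) (F : I -> tens U A) z :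
  TD (\sum_i F i) z = \sum_i TD (F i) z.
Proof.
apply: (big_morph (fun x => TD x z)) => [x y|]; first exact: tens_dotDl.
by apply: (addrI (TD 0 z)); rewrite -tens_dotDl !addr0.
Qed.

(** An orthonormal basis of L^2(A, h) makes H (x) L^2(A, h) an orthogonal sum of copies of H. *)
Lemma tens_dotE x y : TD x y = \sum_i dot (crd i x) (crd i y).
Proof.
rewrite [in LHS](crd_sum cl oc x) tens_dot_suml.
apply: eq_bigr => i _; rewrite [in LHS](crd_sum cl oc y) (lin_sumE (lin_tens_dot _)).
rewrite (bigD1 i) //= big1 ?addr0 => [|j ji].
  by rewrite tens_dot_basis eqxx mul1r.
by rewrite tens_dot_basis eq_sym (negPf ji) mul0r.
Qed.

Lemma tens_dot_ge0 x : 0 <= TD x x.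
Proof. by rewrite tens_dotE; apply: sumr_ge0 => i _. Qed.

Lemma nsq_tens x : nsq TD x = \sum_i nsq dot (crd i x).
Proof. by rewrite /nsq tens_dotE raddf_sum. Qed.

Lemma nsq_tens_basis xi i : nsq TD (xi \ox o i) = nsq dot xi.
Proof. by rewrite /nsq tens_dot_basis eqxx mul1r. Qed.

Lemma crd_basis i j (xi : U) : crd i (xi \ox o j) = (i == j)%:R *: xi.
Proof. by rewrite crd_pure // co. Qed.

(** Taking a coordinate is adjoint to eta -> eta (x) o_i; hence functionals of a matrix entry are
    functionals of the whole operator. *)
Lemma dot_crd eta i y : dot eta (crd i y) = TD (eta \ox o i) y.
Proof.
rewrite tens_dotE (bigD1 i) //= crd_basis eqxx scale1r big1 ?addr0 // => j ji.
by rewrite crd_basis (negPf ji) scale0r dotC (lin0 (dotl _)) rmorph0.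
Qed.

Lemma tact_ext (S T : tens U A -> tens U A) : lin S -> lin T ->
  (forall i j xi, crd i (S (xi \ox o j)) = crd i (T (xi \ox o j))) ->
  forall x, S x = T x.
Proof.
move=> S_lin T_lin ST x; rewrite (crd_sum cl oc x) (lin_sumE S_lin) (lin_sumE T_lin).
apply: eq_bigr => j _; rewrite [LHS](crd_sum cl oc) [RHS](crd_sum cl oc).
by apply: eq_bigr => i _; rewrite ST.
Qed.

Lemma crd_tact_sum i X x : crd i (tact pi X x) = \sum_j pi (entry i j X) (crd j x).
Proof.
have [tl _] := bilin_tact A pib.
rewrite [in LHS](crd_sum cl oc x) (lin_sumE (tl X)) (lin_sumE (lin_crd c i)).
by apply: eq_bigr => j _; exact: crd_tact.
Qed.

(** Block by block: [b] bounds the single entries, and [nsq_sum] controls the sum along a row. *)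
Lemma bounded_tact X : bounded_operator TD (tact pi X).
Proof.
have /choice[b bP] : forall m, exists C, 0 <= C /\ forall x, nsq dot (pi m x) <= C * nsq dot x.
  by move=> m; have [C C0 CP] := nsq_bounded dot_ge0 (pi_bounded m); exists C.
have [C C0 CP] := nsq_sum dotl dotC dot_ge0 (index_enum J).
pose B := \sum_i \sum_j b (entry i j X).
apply: (bounded_nsq (dot := TD) tens_dot_ge0 (C := C * B)).
  exact: (proj1 (bilin_tact A pib) X).
move=> x; have nge y : 0 <= nsq dot y by exact: nsq_ge0.
rewrite [leLHS]nsq_tens /B mulr_sumr mulr_suml; apply: ler_sum => i _.
rewrite crd_tact_sum; apply: le_trans (CP _) _.
rewrite -mulrA ler_wpM2l // mulr_suml; apply: ler_sum => j _.
have [b0 bj] := bP (entry i j X); apply: le_trans (bj _) _.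
apply: ler_wpM2l => //; rewrite nsq_tens (bigD1 j) //= lerDl.
exact: sumr_ge0.
Qed.

Lemma weak_lt_crd i j xi eta (S T : tens U A -> tens U A) e :
  weak_lt TD (fun n => xi n \ox o i) (fun n => eta n \ox o j) (fun x => S x - T x) e ->
  weak_lt dot xi eta (fun x => crd i (S (x \ox o j)) - crd i (T (x \ox o j))) e.
Proof.
move=> [N NP]; exists N => n /NP.
by under [in X in _ -> X]eq_bigr => k _ do rewrite -(linB (lin_crd c i)) dot_crd.
Qed.

Lemma weak_admissible_tens xi i : weak_admissible w dot xi ->
  weak_admissible w TD (fun n => xi n \ox o i).
Proof.
case: (w) => [[N NP]|[C CP]]; [exists N => n /NP -> | exists C => N].
  exact: (lin0 (lin_pure1 _ (@lin_id _ _))).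
apply: le_trans (CP N); apply: ler_sum => n _.
by rewrite !hilbert_norm_nsq // ?nsq_tens_basis //; exact: tens_dot_ge0.
Qed.

Definition weak_null : set (set M) := [set V |
  exists (n : nat) (xi eta : 'I_n -> nat -> U) (d : R), [/\ 0 < d,
    forall j, weak_admissible w dot (xi j) /\ weak_admissible w dot (eta j) &
    forall m, (forall j, weak_lt dot (xi j) (eta j) (pi m) d) -> V m]]%classic.

Lemma weak_nullS V V' : weak_null V -> (forall m, V m -> V' m) -> weak_null V'.
Proof.
by move=> [n [xi [eta [d [d0 adm dV]]]]] VV'; exists n, xi, eta, d; split=> // m /dV/VV'.
Qed.

Lemma weak_nullT : weak_null setT.
Proof. by exists 0%N, (fun _ _ => 0), (fun _ _ => 0), 1; split=> // -[]. Qed.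

Lemma weak_nullI V V' : weak_null V -> weak_null V' -> weak_null (V `&` V')%classic.
Proof.
move=> [n [xi [eta [d [d0 adm dV]]]]] [n' [xi' [eta' [d' [d'0 adm' dV']]]]].
pose f (z : 'I_n -> nat -> U) (z' : 'I_n' -> nat -> U) (j : 'I_(n + n')) :=
  match fintype.split j with inl k => z k | inr k => z' k end.
exists (n + n')%N, (f xi xi'), (f eta eta'), (Num.min d d'); split=> [|j|m mP].
- by rewrite lt_min d0.
- by rewrite /f; case: (fintype.split j) => k; [exact: adm | exact: adm'].
split; [apply: dV => k | apply: dV' => k].
  have := mP (unsplit (inl k)); rewrite /f unsplitK; apply: weak_lt_le.
  by rewrite ge_min lexx.
have := mP (unsplit (inr k)); rewrite /f unsplitK; apply: weak_lt_le.
by rewrite ge_min lexx orbT.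
Qed.

Lemma weak_null_all (I : eqType) (s : seq I) (V : I -> set M) :
  (forall i, weak_null (V i)) -> weak_null [set m | forall i, i \in s -> V i m]%classic.
Proof.
move=> nV; elim: s => [|i s IH]; first by apply: weak_nullS weak_nullT _.
apply: weak_nullS (weak_nullI (nV i) IH) _ => m [Vm sm] j.
by rewrite inE => /orP[/eqP ->|/sm].
Qed.

Lemma weak_null_filter : null_filter weak_null.
Proof.
have [pil1 pil2] := pib.
split=> [|V V'|V [n [xi [eta [d [d0 adm dV]]]]]|a V [n [xi [eta [d [d0 adm dV]]]]]
  |V [n [xi [eta [d [d0 adm dV]]]]]|x xV].
- exact: weak_nullT.
- exact: weak_nullI.
- exists [set m | forall j, weak_lt dot (xi j) (eta j) (pi m) (d / 2)]%classic.
    by exists n, xi, eta, (d / 2); split=> //; rewrite divr_gt0.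
  move=> x y xd yd; apply: dV => j; rewrite [d]splitr.
  apply: eq_weak_lt (weak_ltD dotl (xd j) (yd j)) => z.
  by rewrite (linD (pil2 z)).
- apply: (@weak_nullS [set m | forall j, j \in enum 'I_n ->
      weak_lt dot (xi j) (eta j) (pi (act a m)) d]%classic); last first.
    by move=> m mP; apply: dV => j; apply: mP; rewrite mem_enum.
  apply: (@weak_null_all _ (enum 'I_n) (fun j =>
    [set m | weak_lt dot (xi j) (eta j) (pi (act a m)) d]%classic)) => j.
  have [admx adme] := adm j.
  have [n' [xi' [eta' [d' [d'0 adm' dP]]]]] := act_cont a (0 : M) admx adme d0.
  exists n', xi', eta', d'; split=> // m mP.
  have := dP m; rewrite subr0 (lin0 (proj1 actl a)) subr0; exact.
- apply: dV => j; apply: eq_weak_lt (weak_lt0 dotl (xi j) (eta j) d0) => z.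
  by rewrite (lin0 (pil2 z)).
- apply: (vn_inj vN) => z; apply: (hilbert_eq0 hs).
  (* A vector at index 0 followed by zeros is admissible for both topologies; the pair for y and z
     tests the single coefficient [dot y (pi x z)]. *)
  pose delta (v : U) (n : nat) : U := if n == 0%N then v else 0.
  have adm v : weak_admissible w dot (delta v).
    have nn0 : hilbert_norm dot 0 = 0.
      by rewrite /hilbert_norm (lin0 (dotl 0)) raddf0 sqrtr0.
    case: (w); [by exists 1%N => -[] | exists (hilbert_norm dot v ^+ 2) => -[|N]].
      by rewrite big_ord0 sqr_ge0.
    rewrite big_ord_recl big1 ?addr0 // => k _.
    by rewrite /delta /= nn0 expr0n.
  set y := pi x z; apply: Normc.eq0_normc; apply/eqP; rewrite eq_le; apply/andP; split; last first.
    by rewrite /Normc.normc; case: (dot y y) => ? ?; exact: sqrtr_ge0.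
  rewrite leNgt; apply/negP => y0.
  have : [set m | weak_lt dot (delta y) (delta z) (pi m) (Normc.normc (dot y y))]%classic x.
    apply: xV; exists 1%N, (fun=> delta y), (fun=> delta z), (Normc.normc (dot y y)).
    by split=> // m; apply; exact: ord0.
  (* With N + 1 terms the partial sum contains index 0 even when N = 0. *)
  move=> [N /(_ N.+1 (leqnSn N))]; rewrite big_ord_recl big1 ?addr0 => [|k _].
    by rewrite /delta /= -/y ltxx.
  by rewrite /delta /= dotC (lin0 (dotl _)) rmorph0.
Qed.

Local Notation op q := (tens_op pi (LambdaQ q)).

(** The approximation hypothesis is used twice. For one entry at a time it puts T_ij in the closed
    set pi(M), which produces X with T = [tens_op pi X]; for all entries at once it puts X in the
    entrywise closure of the range, where [range_LambdaQ_closed] applies. *)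
Lemma range_LambdaQ_weak_closed : weak_closed w TD (range (fun q => op q)).
Proof.
move=> T bT TS; have Tl : lin T := proj1 bT.
have [tactl1 tactl2] := bilin_tact A pib.
have Tfin (I : finType) : weak_approx w TD (range (fun q => op q)) T I.
  by apply: weak_approx_finType => n; exact: TS.
pose Tij i j xi := crd i (T (xi \ox o j)).
have Tij_pi i j : range pi (Tij i j).
  apply: (vn_closed vnI) => [|n xi eta e e0 adm].
    have [C C0 CP] := nsq_bounded tens_dot_ge0 bT.
    apply: (bounded_nsq dot_ge0 (C := C)).
      by apply: (lin_comp (lin_crd c i)); apply: (lin_comp Tl); exact: (lin_pure1 _ (@lin_id _ _)).
    move=> xi; apply: le_trans (_ : nsq TD (T (xi \ox o j)) <= _).
      rewrite nsq_tens (bigD1 i) //= lerDl; apply: sumr_ge0 => k _; exact: nsq_ge0.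
    by apply: le_trans (CP _) _; rewrite nsq_tens_basis.
  have [|_ [q _ <-] TT'] := TS n (fun k m => xi k m \ox o i) (fun k m => eta k m \ox o j) e e0.
    by move=> k; have [? ?] := adm k; split; exact: weak_admissible_tens.
  exists (pi (entry i j (LambdaQ q))) => [|k]; first by exists (entry i j (LambdaQ q)).
  apply: eq_weak_lt (weak_lt_crd (TT' k)) => z; congr (_ - _).
  exact: crd_tact.
have /choice[m mP] : forall ij, exists m, pi m = Tij ij.1 ij.2.
  by move=> ij; have [m _ mE] := Tij_pi ij.1 ij.2; exists m.
pose X := \sum_k \sum_l (m (k, l) \ox munit k l).
have XE i j : entry i j X = m (i, j).
  exact: (entry_munit_sum cl co (fun k l => m (k, l))).
have TX : T = tens_op pi X.
  apply/funext; apply: tact_ext => //; first exact: tactl1.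
  by move=> i j xi; rewrite (crd_tact o cl i j X xi pib) XE mP.
have [q _ qX] : range LambdaQ X.
  apply: (range_LambdaQ_closed cl oc weak_null_filter) => V [n [xi [eta [d [d0 adm dV]]]]].
  (* One test pair for each of the n given pairs and each matrix position, so that a single q serves
     all entries. *)
  have [|_ [q _ <-] TT'] := Tfin ('I_n * (J * J))%type
      (fun k a => xi k.1 a \ox o k.2.1) (fun k a => eta k.1 a \ox o k.2.2) d d0.
    by move=> k; have [? ?] := adm k.1; split; exact: weak_admissible_tens.
  exists (LambdaQ q) => [|i j]; first by exists q.
  apply: dV => k; apply: eq_weak_lt (weak_lt_crd (TT' (k, (i, j)))) => z.
  rewrite (linB (lin_entry o c i j)) (linB (proj2 pib z)) TX.
  by congr (_ - _); exact: crd_tact.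
by exists q => //; rewrite TX qX.
Qed.

Lemma tens_dot_mstar Z x y : TD x (tact pi Z y) = TD (tact pi (mstar Z) x) y.
Proof.
rewrite !tens_dotE.
transitivity (\sum_i \sum_j dot (crd i x) (pi (entry i j Z) (crd j y))).
  by apply: eq_bigr => i _; rewrite crd_tact_sum (lin_sumE (dotl _)).
rewrite exchange_big; apply: eq_bigr => j _.
rewrite crd_tact_sum (dot_suml dotl dotC); apply: eq_bigr => i _.
by rewrite entry_mstar (vn_star vN).
Qed.

Lemma von_neumann_range_LambdaQ : von_neumann_algebra w TD (range (fun q => op q)).
Proof.
have [tactl1 tactl2] := bilin_tact A pib; have ll := lin_LambdaQ.
split.
- by move=> _ [q _ <-]; exact: bounded_tact.
- exists 0 => //; apply/funext => x; rewrite (lin0 ll); exact: (lin0 (tactl2 x)).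
- move=> _ _ [q _ <-] [q' _ <-]; exists (q + q') => //; apply/funext => x.
  rewrite (linD ll); exact: (linD (tactl2 x)).
- move=> k _ [q _ <-]; exists (k *: q) => //; apply/funext => x.
  rewrite (linZ ll); exact: (linZ (tactl2 x)).
- move=> _ _ [q _ <-] [q' _ <-].
  have [[s ->] [t ->]] := (crossed_classP q, crossed_classP q').
  exists (crossed_class act (crossed_mul act s t)) => //; apply/funext => x.
  rewrite !LambdaQE Lambda0_mul.
  exact: (tact_mul pib _ _ _ (vn_mul vN)).
- move=> _ [q _ <-]; have [t ->] := crossed_classP q.
  exists (op (crossed_class act (crossed_star act t))).
    by exists (crossed_class act (crossed_star act t)).
  move=> x y; rewrite !LambdaQE (Lambda0_star h_haar h_pos).
  exact: tens_dot_mstar.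
- exact: range_LambdaQ_weak_closed.
Qed.
End VonNeumannCase.
End CrossedMap.

Theorem theorem3p4p2 (R : realType) (A : weakCstarHopfType R)
    (M : starAlgType R) (act : A -> M -> M) (h : 'Hom(A, R[i]^o))
    (act_alg : module_algebra act)
    (h_haar : haar_integral h) (h_pos : faithful_positive h) :
  exists Lambda : {linear crossed_product act -> tens M 'End(A)},
    (forall (m : M) (a : A),
       Lambda (crossed act m a)
       = mend_mul (tauL_coaction act m) (1 \ox ell a)) /\
    injective Lambda /\
    (forall s t : tens M A,
       Lambda (crossed_class act (crossed_mul act s t))
       = mend_mul (Lambda (crossed_class act s))
           (Lambda (crossed_class act t))) /\
    (forall t : tens M A,
       Lambda (crossed_class act (crossed_star act t))
       = mend_star h (Lambda (crossed_class act t))) /\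
    (forall (m : M) (a : A) (phi : 'Hom(A, R[i]^o)),
       Lambda (crossed act m (harpoonl phi a))
       = \sw_(phi1, phi2 <- hat_comul phi)
           mend_mul
             (mend_mul (1 \ox tauR phi1) (Lambda (crossed act m a)))
             (1 \ox tauR (hat_antipode A phi2))) /\
    (forall (nrm : M -> R) (N : tens M 'End(A) -> R),
       cstar_norm *%R star nrm ->
       (forall a : A, norm_continuous nrm (act a)) ->
       cstar_norm (@mend_mul R A M) (mend_star h) N ->
       (forall m : M, N (m \ox \1%VF) = nrm m) ->
       cstar_subalgebra (@mend_mul R A M) (mend_star h) N (range Lambda)) /\
    (forall (w : weak_topology) (H : lmodType R[i]) (dot : H -> H -> R[i])
        (pi : M -> H -> H),
       von_neumann_on w dot pi ->
       (forall a : A, weakly_continuous w dot pi (act a)) ->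
       von_neumann_algebra w (tens_dot dot h)
         (range (fun x => tens_op pi (Lambda x)))).

Proof.
pose L : {linear crossed_product act -> tens M 'End(A)} :=
  HB.pack (LambdaQ (act := act))
    (GRing.isLinear.Build _ _ _ _ (LambdaQ (act := act)) (lin_LambdaQ act_alg)).
have LE t : L (crossed_class act t) = Lambda0 act t by exact: LambdaQE.
have L_star t : L (crossed_class act (crossed_star act t))
    = mend_star h (L (crossed_class act t)).
  by rewrite !LE; exact: Lambda0_star.
have L_mul s t : L (crossed_class act (crossed_mul act s t))
    = mend_mul (L (crossed_class act s)) (L (crossed_class act t)).
  by rewrite !LE; exact: Lambda0_mul.
(* Both topological statements take matrix entries in a basis orthonormal for the Haar scalar
   product. *)
have [o [oo oV]] := orthonormal_basis (lin_l2_dot h) (l2_dotC h_pos)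
  (l2_dot_ge0 h_pos) (l2_dot_eq0 h_pos).
exists L; split; first by move=> m a; rewrite -[RHS](Lambda0_pure act_alg); exact: LE.
split.
  move=> q q' E; rewrite -(LambdaQ_retract act_alg q) -(LambdaQ_retract act_alg q').
  exact: (congr1 (fun X => crossed_class act (retract act X)) E).
split; first exact: L_mul.
split; first exact: L_star.
split.
  move=> m a phi; rewrite -[crossed act m a]/(crossed_class act (m \ox a)) LE.
  by apply: (etrans (LE _)); exact: Lambda0_harpoonl.
split=> [nrm N nP act_cont NP N1|w U dot pi vN act_cont]; last first.
  exact: (von_neumann_range_LambdaQ act_alg h_haar h_pos oo oV vN act_cont).
split.
- by exists 0; rewrite ?linear0.
- by move=> _ _ [q _ <-] [q' _ <-]; exists (q + q'); rewrite ?linearD.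
- by move=> k _ [q _ <-]; exists (k *: q); rewrite ?linearZ.
- move=> _ _ [q _ <-] [q' _ <-].
  have [[s ->] [t ->]] := (crossed_classP q, crossed_classP q').
  by exists (crossed_class act (crossed_mul act s t)); last exact: L_mul.
- move=> _ [q _ <-]; have [t ->] := crossed_classP q.
  by exists (crossed_class act (crossed_star act t)); last exact: L_star.
- exact: (range_LambdaQ_norm_closed act_alg (fun i => lin_l2_dot h (o i)) oV nP act_cont NP N1).
Qed.
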